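(* Let $n\ge 1$. The families of Hohlweg--Lange associahedra $\mathrm{Ass}^{\mathrm I}_n(\sigma)$, $\sigma\in\{+,-\}^{n-1}$, and of Santos associahedra $\mathrm{Ass}^{\mathrm{II}}_n(T)$, $T$ a triangulation of a convex $(n+3)$-gon, considered up to normal isomorphism, have exactly one common element, namely the Chapoton--Fomin--Zelevinsky associahedron. That is, for a polytope $P$ the following are equivalent: (a) there are a sequence $\sigma\in\{+,-\}^{n-1}$ and a triangulation $T$ of the $(n+3)$-gon such that $P$ is normally isomorphic both to $\mathrm{Ass}^{\mathrm I}_n(\sigma)$ and to $\mathrm{Ass}^{\mathrm{II}}_n(T)$; (b) $P$ is normally isomorphic to the Chapoton--Fomin--Zelevinsky associahedron $\mathrm{CFZ}_n(A_n)$.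
   Context: **Normal isomorphism.** Two complete fans in real vector spaces $V,V'$ of the same dimension are linearly isomorphic if there is a linear isomorphism $V\to V'$ sending each cone of one fan to a cone of the other. Two polytopes are normally isomorphic if their normal fans are linearly isomorphic. (For a polytope that is not full-dimensional in its ambient space, the normal fan is taken modulo its lineality space, i.e. the polytope is considered as full-dimensional in its affine hull.) **Polygons.** A diagonal of a convex polygon means an internal diagonal. Two diagonals cross if they meet in a point interior to both. A triangulation of a convex $(n+3)$-gon (without new vertices) is identified with its set of $n$ pairwise non-crossing diagonals. **Hohlweg--Lange associahedra (type I).** For $\sigma\in\{+,-\}^{n-1}$ let $\widetilde\sigma=(+,-,\sigma,-,+)$, a sequence of $n+3$ signs indexed by $0,1,\dots,n+2$. Let $P_{n+3}(\sigma)$ be a convex $(n+3)$-gon with vertices labelled $0,1,\dots,n+2$ from left to right (increasing first coordinate), with the vertices of sign $+$ placed above a fixed horizontal line and those of sign $-$ placed below it. For a diagonal $ij$ ($i<j$) of $P_{n+3}(\sigma)$, let $R_{ij}(\sigma)$ be the set of vertices strictly below it, and let $S_{ij}(\sigma)$ be obtained from $R_{ij}(\sigma)$ by replacing $0$ by $i$ if $0\in R_{ij}(\sigma)$ and replacing $n+2$ by $j$ if $n+2\in R_{ij}(\sigma)$. Then $$\mathrm{Ass}^{\mathrm I}_n(\sigma)=\Big\{x\in\mathbb R^{n+1}:\ \sum_{i\in S_\delta(\sigma)}x_i\ge \tfrac12|S_\delta(\sigma)|(|S_\delta(\sigma)|+1)\text{ for all diagonals }\delta,\ \ x_1+\cdots+x_{n+1}=\tfrac{(n+1)(n+2)}2\Big\}.$$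 **Santos associahedra (type II).** Let $\alpha_1,\dots,\alpha_n$ be a basis of an $n$-dimensional real vector space $V$, and let $T_0=\{\delta_1,\dots,\delta_n\}$ be a triangulation of a convex $(n+3)$-gon (the seed triangulation). To each diagonal $pq$ associate $v_{pq}\in V$: $v_{pq}=-\alpha_i$ if $pq=\delta_i$, and $v_{pq}=\sum_{i:\ pq\text{ crosses }\delta_i}\alpha_i$ if $pq\notin T_0$. For each triangulation $T$ let $\mathbb R_{\ge0}T$ be the cone generated by $\{v_\delta:\delta\in T\}$. These cones are the maximal cones of a complete simplicial fan $\mathcal F_{T_0}$ in $V$, which is the normal fan of a polytope; $\mathrm{Ass}^{\mathrm{II}}_n(T_0)$ denotes any polytope with normal fan $\mathcal F_{T_0}$ (well defined up to normal isomorphism). **Chapoton--Fomin--Zelevinsky associahedron.** $\mathrm{CFZ}_n(A_n)$ is any polytope whose normal fan is $\mathcal F_{T_0}$ for $V=\{x\in\mathbb R^{n+1}:\sum x_i=0\}$, $\alpha_i=e_i-e_{i+1}$, and $T_0$ the snake triangulation with its diagonals numbered along the zigzag. The snake triangulation is the triangulation whose $n$ diagonals form a zigzag path: with vertices labelled cyclically by $\mathbb Z/(n+3)$, the diagonals are the consecutive segments of the path $1,\,n+3-1,\,2,\,n+3-2,\,3,\dots$ (of $n$ segments); equivalently, its dual tree is a path that alternates left and right turns. *)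

(* Defs.v *)
From HB Require Import structures.
From mathcomp Require Import all_boot all_order all_algebra.
From mathcomp Require Import boolp classical_sets reals.

Set Implicit Arguments.
Unset Strict Implicit.
Unset Printing Implicit Defensive.

Import Order.TTheory GRing.Theory Num.Theory.

Local Open Scope classical_set_scope.
Local Open Scope ring_scope.

Section Polytopes.
Variable R : realType.

Definition conv_hull (W : lmodType R) (I : finType) (D : pred I) (p : I -> W) :
    set W :=
  [set x | exists t : I -> R,
    [/\ forall i, 0 <= t i, \sum_(i | D i) t i = 1
      & x = \sum_(i | D i) t i *: p i]].

Definition conic_hull (W : lmodType R) (I : finType) (D : pred I) (p : I -> W) :
    set W :=
  [set x | exists t : I -> R,
    (forall i, 0 <= t i) /\ x = \sum_(i | D i) t i *: p i].

Definition polytope (W : vectType R) (P : set W) : Prop :=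
  exists (k : nat) (p : 'I_k -> W), P = conv_hull xpredT p.

(* The least subspace containing A; it exists since W is finite dimensional,
   so the default value 0 is never used. *)
Definition linear_span (W : vectType R) (A : set W) : {vspace W} :=
  xget 0%VS [set U : {vspace W} |
    (forall x, A x -> x \in U) /\
    (forall U' : {vspace W}, (forall x, A x -> x \in U') -> (U <= U')%VS)].

Definition direction (W : vectType R) (P : set W) : {vspace W} :=
  linear_span [set z | exists x y, [/\ P x, P y & z = x - y]].

Definition face (W : vectType R) (P F : set W) : Prop :=
  F !=set0 /\
  exists c : 'Hom(W, R^o),
    F = [set x | P x /\ forall y, P y -> (c y : R) <= c x].

(* Linear forms on the direction space of P, so that P is regarded as a full
   dimensional polytope in its affine hull and the lineality space is
   quotiented out. *)
Definition conormal_space (W : vectType R) (P : set W) : vectType R :=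
  'Hom(subvs_of (direction P), R^o).

Definition normal_cone (W : vectType R) (P F : set W) :
    set (conormal_space P) :=
  [set c : 'Hom(subvs_of (direction P), R^o) | forall x y, F x -> P y ->
    (c (vsproj (direction P) (y - x)) : R) <= 0].

Arguments normal_cone {W} P F.

(* Outer normals; passing to inner normals applies the isomorphism c |-> - c. *)
Definition normal_fan (W : vectType R) (P : set W) :
    set (set (conormal_space P)) :=
  [set C | exists F, face P F /\ C = normal_cone P F].

Arguments normal_fan {W} P.

Definition linearly_isomorphic (V V' : vectType R)
    (F : set (set V)) (F' : set (set V')) : Prop :=
  exists f : 'Hom(V, V'), bijective f /\ forall C, F C -> F' (f @` C).

Definition normally_isomorphic (W W' : vectType R) (P : set W) (P' : set W') :
    Prop :=
  linearly_isomorphic (normal_fan P) (normal_fan P').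

(* The normal fan of Q is F, the dual of the direction space of Q being
   identified with V through some linear isomorphism f. *)
Definition has_normal_fan (W V : vectType R) (Q : set W) (F : set (set V)) :
    Prop :=
  exists f : 'Hom(V, conormal_space Q),
    bijective f /\ normal_fan Q = [set f @` C | C in F].

End Polytopes.

Arguments normal_cone {R W} P F.
Arguments normal_fan {R W} P.

Section Polygons.
Variable R : realType.

(* Points of the plane are row vectors (abscissa, ordinate). *)
Definition abscissa (a : 'rV[R]_2) : R := a 0 0.
Definition ordinate (a : 'rV[R]_2) : R := a 0 1.

(* Positive iff c is strictly to the left of the line directed from a to b. *)
Definition orient (a b c : 'rV[R]_2) : R :=
  (abscissa b - abscissa a) * (ordinate c - ordinate a) -
  (abscissa c - abscissa a) * (ordinate b - ordinate a).

(* The p i are the distinct vertices of a convex polygon, in no special order: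
   none of them is in the convex hull of the others. *)
Definition convex_polygon (m : nat) (p : 'I_m -> 'rV[R]_2) : Prop :=
  forall k, ~ conv_hull (predC1 k) p (p k).

(* The segment between two vertices of a convex polygon is an internal
   diagonal, rather than an edge, when there are vertices strictly on both
   sides of it. *)
Definition internal (m : nat) (p : 'I_m -> 'rV[R]_2) (i j : 'I_m) : bool :=
  [exists k, orient (p i) (p j) (p k) < 0] &&
  [exists k, 0 < orient (p i) (p j) (p k)].

Definition is_diagonal (m : nat) (p : 'I_m -> 'rV[R]_2) (d : 'I_m * 'I_m) : bool :=
  (d.1 < d.2)%N && internal p d.1 d.2.

Definition cyclically_labelled (m : nat) (p : 'I_m -> 'rV[R]_2) : Prop :=
  forall i, ~~ internal p i (ordS i).

Definition open_segment (a b : 'rV[R]_2) : set 'rV[R]_2 :=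
  [set x | exists t : R, 0 < t < 1 /\ x = (1 - t) *: a + t *: b].

(* Meant for distinct diagonals only. *)
Definition crosses (m : nat) (p : 'I_m -> 'rV[R]_2) (d e : 'I_m * 'I_m) : Prop :=
  exists x, open_segment (p d.1) (p d.2) x /\ open_segment (p e.1) (p e.2) x.

Definition triangulation (n : nat) (p : 'I_n.+3 -> 'rV[R]_2)
    (T : {set 'I_n.+3 * 'I_n.+3}) : Prop :=
  [/\ #|T| = n,
      forall d, d \in T -> is_diagonal p d
    & forall d e, d \in T -> e \in T -> d != e -> ~ crosses p d e].

End Polygons.

Section HohlwegLange.
Variable R : realType.

(* true stands for the sign + *)
Definition extended_signs (n : nat) (s : (n.-1).-tuple bool) : seq bool :=
  [:: true, false & s ++ [:: false; true]].

Definition HL_polygon (n : nat) (s : (n.-1).-tuple bool)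
    (p : 'I_n.+3 -> 'rV[R]_2) : Prop :=
  [/\ convex_polygon p,
      forall i j : 'I_n.+3, (i < j)%N -> abscissa (p i) < abscissa (p j)
    & exists h : R, forall k : 'I_n.+3,
        if nth true (extended_signs s) k then h < ordinate (p k)
        else ordinate (p k) < h].

(* Vertices on the right of the line directed from p d.1 to p d.2; as p d.1 is
   on the left of p d.2, these are the vertices strictly below that line. *)
Definition HL_R (n : nat) (p : 'I_n.+3 -> 'rV[R]_2) (d : 'I_n.+3 * 'I_n.+3) :
    {set 'I_n.+3} :=
  [set k | orient (p d.1) (p d.2) (p k) < 0]%SET.

Definition HL_S (n : nat) (p : 'I_n.+3 -> 'rV[R]_2) (d : 'I_n.+3 * 'I_n.+3) :
    {set 'I_n.+3} :=
  [set if k == ord0 then d.1 else if k == ord_max then d.2 else k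
     | k in HL_R p d]%SET.

(* The coordinate x_k, for 1 <= k <= n + 1, has index k - 1 in 'I_n.+1. *)
Definition coord1 (n : nat) (x : 'rV[R]_(n.+1)) (k : nat) : R :=
  x 0 (inord k.-1).

Definition Ass_I (n : nat) (p : 'I_n.+3 -> 'rV[R]_2) : set 'rV[R]_(n.+1) :=
  [set x |
    (forall d, is_diagonal p d ->
       (#|HL_S p d| * #|HL_S p d|.+1)%:R / 2 <=
         \sum_(k in HL_S p d) coord1 x k)
    /\ \sum_(1 <= k < n.+2) coord1 x k = (n.+1 * n.+2)%:R / 2].

End HohlwegLange.

Section Santos.
Variable R : realType.

Definition santos_vector (n : nat) (q : 'I_n.+3 -> 'rV[R]_2) (V : vectType R)
    (t : 'I_n -> 'I_n.+3 * 'I_n.+3) (a : 'I_n -> V) (d : 'I_n.+3 * 'I_n.+3) : V :=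
  if [pick i | t i == d] is Some i then - a i
  else \sum_(i < n | `[< crosses q d (t i) >]) a i.

(* The maximal cones are simplicial, so that their faces are the cones
   generated by the subsets D of the triangulations. *)
Definition santos_fan (n : nat) (q : 'I_n.+3 -> 'rV[R]_2) (V : vectType R)
    (t : 'I_n -> 'I_n.+3 * 'I_n.+3) (a : 'I_n -> V) : set (set V) :=
  [set C | exists T D : {set 'I_n.+3 * 'I_n.+3},
    [/\ triangulation q T, D \subset T
      & C = conic_hull (mem D) (santos_vector q t a)]].

Definition is_Ass_II (n : nat) (q : 'I_n.+3 -> 'rV[R]_2)
    (T0 : {set 'I_n.+3 * 'I_n.+3}) (W : vectType R) (Q : set W) : Prop :=
  polytope Q /\
  exists (V : vectType R) (a : 'I_n -> V) (t : 'I_n -> 'I_n.+3 * 'I_n.+3),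
    [/\ basis_of fullv (codom a), T0 = [set t i | i : 'I_n]%SET
      & has_normal_fan Q (santos_fan q t a)].

Definition snake_vertex (n k : nat) : 'I_n.+3 :=
  inord (if odd k then (n + 3 - k./2.+1)%N else k./2.+1).

Definition snake (n : nat) (i : 'I_n) : 'I_n.+3 * 'I_n.+3 :=
  let a := snake_vertex n i in
  let b := snake_vertex n i.+1 in
  if (a < b)%N then (a, b) else (b, a).

Definition sum_zero (n : nat) : {vspace 'rV[R]_(n.+1)} :=
  lker (linfun (fun x : 'rV[R]_(n.+1) => \sum_i x 0 i : R^o)).

Definition root_A (n : nat) (i : 'I_n) : subvs_of (sum_zero n) :=
  vsproj (sum_zero n)
    (delta_mx 0 (widen_ord (leqnSn n) i) - delta_mx 0 (lift ord0 i)).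

Definition is_CFZ (n : nat) (q : 'I_n.+3 -> 'rV[R]_2)
    (W : vectType R) (Q : set W) : Prop :=
  polytope Q /\ has_normal_fan Q (santos_fan q (@snake n) (@root_A n)).

End Santos.

(* Main.v *)
(* Let sigma alternate. Numbering the vertices of the polygon along the snake,
   the Santos vector of a diagonal d becomes a linear function of the indicator
   of its set S(d), and for crossing diagonals d, e the union and the
   intersection of S(d) and S(e) are the sets of two opposite sides of the
   quadrilateral they span. Since k(k+1)/2 is strictly convex, uncrossing shows
   that every triangulation T has a point where the inequalities of T are tight
   and all others are strict, and that every vector is a nonnegative
   combination over a triangulation. So Ass_I(sigma) has the snake fan.

   Conversely, let the fan of a seed T0 = {delta_i} be linearly isomorphic to
   the normal fan of Ass_I(sigma). The opposite rays of alpha_i and - alpha_i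
   give complementary sets S, one of which is an initial segment {1, ..., m_i};
   so alpha_i corresponds, up to a positive factor, to a signed indicator of
   that segment. A diagonal crossing exactly delta_i and delta_j then forces
   opposite signs for i and j, which excludes a triangle formed by three
   delta_i. If consecutive delta_1, delta_2, delta_3 shared a vertex, the
   diagonal crossing only delta_2 and one crossing just these three would span
   a cone, while the union and the intersection of their sets S would be those
   of the diagonals crossing {delta_1, delta_2} and {delta_2, delta_3}; by
   strict convexity the two facets do not meet. A triangulation without
   internal triangles and with at most two diagonals at each vertex is a
   snake. *)
From HB Require Import structures.
From mathcomp Require Import all_boot all_order all_algebra.
From mathcomp Require Import boolp classical_sets functions reals topology normedtype derive.
From mathcomp Require Import zify ring lra.
Require Import Defs.

Set Implicit Arguments.
Unset Strict Implicit.
Unset Printing Implicit Defensive.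

Import Order.TTheory GRing.Theory Num.Theory.
Import numFieldNormedType.Exports.

(** The obstacle is that two orders must be reconciled: Santos vectors depend on crossings, read off
    cyclic labels, while the sets S depend on the left to right labels of a polygon with prescribed
    signs. The zigzag labelling [zlab] translates between them and turns crossing into a comparison
    of left and of right ends. Plane geometry is reduced to the order of labels by means of
    orientations.

    For general sigma only the inequalities of Ass_I(sigma) are at hand, not its facets. So a ray of
    the given fan is matched with some inequality tight on its face; the normal of that inequality
    lies in the image of the same ray, which fixes the ray up to a positive factor.

    For completeness of the snake fan, a nonnegative representation of least cost is taken, the cost
    of S being |S|(n+1-|S|): it vanishes on the empty and the full set, which edges contribute, and
    is strictly submodular, so that uncrossing makes the support non-crossing.

    A normal isomorphism is only asked to send cones to cones. That it reaches every cone, and so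
    can be inverted, is proved for nonempty polytopes. *)

(** * Chords of a polygon *)

(* The chords ab and cd, both unordered, cross. *)
Definition cr (a b c d : nat) : bool :=
  [&& a != c, a != d, b != c, b != d &
      (a < c) (+) (b < c) (+) (a < d) (+) (b < d)].

Definition nonadj (m i j : nat) : bool :=
  [&& i < m, j < m & (i.+1 < j < i + m.-1) || (j.+1 < i < j + m.-1)].

Lemma crC a b c d : cr a b c d = cr b a c d.
Proof. rewrite /cr; lia. Qed.

Lemma crCr a b c d : cr a b c d = cr a b d c.
Proof. rewrite /cr; lia. Qed.

Lemma cr_swap a b c d : cr a b c d = cr c d a b.
Proof. rewrite /cr; lia. Qed.

Lemma nonadjC m i j : nonadj m i j = nonadj m j i.
Proof. rewrite /nonadj; lia. Qed.

(** Maximality replaces the cardinality [n] of a triangulation: in this form the notion is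
    transported by relabellings at once. [ctri_maximal] and [maximal_card] link the two. *)
Record maximal_noncrossing (m : nat) (t : rel nat) : Prop := MaximalNoncrossing {
  mn_sym : forall i j, t i j = t j i;
  mn_nonadj : forall i j, t i j -> nonadj m i j;
  mn_cr : forall i j k l, t i j -> t k l -> ~~ cr i j k l;
  mn_max : forall i j, nonadj m i j ->
    (forall k l, t k l -> ~~ cr i j k l) -> t i j }.

(** * Dihedral relabellings *)

Record dihedral (m : nat) (s : nat -> nat) : Prop := Dihedral {
  dih_lt : forall i, i < m -> s i < m;
  dih_surj : forall i, i < m -> exists2 j, j < m & s j = i;
  dih_inj : forall i j, i < m -> j < m -> s i = s j -> i = j;
  dih_cr : forall i j k l, i < m -> j < m -> k < m -> l < m ->
    cr (s i) (s j) (s k) (s l) = cr i j k l;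
  dih_nonadj : forall i j, i < m -> j < m ->
    nonadj m (s i) (s j) = nonadj m i j }.

Definition rotn (m x i : nat) := if i + x < m then i + x else i + x - m.
Definition refl0 (m i : nat) := if i == 0 then 0 else m - i.

(** [cr] adds four comparisons modulo 2, in which each of the four vertices occurs twice: the
    correction [w] cancels, and so does the global flip [b], occurring four times. A rotation flips
    the comparisons between labels that wrap around and labels that do not; a reflection flips all
    but those with the fixed vertex 0. *)
Lemma cr_coboundary m (s : nat -> nat) (w : nat -> bool) (b : bool) :
  (forall i j, i < m -> j < m -> s i = s j -> i = j) ->
  (forall i j, i < m -> j < m -> i != j -> (s i < s j) = (i < j) (+) b (+) w i (+) w j) ->
  forall i j k l, i < m -> j < m -> k < m -> l < m ->
  cr (s i) (s j) (s k) (s l) = cr i j k l.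
Proof.
move=> s_inj H i j k l li lj lk ll; rewrite /cr.
have E x y : x < m -> y < m -> (s x == s y) = (x == y).
  by move=> lx ly; apply/eqP/eqP => [/(s_inj _ _ lx ly)|->].
rewrite !E //; case: eqP => //= /eqP ik; case: eqP => //= /eqP il.
case: eqP => //= /eqP jk; case: eqP => //= /eqP jl; rewrite !H //.
by case: b {H}; case: (w i); case: (w j); case: (w k); case: (w l);
  case: (i < k); case: (j < k); case: (i < l); case: (j < l).
Qed.

Lemma dihedral_rotn m x : x < m -> dihedral m (rotn m x).
Proof.
rewrite /rotn => lt_xm.
have inj i j : i < m -> j < m -> rotn m x i = rotn m x j -> i = j.
  by rewrite /rotn; do !case: ifP; lia.
split=> //.
- by move=> i; case: ifP; lia.
- move=> i lt_im; exists (if x <= i then i - x else i + m - x); do !case: ifP; lia.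
- apply: (cr_coboundary (w := fun i => i + x < m) (b := false)) => // i j li lj ij.
  by case: ifP => wi; case: ifP => wj; move: ij wi wj; clear -li lj lt_xm; lia.
- by move=> i j; rewrite /nonadj; do !case: ifP; lia.
Qed.

Lemma dihedral_refl0 m : dihedral m (refl0 m).
Proof.
rewrite /refl0.
have inj i j : i < m -> j < m -> refl0 m i = refl0 m j -> i = j.
  by rewrite /refl0; do !case: ifP; lia.
split=> //.
- by move=> i; case: ifP; lia.
- move=> i lt_im; exists (if i == 0 then 0 else m - i); do !case: ifP; lia.
- apply: (cr_coboundary (w := fun i => i == 0) (b := true)) => // i j li lj ij.
  by case: (i =P 0) => zi; case: (j =P 0) => zj; move: ij zi zj; clear -li lj; lia.
- by move=> i j; rewrite /nonadj; do !case: ifP; lia.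
Qed.

Lemma dihedral_comp m s r :
  dihedral m s -> dihedral m r -> dihedral m (s \o r).
Proof.
move=> [ls ss si sc sn] [lr rs ri rc rn]; split => /=.
- by move=> i /lr/ls.
- by move=> i /ss[j /rs[k lk <-] <-]; exists k.
- by move=> i j li lj /(si _ _ (lr _ li) (lr _ lj)); exact: ri.
- by move=> i j k l *; rewrite sc ?rc ?lr.
- by move=> i j *; rewrite sn ?rn ?lr.
Qed.

Definition pullback (m : nat) (s : nat -> nat) (t : rel nat) : rel nat :=
  fun i j => [&& i < m, j < m & t (s i) (s j)].

Lemma maximal_noncrossing_pullback m s t :
  dihedral m s -> maximal_noncrossing m t ->
  maximal_noncrossing m (pullback m s t).
Proof.
move=> [ls ss si sc sn] [tsym tna tcr tmax]; rewrite /pullback; split.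
- by move=> i j; rewrite tsym andbCA.
- by move=> i j /and3P[li lj /tna]; rewrite sn.
- by move=> i j k l /and3P[? ? ?] /and3P[? ? ?]; rewrite -sc // tcr.
- move=> i j ij H; have /and3P[li lj _] := ij; rewrite li lj /=.
  apply: tmax => [|k l kl]; first by rewrite sn.
  have /and3P[lk ll _] := tna _ _ kl.
  have [k' lk' ek] := ss _ lk; have [l' ll' el] := ss _ ll.
  by rewrite -ek -el sc // H // lk' ll' /= ek el.
Qed.

Definition same_chord (i j : nat) (c : nat * nat) : bool :=
  ((i, j) == c) || ((j, i) == c).

Definition crosses_only (m : nat) (t : rel nat) (u w : nat)
    (cs : seq (nat * nat)) : Prop :=
  nonadj m u w /\ forall k l, t k l -> cr u w k l = has (same_chord k l) cs.

Lemma crosses_only_dihedral m s (t : rel nat) u w cs :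
  dihedral m s -> (forall i j, t i j -> nonadj m i j) ->
  u < m -> w < m -> all (fun c => (c.1 < m) && (c.2 < m)) cs ->
  crosses_only m (pullback m s t) u w cs ->
  crosses_only m t (s u) (s w) [seq (s c.1, s c.2) | c <- cs].
Proof.
move=> [ls ss si sc sn] tna lu lw /allP lcs [uw H]; split; first by rewrite sn.
move=> k l kl; have /and3P[lk ll _] := tna _ _ kl.
have [k' lk' ek] := ss _ lk; have [l' ll' el] := ss _ ll.
rewrite -ek -el sc // H; last by rewrite /pullback lk' ll' ek el.
rewrite has_map; apply: eq_in_has => -[a b] /lcs/= /andP[la lb].
have e x y : x < m -> y < m -> (s x == s y) = (x == y).
  by move=> lx ly; apply/eqP/eqP => [|->//]; apply: si.
by rewrite /same_chord /= !xpair_eqE !e.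
Qed.

(** * Diagonals at a vertex of a triangulation *)

Section Star.
Variables (m : nat) (t : rel nat).
Hypothesis m_gt3 : 3 < m.
Hypothesis tT : maximal_noncrossing m t.

(* Neighbours of 0, edges of the polygon included: a chord joining two of them
   only crosses diagonals at 0. *)
Definition nb0 (v : nat) : bool := [|| t 0 v, v == 1 | v == m.-1].

Lemma t0_bound v : t 0 v -> 1 < v < m.-1.
Proof. by move/(mn_nonadj tT); rewrite /nonadj; lia. Qed.

Lemma nb0_bound v : nb0 v -> 0 < v < m.
Proof. by rewrite /nb0 => /or3P[/t0_bound|/eqP->|/eqP->]; lia. Qed.

(** The sides [0u] and [0w] of the triangle [0uw] are edges or chords of [t], so a chord of [t]
    crossing the third side can only leave the triangle at the vertex 0. *)
Lemma star_cr u w k l : nb0 u -> nb0 w -> u < w -> t k l -> k < l ->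
  cr u w k l -> k = 0 /\ u < l < w.
Proof.
move=> nu nw uw kl ltkl crk.
have /and3P[lk ll _] := mn_nonadj tT kl.
have bu := nb0_bound nu; have bw := nb0_bound nw.
have cu : t 0 u -> ~~ cr 0 u k l by move=> tu; exact: mn_cr tT _ _ _ _ tu kl.
have cw : t 0 w -> ~~ cr 0 w k l by move=> tw; exact: mn_cr tT _ _ _ _ tw kl.
move: nu nw cu cw crk; rewrite /nb0 /cr.
by case: (t 0 u); case: (t 0 w) => /= ?? cu cw; lia.
Qed.

Lemma crosses_only_star u w cs : nb0 u -> nb0 w -> u.+1 < w ->
  (forall l, u < l < w -> t 0 l -> (0, l) \in cs) ->
  all (fun c => (c.1 == 0) && (u < c.2 < w)) cs ->
  crosses_only m t u w cs.
Proof.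
move=> nu nw uw Hcs /allP csP.
have bu := nb0_bound nu; have bw := nb0_bound nw.
have uw' : u < w by exact: ltnW.
split; first by rewrite /nonadj; lia.
move=> k l kl; apply/idP/hasP.
  move=> crk; case: (ltngtP k l) => [ltkl|ltlk|ekl].
  - have [k0 ul] := star_cr nu nw uw' kl ltkl crk.
    by exists (0, l); rewrite ?Hcs -?k0 // /same_chord eqxx.
  - rewrite (mn_sym tT) in kl; rewrite crCr in crk.
    have [k0 ul] := star_cr nu nw uw' kl ltlk crk.
    by exists (0, k); rewrite ?Hcs -?k0 // /same_chord eqxx orbT.
  - by move: (mn_nonadj tT kl); rewrite /nonadj; lia.
move=> [[a b] /csP/= /andP[/eqP-> ub]].
by rewrite /same_chord !xpair_eqE /cr; lia.
Qed.

Lemma nb0_prev y : 1 < y -> exists u, [/\ nb0 u, u < y &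
  forall l, u < l < y -> ~~ t 0 l].
Proof.
move=> lty; have ex1 : exists v, nb0 v && (v < y).
  by exists 1; rewrite /nb0 eqxx orbT lty.
have bd v : nb0 v && (v < y) -> v <= y by lia.
have [u /andP[nu uy] umax] := ex_maxnP ex1 bd; exists u; split=> // l /andP[ul ly].
by apply/negP => tl; have := umax l; rewrite /nb0 tl ly /= => /(_ isT); lia.
Qed.

Lemma nb0_next y : y < m.-1 -> exists u, [/\ nb0 u, y < u &
  forall l, y < l < u -> ~~ t 0 l].
Proof.
move=> lty; have ex1 : exists v, nb0 v && (y < v).
  by exists m.-1; rewrite /nb0 eqxx !orbT lty.
have [u /andP[nu uy] umin] := ex_minnP ex1; exists u; split=> // l /andP[ul ly].
by apply/negP => tl; have := umin l; rewrite /nb0 tl ul /= => /(_ isT); lia.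
Qed.

(** The two neighbours of 0 next to [y] span the other diagonal of the quadrilateral around the
    chord [0y]. *)
Lemma flip0 y : t 0 y -> exists u w, crosses_only m t u w [:: (0, y)].
Proof.
move=> ty; have by_ := t0_bound ty.
have [|u [nu uy Hu]] := @nb0_prev y; first by lia.
have [|w [nw yw Hw]] := @nb0_next y; first by lia.
exists u, w; apply: crosses_only_star => //; first by lia.
  move=> l ulw tl; case: (ltngtP l y) => [ly|ly|->]; last by rewrite inE.
  - by move: (Hu l); rewrite tl; lia.
  - by move: (Hw l); rewrite tl; lia.
by rewrite /= uy yw.
Qed.

Lemma two_at0 y z : t 0 y -> t 0 z -> y < z ->
  (forall l, y < l < z -> ~~ t 0 l) ->
  exists u w, crosses_only m t u w [:: (0, y); (0, z)].
Proof.
move=> ty tz yz Hyz; have by_ := t0_bound ty; have bz := t0_bound tz.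
have [|u [nu uy Hu]] := @nb0_prev y; first by lia.
have [|w [nw yw Hw]] := @nb0_next z; first by lia.
exists u, w; apply: crosses_only_star => //; first by lia.
  move=> l ulw tl.
  case: (ltngtP l y) => [ly|ly|->]; last by rewrite inE eqxx.
    by move: (Hu l); rewrite tl; lia.
  case: (ltngtP l z) => [lz|lz|->]; last by rewrite !inE eqxx orbT.
    by move: (Hyz l); rewrite tl; lia.
  by move: (Hw l); rewrite tl; lia.
by rewrite /= uy yw; lia.
Qed.

(** A chord from 0 ending between [y] and [z] would cross [yz], so the two are consecutive around
    0. *)
Lemma triangle_at0 y z : t 0 y -> t 0 z -> t y z ->
  exists u w, crosses_only m t u w [:: (0, y); (0, z)].
Proof.
have H y' z' : t 0 y' -> t 0 z' -> t y' z' -> y' < z' ->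
    exists u w, crosses_only m t u w [:: (0, y'); (0, z')].
  move=> ty tz tyz yz; apply: two_at0 => // l l1; apply/negP => tl.
  by have := mn_cr tT tl tyz; have := t0_bound tl; have := t0_bound ty; rewrite /cr; lia.
move=> ty tz tyz; case: (ltngtP y z) => [|ltzy|eyz]; first exact: H.
  have [|u [w [? uw]]] := H _ _ tz ty _ ltzy; first by rewrite (mn_sym tT).
  exists u, w; split=> // k l kl; rewrite uw //=.
  by rewrite !orbF orbC.
by move: (mn_nonadj tT tyz); rewrite /nonadj; lia.
Qed.

(** [y1] is the least of the given neighbours of 0, [y2] and [y3] are the next ones, [y0] and [y4]
    the adjacent ones outside, which may be ends of edges. The other two given neighbours ensure
    that [y2] and [y3] are ends of diagonals. The four lists of crossed chords are the configuration
    that [ctri_snake] excludes. *)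
Lemma fan_at0 a b c : t 0 a -> t 0 b -> t 0 c -> uniq [:: a; b; c] ->
  exists ys y0 y1 y2 y3 y4,
  [/\ ys = [:: y0; y1; y2; y3; y4],
      sorted ltn ys, all (fun y => y < m) ys, all (t 0) [:: y1; y2; y3]
    & [/\ crosses_only m t y1 y3 [:: (0, y2)],
      crosses_only m t y0 y3 [:: (0, y1); (0, y2)],
      crosses_only m t y1 y4 [:: (0, y2); (0, y3)]
    & crosses_only m t y0 y4 [:: (0, y1); (0, y2); (0, y3)]]].
Proof.
wlog [ab bc] : a b c / a < b /\ b < c.
  move=> H ta tb tc; rewrite /= !inE.
  case: (ltngtP a b) => //= ab; case: (ltngtP b c) => //= bc;
  case: (ltngtP a c) => //= ac _; try lia.
  - by apply: (H a b c) => //=; rewrite ?inE; lia.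
  - by apply: (H a c b) => //=; rewrite ?inE; lia.
  - by apply: (H c a b) => //=; rewrite ?inE; lia.
  - by apply: (H b a c) => //=; rewrite ?inE; lia.
  - by apply: (H b c a) => //=; rewrite ?inE; lia.
  - by apply: (H c b a) => //=; rewrite ?inE; lia.
move=> ta tb tc _; have ba := t0_bound ta; have bb := t0_bound tb.
have bc' := t0_bound tc.
have [|y0 [n0 y0a H0]] := @nb0_prev a; first by lia.
have [|y2 [n2 ay2 H2]] := @nb0_next a; first by lia.
have y2b : y2 <= b by rewrite leqNgt; apply/negP => h; move: (H2 b); rewrite tb; lia.
have t2 : t 0 y2 by move: n2; rewrite /nb0 => /or3P[//|/eqP e|/eqP e]; lia.
have [|y3 [n3 y23 H3]] := @nb0_next y2; first by lia.
have y3c : y3 <= c by rewrite leqNgt; apply/negP => h; move: (H3 c); rewrite tc; lia.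
have t3 : t 0 y3 by move: n3; rewrite /nb0 => /or3P[//|/eqP e|/eqP e]; lia.
have [|y4 [n4 y34 H4]] := @nb0_next y3; first by lia.
have n1 : nb0 a by rewrite /nb0 ta.
have b0 := nb0_bound n0; have b4 := nb0_bound n4.
have split5 l : y0 < l < y4 -> t 0 l -> [|| l == a, l == y2 | l == y3].
  move=> bl tl; move: (H0 l) (H2 l) (H3 l) (H4 l); rewrite tl.
  by clear -bl; lia.
have N : [&& 0 < y0, y0 < a, a < y2, y2 < y3, y3 < y4 & y4 < m].
  by clear -b0 b4 y0a ay2 y23 y34; lia.
exists [:: y0; a; y2; y3; y4], y0, a, y2, y3, y4.
split; [by []|by rewrite /= y0a ay2 y23 y34|by clear -N; rewrite /=; lia| |].
  by rewrite /= ta t2 t3.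
have bd l : a < l < y3 \/ y0 < l < y3 \/ a < l < y4 -> y0 < l < y4.
  by clear -N; lia.
split; apply: crosses_only_star => //; try by clear -N; rewrite /=; lia.
all: move=> l bl tl; have := split5 l (bd l _) tl; rewrite !inE !xpair_eqE.
all: by clear -N bl; lia.
Qed.

End Star.

Lemma nonadj_root m (t : rel nat) i j : maximal_noncrossing m t -> t i j -> i < m /\ j < m.
Proof. by move=> tT /(mn_nonadj tT)/and3P[]. Qed.

Section StarAt.
Variables (m : nat) (t : rel nat).
Hypothesis m_gt3 : 3 < m.
Hypothesis tT : maximal_noncrossing m t.

Lemma rotate_to0 x : x < m -> exists s, [/\ dihedral m s, s 0 = x,
  maximal_noncrossing m (pullback m s t) &
  forall y, t x y -> exists2 y', y = s y' & pullback m s t 0 y'].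
Proof.
move=> lx; have dx := dihedral_rotn lx; exists (rotn m x); split => //.
- by rewrite /rotn add0n lx.
- exact: maximal_noncrossing_pullback.
move=> y txy; have [_ ly] := nonadj_root tT txy.
have [y' ly' ey] := dih_surj dx ly; exists y' => //.
by rewrite /pullback ly' ey /rotn add0n lx txy andbT; lia.
Qed.

Lemma flip_at x y : t x y -> exists u w, crosses_only m t u w [:: (x, y)].
Proof.
move=> txy; have [lx ly] := nonadj_root tT txy.
have [s [ds s0 sT]] := rotate_to0 lx => /(_ _ txy) [y' -> ty].
have [u [w uw]] := flip0 m_gt3 sT ty.
exists (s u), (s w); rewrite -s0.
have [??] : u < m /\ w < m by case: uw => /and3P[].
apply: (crosses_only_dihedral (t := t) (cs := [:: (0, y')]) ds) => //.
- exact: mn_nonadj tT.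
- by rewrite /= andbT; case/and3P: ty => -> ->.
Qed.

Lemma triangle_at x y z : t x y -> t x z -> t y z ->
  exists u w, crosses_only m t u w [:: (x, y); (x, z)].
Proof.
move=> txy txz tyz; have [lx ly] := nonadj_root tT txy.
have [s [ds s0 sT S]] := rotate_to0 lx.
have [y' ey ty] := S _ txy; have [z' ez tz] := S _ txz; subst y z.
have /and3P[_ ly' _] := ty; have /and3P[l0 lz' _] := tz.
have tyz' : pullback m s t y' z' by rewrite /pullback ly' lz'.
have [u [w uw]] := triangle_at0 m_gt3 sT ty tz tyz'.
exists (s u), (s w); rewrite -s0.
have [??] : u < m /\ w < m by case: uw => /and3P[].
apply: (crosses_only_dihedral (t := t) (cs := [:: (0, y'); (0, z')]) ds) => //.
- exact: mn_nonadj tT.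
- by rewrite /= l0 ly' lz'.
Qed.

Lemma fan_at x a b c : t x a -> t x b -> t x c -> uniq [:: a; b; c] ->
  exists y0 y1 y2 y3 y4,
  [/\ uniq [:: y1; y2; y3], all (t x) [:: y1; y2; y3], ~~ cr y1 y3 y0 y4 &
  [/\ crosses_only m t y1 y3 [:: (x, y2)],
      crosses_only m t y0 y3 [:: (x, y1); (x, y2)],
      crosses_only m t y1 y4 [:: (x, y2); (x, y3)]
    & crosses_only m t y0 y4 [:: (x, y1); (x, y2); (x, y3)]]].
Proof.
move=> txa txb txc; have [lx ly] := nonadj_root tT txa.
have [s [ds s0 sT S]] := rotate_to0 lx.
have [a' ea ta] := S _ txa; have [b' eb tb] := S _ txb.
have [c' ec tc] := S _ txc; subst a b c.
rewrite -[X in uniq X]/(map s [:: a'; b'; c']) => /map_uniq uabc.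
have [ys [y0 [y1 [y2 [y3 [y4 [eys sys lys tys [H13 H03 H14 H04]]]]]]]] :=
  fan_at0 m_gt3 sT ta tb tc uabc; subst ys.
move: lys => /= /and5P[l0' l1 l2 l3 /andP[l4 _]].
move: tys => /= /and4P[t1 t2 t3 _].
move: sys => /= /and5P[y01 y12 y23 y34 _].
exists (s y0), (s y1), (s y2), (s y3), (s y4).
have lx0 : 0 < m by exact: leq_ltn_trans lx.
have tna := mn_nonadj tT.
split.
- change (is_true (uniq (map s [:: y1; y2; y3]))).
  rewrite map_inj_in_uniq; first by rewrite /= !inE; clear -y12 y23; lia.
  by move=> u w; rewrite !inE => /or3P[]/eqP-> /or3P[]/eqP->; apply: (dih_inj ds).
- rewrite /= -s0.
  by move: t1 t2 t3; rewrite /pullback => /and3P[_ _ ->] /and3P[_ _ ->] /and3P[_ _ ->].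
- by rewrite (dih_cr ds) // /cr; clear -y01 y12 y23 y34; lia.
- rewrite -s0; split.
  + by apply: (crosses_only_dihedral (cs := [:: (0, y2)]) ds) => //=; rewrite ?lx0 ?l1 ?l2 ?l3.
  + by apply: (crosses_only_dihedral (cs := [:: (0, y1); (0, y2)]) ds) => //=; rewrite ?lx0 ?l1 ?l2 ?l3.
  + by apply: (crosses_only_dihedral (cs := [:: (0, y2); (0, y3)]) ds) => //=; rewrite ?lx0 ?l1 ?l2 ?l3.
  + by apply: (crosses_only_dihedral (cs := [:: (0, y1); (0, y2); (0, y3)]) ds) => //=; rewrite ?lx0 ?l1 ?l2 ?l3.
Qed.

End StarAt.

(** * Counting the triangles of a triangulation *)

Section Apex.
Variables (m : nat) (t : rel nat).

(** The edge from 0 to [m.-1] serves as a root: each triangle then lies beneath exactly one of these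
    chords, and its middle vertex is a label strictly between 0 and [m.-1]. Counting middle vertices
    counts chords. *)
Definition tplus (i j : nat) : bool := t i j || (i == 0) && (j == m.-1).

(* The third vertex of the triangle on the side of the chord ij facing the
   vertices between i and j. *)
Definition apex (i j : nat) : nat :=
  \max_(k < j | (k == i.+1 :> nat) || (i < k) && t i k) k.

Lemma apexP i j : i.+1 < j -> [/\ i < apex i j < j,
    (apex i j == i.+1) || t i (apex i j)
  & forall k, i < k < j -> t i k -> k <= apex i j].
Proof.
move=> ij; pose P (k : 'I_j) := (k == i.+1 :> nat) || (i < k) && t i k.
have Pi : P (Ordinal ij) by rewrite /P eqxx.
have P0 : 0 < #|P| by apply/card_gt0P; exists (Ordinal ij).
have [k0 Pk0 e] := eq_bigmax_cond (fun k : 'I_j => nat_of_ord k) P0.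
have ea : apex i j = k0 by rewrite -e.
rewrite ea; move: Pk0; rewrite unfold_in /P => Pk0; split.
- by have := ltn_ord k0; move/orP: Pk0 => [/eqP->|/andP[]]; lia.
- by move/orP: Pk0 => [->//|/andP[_ ->]]; rewrite orbT.
move=> k /andP[ik kj] tik; rewrite -ea.
by apply: (leq_bigmax_cond (Ordinal kj)) => /=; rewrite ik tik orbT.
Qed.

Hypothesis t_nonadj : forall i j, t i j -> nonadj m i j.
Hypothesis t_cr : forall i j k l, t i j -> t k l -> ~~ cr i j k l.

Lemma tplus_lt i j : 2 < m -> tplus i j -> i < j -> i.+1 < j < m.
Proof. by move=> m2 /orP[/t_nonadj|/andP[/eqP-> /eqP->]]; rewrite /nonadj; lia. Qed.

(** With a common middle vertex [c] and [i < i'], the chord [ic] would cross [i'j']; with [i = i']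
    and [j < j'], the choice of [c] as last neighbour of [i] before [j'] gives [j <= c]. *)
Lemma apex_inj i j i' j' : 2 < m -> tplus i j -> tplus i' j' -> i < j -> i' < j' ->
  apex i j = apex i' j' -> (i, j) = (i', j').
Proof.
move=> m2 tij tij' ij ij' e.
have tt k l k' l' : tplus k l -> tplus k' l' -> k < l -> k' < l' -> ~~ cr k l k' l'.
  move=> tk tk' kl kl'; have b1 := tplus_lt m2 tk kl; have b2 := tplus_lt m2 tk' kl'.
  move: tk tk'; rewrite /tplus => /orP[tk|/andP[/eqP-> /eqP->]];
    last by rewrite /cr; lia.
  by move=> /orP[tk'|/andP[/eqP-> /eqP->]]; [exact: t_cr|rewrite /cr; lia].
wlog lei : i j i' j' tij tij' ij ij' e / (i < i') || (i == i') && (j <= j').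
  move=> H; case: (ltngtP i i') => ii'.
  - by apply: H => //; rewrite ii'.
  - by apply/esym/H => //; rewrite ii'.
  - by case: (leqP j j') => jj'; [|apply/esym]; apply: H => //; rewrite ii' eqxx /= ?jj' ?orbT; lia.
have b1 := tplus_lt m2 tij ij; have b2 := tplus_lt m2 tij' ij'.
have [|a1 a2 a3] := @apexP i j; first by lia.
have [|a1' a2' a3'] := @apexP i' j'; first by lia.
case/orP: lei => [ii'|/andP[/eqP ii' jj']].
  exfalso; move: a2; case: eqP => [|_ /= tia]; first by lia.
  have : ~~ cr i (apex i j) i' j' by apply: tt => //; [rewrite /tplus tia|lia].
  by rewrite /cr; lia.
subst i'; move: jj'; rewrite leq_eqVlt => /orP[/eqP->//|jj']; exfalso.
have tij1 : t i j.
  by move: tij => /orP[//|/andP[_ /eqP ej]]; exfalso; clear -b2 jj' ej; lia.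
have := a3' j; rewrite ij jj' tij1 => /(_ isT isT); rewrite -e => h.
by clear -h a1; lia.
Qed.

Hypothesis t_sym : forall i j, t i j = t j i.
Hypothesis t_max : forall i j, nonadj m i j ->
    (forall k l, t k l -> ~~ cr i j k l) -> t i j.

(** A chord crossing the third side would cross one of the other two sides or start at [i] beyond
    the apex, against the choice of the apex; maximality then puts the third side in [t] unless it
    is an edge. *)
Lemma apex_right i j : 2 < m -> tplus i j -> i < j ->
  (j == (apex i j).+1) || t (apex i j) j.
Proof.
move=> m2 tij ij; have b := tplus_lt m2 tij ij.
have [|a1 a2 a3] := @apexP i j; first by lia.
set c := apex i j in a1 a2 a3 *.
case: eqP => //= nj; apply: t_max => [|k l kl].
  rewrite /nonadj; move: tij a2; rewrite /tplus => /orP[/t_nonadj|]; rewrite /nonadj; lia.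
wlog kltl : k l kl / k < l.
  move=> H; case: (ltngtP k l) => [?|?|?]; first exact: H.
    by rewrite crCr; apply: H => //; rewrite t_sym.
  by move: (t_nonadj kl); rewrite /nonadj; lia.
have h1 : t i j -> ~~ cr i j k l by move=> h; apply: t_cr.
have h2 : t i c -> ~~ cr i c k l by move=> h; apply: t_cr.
have h3 : i < l < j -> k = i -> l <= c by move=> h ek; apply: a3 => //; rewrite -ek.
move: (t_nonadj kl) tij a2 h1 h2 h3; rewrite /tplus /cr /nonadj.
by case: (t i j); case: (t i c); lia.
Qed.

(** Descent in the binary tree of triangles: if [c] is not the apex below [ij], it lies below one of
    the other two sides of that triangle, which is shorter. *)
Lemma apex_surj c : 2 < m -> 0 < c < m.-1 ->
  exists i j, [/\ i < j, tplus i j & apex i j = c].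
Proof.
move=> m2 c0.
suff H L : forall i j, j - i <= L -> tplus i j -> i < c < j ->
    exists i j, [/\ i < j, tplus i j & apex i j = c].
  by apply: (H m 0 m.-1) => //; [lia|rewrite /tplus !eqxx orbT].
elim: L => [|L IH] i j; first by lia.
move=> lij tij /andP[ic cj]; have ij : i < j by lia.
have b := tplus_lt m2 tij ij; have [|a1 a2 a3] := @apexP i j; first by lia.
have a4 := apex_right m2 tij ij.
case: (ltngtP c (apex i j)) => [h|h|->]; last by exists i, j.
- apply: (IH i (apex i j)); try lia.
  by rewrite /tplus; case/orP: a2 => [/eqP|->//]; lia.
- apply: (IH (apex i j) j); try lia.
  by rewrite /tplus; case/orP: a4 => [/eqP|->//]; lia.
Qed.

End Apex.

(** * Recognizing a snake *)

Definition snake_label (m k : nat) : nat :=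
  if odd k then m - k./2.+1 else k./2.+1.

Section SnakeClassification.
Variables (m : nat) (t : rel nat).
Hypothesis m_gt3 : 3 < m.
Hypothesis tT : maximal_noncrossing m t.
Hypothesis t_tri : forall x y z, t x y -> t x z -> ~~ t y z.
Hypothesis t_fan : forall x a b c, t x a -> t x b -> t x c -> ~~ uniq [:: a; b; c].

Lemma apex_split i j : t i j -> i < j -> exists c, [/\ i < c < j,
  (c == i.+1) || t i c & (j == c.+1) || t c j].
Proof.
move=> tij ij; have [tsym tna tcr tmax] := tT.
have tp : tplus m t i j by rewrite /tplus tij.
have b : i.+1 < j by have := tna _ _ tij; rewrite /nonadj; lia.
have [a1 a2 a3] := apexP t b.
exists (apex t i j); split=> //.
exact: (apex_right tna tcr tsym tmax (ltnW m_gt3) tp ij).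
Qed.

Lemma has_ear : exists i, [/\ i < m, i.+2 < m & t i i.+2].
Proof.
have [tsym tna tcr tmax] := tT.
have [i [j [ij tij]]] : exists i j, i < j /\ t i j.
  have h : ~~ [forall i : 'I_m, forall j : 'I_m, ~~ t i j].
    apply/negP => /forallP h.
    have : t 0 2.
      apply: tmax => [|k l kl]; first by rewrite /nonadj; lia.
      have [lk ll] := nonadj_root tT kl.
      by have := forallP (h (Ordinal lk)) (Ordinal ll); rewrite /= kl.
    have l0 : 0 < m by lia.
    have l2 : 2 < m by lia.
    by have := forallP (h (Ordinal l0)) (Ordinal l2); rewrite /= => /negbTE->.
  move: h; rewrite negb_forall => /existsP[i]; rewrite negb_forall => /existsP[j].
  rewrite negbK => tij; case: (ltngtP i j) => [h|h|h].
  - by exists i, j.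
  - by exists j, i; rewrite tsym.
  - by move: (tna _ _ tij); rewrite /nonadj; lia.
have [L hL] : exists L, j - i <= L by exists (j - i).
elim: L i j ij tij hL => [|L IH] i j ij tij hL; first by lia.
have [lti ltj] := nonadj_root tT tij.
have [c [bc h1 h2]] := apex_split tij ij.
case/orP: h1 => [/eqP ec|tic]; last by apply: (IH i c) => //; lia.
case/orP: h2 => [/eqP ej|tcj]; last by apply: (IH c j) => //; lia.
by subst c j; exists i.
Qed.

(** The triangle beyond the second chord has a side at the vertex common to both chords. As a
    diagonal it would be the third one there, so it is an edge; this fixes the apex, and the last
    side is the next segment of the zigzag, a diagonal because [k.+3 <= n]. *)
Lemma snake_next (n k : nat) : m = n.+3 -> k.+3 <= n ->
  t (snake_label m k) (snake_label m k.+1) ->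
  t (snake_label m k.+1) (snake_label m k.+2) ->
  t (snake_label m k.+2) (snake_label m k.+3).
Proof.
move=> em kn; have [tsym tna tcr tmax] := tT; rewrite /snake_label /=.
set u := k./2; rewrite uphalf_half -/u.
have ku : k = odd k + u.*2 by rewrite odd_double_half.
have lt_apex i j : t i j -> i < j -> exists c, [/\ i < c < j,
  (c == i.+1) || t i c & (j == c.+1) || t c j] by exact: apex_split.
case ok: (odd k) ku => /= ku; rewrite ?add1n ?add0n => t1 t2.
- have [|c [bc h1 h2]] := lt_apex _ _ t2; first by clear -kn em ku; lia.
  case/orP: h1 => [/eqP ec|tic].
    rewrite ec in h2; rewrite tsym; case/orP: h2 => [/eqP h|//].
    by exfalso; clear -kn em ku h; lia.
  exfalso; have := @t_fan u.+2 (m - u.+1) (m - u.+2) c.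
  rewrite tic (tsym u.+2) t1 t2 /= !inE => /(_ isT isT isT).
  by clear -bc kn em ku; lia.
- rewrite tsym in t2.
  have [|c [bc h1 h2]] := lt_apex _ _ t2; first by clear -kn em ku; lia.
  case/orP: h2 => [/eqP ec|tic].
    have -> : m - u.+2 = c by clear -ec kn em ku; lia.
    by case/orP: h1 => [/eqP h|//]; exfalso; clear -h ec kn em ku; lia.
  exfalso; have := @t_fan (m - u.+1) (u.+1) (u.+2) c.
  rewrite (tsym _ c) tic (tsym _ u.+1) t1 (tsym _ u.+2) t2 /= !inE => /(_ isT isT isT).
  by clear -bc; lia.
Qed.

End SnakeClassification.

Lemma snake_classification m n t : m = n.+3 -> 0 < n -> maximal_noncrossing m t ->
  (forall x y z, t x y -> t x z -> ~~ t y z) ->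
  (forall x a b c, t x a -> t x b -> t x c -> ~~ uniq [:: a; b; c]) ->
  exists2 s, dihedral m s &
    forall k, k < n -> t (s (snake_label m k)) (s (snake_label m k.+1)).
Proof.
move=> em n0 tT t_tri t_fan.
have m3 : 3 < m by lia.
have snake_lt k : k <= n -> snake_label m k < m.
  by move=> kn; rewrite /snake_label; case: ifP; lia.
suff [s ds [h0 h1]] : exists2 s, dihedral m s & t (s 1) (s m.-1) /\ (1 < n -> t (s m.-1) (s 2)).
  exists s => // k kn.
  pose t' := pullback m s t; have tT' := maximal_noncrossing_pullback ds tT.
  have t'fan x a b c : t' x a -> t' x b -> t' x c -> ~~ uniq [:: a; b; c].
    move=> /and3P[lx la ta] /and3P[_ lb tb] /and3P[_ lc tc].
    have := t_fan _ _ _ _ ta tb tc; apply: contra => u.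
    have -> : [:: s a; s b; s c] = map s [:: a; b; c] by [].
    rewrite map_inj_in_uniq //.
    by move=> u' w; rewrite !inE => /or3P[]/eqP-> /or3P[]/eqP->; apply: (dih_inj ds).
  suff : t' (snake_label m k) (snake_label m k.+1) by case/and3P.
  have e1 : t' (snake_label m 0) (snake_label m 1).
    by rewrite /t' /pullback !snake_lt // /snake_label /= subn1.
  have e2 : 1 < n -> t' (snake_label m 1) (snake_label m 2).
    by move=> n1; rewrite /t' /pullback !snake_lt ?(ltnW n1) // /snake_label /= subn1 h1.
  suff /(_ k) : forall k, (k < n -> t' (snake_label m k) (snake_label m k.+1)) /\
      (k.+1 < n -> t' (snake_label m k.+1) (snake_label m k.+2)).
    by case=> h _; exact: h.
  elim=> [|j [IH1 IH2]]; first by split.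
  split=> [//|jn]; apply: (snake_next (n := n) m3 tT' t'fan) => //.
  by apply: IH1; lia.
  by apply: IH2; lia.
(* The ear is rotated so that its tip is 0. The triangle beyond it has at most one further diagonal
   as a side, and a reflection moves that side, if necessary, to where the zigzag turns next. *)
have [i [li li2 ti]] := has_ear m3 tT.
have di : i.+1 < m by lia.
have ds := dihedral_rotn di; set s := rotn m i.+1 in ds.
have tT' := maximal_noncrossing_pullback ds tT; set t' := pullback m s t in tT'.
have s1 : s 1 = i.+2 by rewrite /s /rotn; case: ifP; lia.
have sm : s m.-1 = i by rewrite /s /rotn; case: ifP; lia.
have t1 : t' 1 m.-1.
  by rewrite /t' /pullback s1 sm (mn_sym tT) ti; lia.
have [|c [bc h1 h2]] := apex_split m3 tT' t1; first by lia.
case: (boolP (t' c m.-1)) h2 => [tc _|_].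
  case/orP: h1 => [/eqP ec|tic].
    exists s => //; split; first by case/and3P: t1.
    by move=> _; rewrite (mn_sym tT); case/and3P: tc; rewrite ec.
  exfalso; case/and3P: t1 => _ _ t1; case/and3P: tc => _ _ tc.
  case/and3P: tic => _ _ tic.
  by have := t_tri _ _ _ tic t1; rewrite tc.
rewrite orbF => /eqP ec.
exists (s \o refl0 m); first by apply: dihedral_comp => //; exact: dihedral_refl0.
rewrite /= /refl0; have -> : (m.-1 == 0) = false by lia.
rewrite /= subn1 (_ : m - m.-1 = 1); last by lia.
split; first by rewrite (mn_sym tT); case/and3P: t1.
move=> n1; rewrite (_ : m - 2 = c); last by lia.
by case/orP: h1 => [/eqP|]; [lia|case/and3P].
Qed.

(** * Triangulations as sets of chords *)

Notation chord n := ('I_n.+3 * 'I_n.+3)%type.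

Section Chords.
Variable n : nat.
Implicit Types (d e : chord n) (T : {set chord n}).
Local Notation m := n.+3.

Definition diag d : bool := (d.1 < d.2) && nonadj n.+3 d.1 d.2.
Definition crd d e : bool := cr d.1 d.2 e.1 e.2.
Definition nat_chord d : nat * nat := (nat_of_ord d.1, nat_of_ord d.2).
Definition mkchord (u w : nat) : chord n := (inord (minn u w), inord (maxn u w)).

Definition noncrossing T : Prop :=
  (forall d, d \in T -> diag d) /\ (forall d e, d \in T -> e \in T -> ~~ crd d e).

Definition ctri T : Prop := #|T| = n /\ noncrossing T.

Definition relT T : rel nat :=
  fun i j => [exists d, (d \in T) && same_chord i j (nat_chord d)].

Lemma relTP T i j : reflect (exists2 d, d \in T & same_chord i j (nat_chord d)) (relT T i j).
Proof. by apply: (iffP existsP) => -[d]; [move=> /andP[]|]; exists d => //; apply/andP. Qed.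

Lemma mkchordC u w : mkchord u w = mkchord w u.
Proof. by rewrite /mkchord minnC maxnC. Qed.

Lemma mkchord_id d : d.1 <= d.2 -> mkchord d.1 d.2 = d.
Proof.
move=> le_d; rewrite /mkchord (minn_idPl le_d) (maxn_idPr le_d) !inord_val.
by case: d le_d.
Qed.

Lemma nat_mkchord u w : u < m -> w < m -> u <= w -> nat_chord (mkchord u w) = (u, w).
Proof.
by move=> lu lw uw; rewrite /nat_chord /mkchord (minn_idPl uw) (maxn_idPr uw) /= !inordK.
Qed.

Lemma crd_mkchordl u w d : u < m -> w < m -> crd (mkchord u w) d = cr u w d.1 d.2.
Proof.
move=> lu lw; rewrite /crd /mkchord /= !inordK; [|lia|lia].
by case: (leqP u w) => // _; rewrite crC.
Qed.

Lemma crd_mkchord u w x y : u < m -> w < m -> x < m -> y < m ->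
  crd (mkchord u w) (mkchord x y) = cr u w x y.
Proof.
move=> lu lw lx ly; rewrite crd_mkchordl // /mkchord /= !inordK; [|lia|lia].
by case: (leqP x y) => // _; rewrite crCr.
Qed.

Lemma crdC d e : crd d e = crd e d.
Proof. exact: cr_swap. Qed.

Lemma crd_same d : crd d d = false.
Proof. by rewrite /crd /cr; lia. Qed.

Lemma diag_mkchord u w : nonadj m u w -> diag (mkchord u w).
Proof.
move=> uw; have /and3P[lu lw _] := uw.
rewrite /diag /mkchord /= !inordK; [|lia|lia].
by case: (leqP u w) => h; rewrite ?(nonadjC _ w) uw andbT; move: uw; rewrite /nonadj; lia.
Qed.

Lemma same_chord_mk d u w : u < m -> w < m -> d.1 <= d.2 ->
  same_chord d.1 d.2 (u, w) = (d == mkchord u w).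
Proof.
move=> lu lw le_d; rewrite /same_chord !xpair_eqE.
apply/idP/eqP => [|->]; last by rewrite /= !inordK; lia.
move=> h; rewrite -[d]mkchord_id // /mkchord.
case/orP: h => /andP[/eqP-> /eqP->] //.
by rewrite minnC maxnC.
Qed.

Lemma relT_mk T u w : (forall d, d \in T -> diag d) -> u < m -> w < m ->
  relT T u w = (mkchord u w \in T).
Proof.
move=> dT lu lw; apply/relTP/idP => [[d dT' h]|h].
  have /andP[ld _] := dT d dT'.
  suff <- : d = mkchord u w by [].
  apply/eqP; rewrite -same_chord_mk ?(ltnW ld) //.
  by move: h; rewrite /same_chord /nat_chord !xpair_eqE => /orP[]/andP[/eqP-> /eqP->]; rewrite !eqxx ?orbT.
exists (mkchord u w) => //.
by rewrite /same_chord /nat_chord /= !inordK ?xpair_eqE; lia.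
Qed.

Lemma relT_chord T d : (forall d, d \in T -> diag d) -> d.1 < d.2 ->
  relT T d.1 d.2 = (d \in T).
Proof. by move=> dT ld; rewrite relT_mk // mkchord_id // ltnW. Qed.

Lemma relT_sym T i j : relT T i j = relT T j i.
Proof. by rewrite /relT; apply: eq_existsb => d; rewrite /same_chord orbC. Qed.

Section NonCrossing.
Variable T : {set chord n}.
Hypothesis ncT : noncrossing T.

Lemma relT_nonadj i j : relT T i j -> nonadj m i j.
Proof.
move=> /relTP[d /ncT.1/andP[_ dd]].
by rewrite /same_chord /nat_chord !xpair_eqE => /orP[]/andP[/eqP-> /eqP->];
  rewrite // nonadjC.
Qed.

Lemma relT_cr i j k l : relT T i j -> relT T k l -> ~~ cr i j k l.
Proof.
move=> /relTP[d dT h] /relTP[e eT h']; have := ncT.2 _ _ dT eT.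
move: h h'; rewrite /crd /same_chord /nat_chord !xpair_eqE.
by move=> /orP[]/andP[/eqP-> /eqP->] /orP[]/andP[/eqP-> /eqP->];
  rewrite // ?(crC d.2) // crCr.
Qed.

Definition root_chord : chord n := (ord0, ord_max).

Let kappa d : 'I_m := inord (apex (relT T) d.1 d.2).

Let TR := root_chord |: T.

Let TR_lt d : d \in TR -> d.1 < d.2.
Proof. by rewrite !inE => /orP[/eqP->//|/ncT.1/andP[]]. Qed.

Let TR_tplus d : d \in TR -> tplus m (relT T) d.1 d.2.
Proof.
rewrite !inE => /orP[/eqP->|dT]; rewrite /tplus ?eqxx ?orbT //.
by apply/orP; left; apply/relTP; exists d => //; rewrite /same_chord eqxx.
Qed.

Let TR_apex d : d \in TR -> 0 < apex (relT T) d.1 d.2 < m.-1.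
Proof.
move=> dT; have b := tplus_lt relT_nonadj isT (TR_tplus dT) (TR_lt dT).
have /andP[/(apexP (relT T))[h _ _] _] := b.
by clear -b h; lia.
Qed.

Let card_mid : #|~: [set ord0; ord_max : 'I_m]| = n.+1.
Proof. by rewrite cardsCs finset.setCK cards2 card_ord. Qed.

Let kappa_inj : {in TR &, injective kappa}.
Proof.
move=> d e dT eT /(congr1 (@nat_of_ord m)).
have := TR_apex dT; have := TR_apex eT => be bd.
rewrite /kappa !inordK; [|by clear -be; lia|by clear -bd; lia].
move=> /(apex_inj relT_nonadj relT_cr isT (TR_tplus dT) (TR_tplus eT) (TR_lt dT) (TR_lt eT)) [e1 e2].
by case: d e e1 e2 {dT eT be bd} => [? ?] [? ?] /= e1 e2; congr pair; apply: val_inj.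
Qed.

Let kappa_sub : kappa @: TR \subset ~: [set ord0; ord_max : 'I_m].
Proof.
apply/fintype.subsetP => _ /imsetP[d dT ->]; have b := TR_apex dT.
rewrite !inE -!(inj_eq val_inj) /= /kappa inordK; clear -b; lia.
Qed.

Let card_TR : #|TR| = #|T|.+1.
Proof.
rewrite cardsU1; case: (boolP (root_chord \in T)) => // /ncT.1.
by rewrite /diag /nonadj /=; lia.
Qed.

(** The middle vertices of the triangles beneath the chords of [T] and beneath the root are distinct
    labels among the [n.+1] inner ones. *)
Lemma noncrossing_card : #|T| <= n.
Proof.
by have := subset_leq_card kappa_sub; rewrite (card_in_imset kappa_inj) card_TR card_mid ltnS.
Qed.

Lemma maximal_card : maximal_noncrossing m (relT T) -> #|T| = n.
Proof.
move=> mT; apply/eqP; rewrite eqn_leq noncrossing_card /=.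
suff : ~: [set ord0; ord_max : 'I_m] \subset kappa @: TR.
  by move/subset_leq_card; rewrite (card_in_imset kappa_inj) card_TR card_mid ltnS.
apply/fintype.subsetP => c; rewrite !inE -!(inj_eq val_inj) /= => c0.
have [tsym tna tcr tmax] := mT.
have [|i [j [ij tij ec]]] := apex_surj (c := c) tna tcr tsym tmax isT.
  by have := ltn_ord c; move: c0; lia.
have b := tplus_lt tna isT tij ij.
have lj : j < m by case/andP: b.
have li : i < m by exact: ltn_trans lj.
apply/imsetP; exists (mkchord i j).
  rewrite !inE; case/orP: tij => [|/andP[/eqP-> /eqP->]].
    by rewrite relT_mk //; [move=> ->; rewrite orbT|exact: ncT.1].
  by apply/orP; left; apply/eqP; congr pair; apply: val_inj; rewrite /= inordK //; lia.
have [e1 e2] := nat_mkchord li lj (ltnW ij).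
by apply: val_inj; rewrite /kappa e1 e2 ec inord_val.
Qed.

End NonCrossing.

Lemma noncrossing_maximal T : noncrossing T ->
  (forall d, diag d -> (forall e, e \in T -> ~~ crd d e) -> d \in T) ->
  maximal_noncrossing m (relT T).
Proof.
move=> ncT mT; split.
- exact: relT_sym.
- exact: relT_nonadj.
- exact: relT_cr.
move=> i j ij H; have /and3P[li lj _] := ij.
rewrite relT_mk //; last exact: ncT.1.
apply: mT => [|e eT]; first exact: diag_mkchord.
rewrite crd_mkchordl // H // relT_chord //; first exact: ncT.1.
by case/andP: (ncT.1 _ eT).
Qed.

Lemma noncrossingU1 T d : noncrossing T -> diag d ->
  (forall e, e \in T -> ~~ crd d e) -> noncrossing (d |: T).
Proof.
move=> [dT cT] dd H; split.
  by move=> e; rewrite !inE => /orP[/eqP->//|/dT].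
move=> e f; rewrite !inE => /orP[/eqP->|eT] /orP[/eqP->|fT].
- by rewrite crd_same.
- exact: H.
- by rewrite crdC H.
- exact: cT.
Qed.

Lemma ctri_max T d : ctri T -> diag d -> (forall e, e \in T -> ~~ crd d e) -> d \in T.
Proof.
move=> [cT ncT] dd H; apply/negPn/negP => ndT.
by have := noncrossing_card (noncrossingU1 ncT dd H); rewrite cardsU1 ndT cT; lia.
Qed.

Lemma ctri_maximal T : ctri T -> maximal_noncrossing m (relT T).
Proof.
move=> tT; apply: noncrossing_maximal; first exact: tT.2.
by move=> d; exact: ctri_max.
Qed.

(** Chords are added while possible; a set that cannot be enlarged is maximal, hence has [n]
    elements. *)
Lemma noncrossing_extend T : noncrossing T -> exists2 T' : {set chord n}, T \subset T' & ctri T'.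
Proof.
have [k] : exists k, n - #|T| <= k by exists (n - #|T|).
elim: k T => [|k IH] T hk ncT.
  exists T => //; split=> //; apply/eqP; rewrite eqn_leq noncrossing_card //=.
  by rewrite -subn_eq0 -leqn0.
case: (boolP [exists d, [&& diag d, d \notin T & [forall (e | e \in T), ~~ crd d e]]]).
  move=> /existsP[d /and3P[dd ndT /forall_inP H]].
  have [|//|T' sT tT] := IH (d |: T); last by exists T' => //; apply: fintype.subset_trans sT; apply: subsetU1.
    by rewrite cardsU1 ndT; lia.
  exact: noncrossingU1.
move=> /existsPn nex; exists T => //; split=> //.
apply: maximal_card => //; apply: noncrossing_maximal => // d dd H.
apply/negPn/negP => ndT; have := nex d; rewrite dd ndT /=.
by move/negP; apply; apply/forall_inP.
Qed.

Definition crosses_exactly T e (ds : seq (chord n)) : Prop :=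
  diag e /\ forall t, t \in T -> crd e t = (t \in ds).

Lemma crosses_exactly_of T u w cs : ctri T ->
  crosses_only m (relT T) u w cs -> all (fun c => (c.1 < m) && (c.2 < m)) cs ->
  crosses_exactly T (mkchord u w) [seq mkchord c.1 c.2 | c <- cs].
Proof.
move=> tT [uw H] /allP lcs; have /and3P[lu lw _] := uw.
split; first exact: diag_mkchord.
move=> t tinT; have /andP[lt _] := tT.2.1 _ tinT.
rewrite crd_mkchordl // H; last by rewrite relT_chord //; exact: tT.2.1.
apply/hasP/mapP => [[c cin h]|[c cin ->]]; exists c => //; have /andP[l1 l2] := lcs c cin.
  by apply/eqP; rewrite -same_chord_mk // 1?ltnW //; case: c {cin l1 l2} h.
by rewrite [X in same_chord _ _ X]surjective_pairing same_chord_mk //= !inordK; lia.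
Qed.

Lemma flip_chord T d : ctri T -> d \in T -> exists e, crosses_exactly T e [:: d].
Proof.
move=> tT dT; have /andP[ld _] := tT.2.1 _ dT.
have rd : relT T d.1 d.2 by rewrite relT_chord //; exact: tT.2.1.
have n0 : 0 < n by rewrite -tT.1; apply/card_gt0P; exists d.
have m3 : 3 < m by [].
have [u [w uw]] := flip_at m3 (ctri_maximal tT) rd.
exists (mkchord u w); have := crosses_exactly_of tT uw.
by rewrite /= (mkchord_id (ltnW ld)) !ltn_ord; apply.
Qed.

Lemma ctri_flip T d : ctri T -> d \in T ->
  exists T' : {set chord n}, [/\ ctri T', T :\ d \subset T' & d \notin T'].
Proof.
move=> tT dT; have [e [de He]] := flip_chord tT dT.
have neT : e \notin T.
  by apply/negP => eT; have := tT.2.2 _ _ eT dT; rewrite He // inE eqxx.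
exists (e |: T :\ d); split; last 2 first.
- exact: finset.subsetUr.
- by rewrite !inE eqxx /= orbF; apply: contraNneq neT => <-.
split.
  by have := tT.1; rewrite cardsU1 !inE (negPf neT) andbF (cardsD1 d T) dT.
apply: noncrossingU1 => //.
  by split => [f|f g]; rewrite !inE => /andP[_]; [exact: tT.2.1|move=> fT /andP[_]; exact: tT.2.2].
by move=> f; rewrite !inE => /andP[fd fT]; rewrite He // inE.
Qed.

Definition act (s : nat -> nat) d : chord n := mkchord (s d.1) (s d.2).

Lemma crd_act s d e : dihedral m s -> crd (act s d) (act s e) = crd d e.
Proof.
move=> ds; have ls := dih_lt ds.
by rewrite /act crd_mkchord ?ls // (dih_cr ds).
Qed.

Lemma diag_act s d : dihedral m s -> diag d -> diag (act s d).
Proof. by move=> ds /andP[_ dd]; apply: diag_mkchord; rewrite (dih_nonadj ds). Qed.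

Lemma act_inj s d e : dihedral m s -> d.1 < d.2 -> e.1 < e.2 -> act s d = act s e -> d = e.
Proof.
move=> ds ld le h.
have ls := dih_lt ds.
have inj (x y : 'I_m) : s x = s y -> x = y by move=> E; apply: val_inj; exact: (dih_inj ds (ltn_ord x) (ltn_ord y) E).
have : same_chord (s d.1) (s d.2) (s e.1, s e.2).
  have : nat_chord (act s d) = nat_chord (act s e) by rewrite h.
  have := ls _ (ltn_ord d.1); have := ls _ (ltn_ord d.2).
  have := ls _ (ltn_ord e.1); have := ls _ (ltn_ord e.2).
  rewrite /nat_chord /act /mkchord /= => h1 h2 h3 h4 [].
  by rewrite !inordK /same_chord ?xpair_eqE; clear -h1 h2 h3 h4; lia.
rewrite /same_chord !xpair_eqE => /orP[]/andP[/eqP h1 /eqP h2].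
  have e1 := inj _ _ h1.
  have e2 := inj _ _ h2.
  by case: d e e1 e2 {ld le h h1 h2} => ? ? [? ?] /= -> ->.
by move: ld le; rewrite (inj _ _ h1) (inj _ _ h2); lia.
Qed.

Lemma act_surj s e : dihedral m s -> diag e -> exists2 d, diag d & act s d = e.
Proof.
move=> ds /andP[le de].
have [i li ei] := dih_surj ds (ltn_ord e.1).
have [j lj ej] := dih_surj ds (ltn_ord e.2).
exists (mkchord i j); first by apply: diag_mkchord; rewrite -(dih_nonadj ds) // ei ej.
rewrite -[RHS](mkchord_id (ltnW le)) -ei -ej /act /mkchord /= !inordK; [|lia|lia].
by case: (leqP i j) => // _; rewrite minnC maxnC.
Qed.

Lemma ctri_act s T : dihedral m s -> ctri T -> ctri (act s @: T).
Proof.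
move=> ds [cT [dT xT]]; split; [|split].
- rewrite card_in_imset // => d e /dT/andP[ld _] /dT/andP[le _]; exact: act_inj.
- by move=> _ /imsetP[d /dT dd ->]; apply: diag_act.
- by move=> _ _ /imsetP[d dd ->] /imsetP[e ee ->]; rewrite crd_act // xT.
Qed.

Definition snake_chord (i : nat) : chord n := mkchord (snake_label m i) (snake_label m i.+1).

(** Combinatorial core of the converse. Any two sides of an internal triangle are the only members
    of [T] crossed by some diagonal, and three sides cannot have pairwise distinct Boolean colours.
    The second condition forbids three diagonals at a vertex. *)
Lemma ctri_snake T (eta : chord n -> bool) : 0 < n -> ctri T ->
  (forall e d1 d2, d1 \in T -> d2 \in T -> d1 != d2 ->
     crosses_exactly T e [:: d1; d2] -> eta d1 != eta d2) ->
  (forall d1 d2 d3 e2 e12 e23 e123,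
     [/\ d1 \in T, d2 \in T, d3 \in T & uniq [:: d1; d2; d3]] ->
     crosses_exactly T e2 [:: d2] ->
     crosses_exactly T e12 [:: d1; d2] -> crosses_exactly T e23 [:: d2; d3] ->
     crosses_exactly T e123 [:: d1; d2; d3] -> ~~ crd e2 e123 -> False) ->
  exists2 s, dihedral m s & forall k, k < n -> act s (snake_chord k) \in T.
Proof.
move=> n0 tT H2 H3; have mT := ctri_maximal tT.
have dT := tT.2.1.
have m3 : 3 < m by [].
have lt1 x y : relT T x y -> x < m by move=> h; have [] := nonadj_root mT h.
have lt2 x y : relT T x y -> y < m by move=> h; have [] := nonadj_root mT h.
have inT x y : relT T x y -> mkchord x y \in T.
  by move=> h; rewrite -relT_mk //; [exact: lt1 h|exact: lt2 h].
have mk_neq x y z : x < m -> y < m -> z < m -> x != y -> x != z -> y != z ->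
    mkchord x y != mkchord x z.
  move=> lx ly lz xy xz yz; apply/eqP => /(congr1 nat_chord).
  rewrite /nat_chord /mkchord /= => -[]; rewrite !inordK; clear -lx ly lz xy xz yz;
  lia.
have t_irr x y : relT T x y -> x != y.
  by move/(mn_nonadj mT); rewrite /nonadj; lia.
have tri2 x y z : relT T x y -> relT T x z -> relT T y z ->
    eta (mkchord x y) != eta (mkchord x z).
  move=> xy xz yz; have [u [w uw]] := triangle_at m3 mT xy xz yz.
  have := crosses_exactly_of tT uw; rewrite /= (lt1 _ _ xy) (lt2 _ _ xy) (lt2 _ _ xz).
  move=> /(_ isT) uw'; apply: H2 uw'; [exact: inT|exact: inT|].
  by apply: mk_neq; [exact: lt1 xy|exact: lt2 xy|exact: lt2 xz|exact: t_irr|exact: t_irr|exact: t_irr].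
have t_tri x y z : relT T x y -> relT T x z -> ~~ relT T y z.
  move=> xy xz; apply/negP => yz.
  have yx : relT T y x by rewrite relT_sym.
  have zx : relT T z x by rewrite relT_sym.
  have zy : relT T z y by rewrite relT_sym.
  have := tri2 _ _ _ xy xz yz; have := tri2 _ _ _ yx yz xz; have := tri2 _ _ _ zx zy xy.
  rewrite (mkchordC y x) (mkchordC z x) (mkchordC z y).
  by case: (eta (mkchord x y)); case: (eta (mkchord x z)); case: (eta (mkchord y z)).
have t_fan x a b c : relT T x a -> relT T x b -> relT T x c -> ~~ uniq [:: a; b; c].
  move=> xa xb xc; apply/negP => uabc.
  have [y0 [y1 [y2 [y3 [y4 [u1 /= /and4P[t1 t2 t3 _] ncr [h2 h12 h23 h123]]]]]]] :=
    fan_at m3 mT xa xb xc uabc.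
  have lx := lt1 _ _ xa.
  have l1 := lt2 _ _ t1; have l2 := lt2 _ _ t2; have l3 := lt2 _ _ t3.
  have g2 := crosses_exactly_of tT h2; have g12 := crosses_exactly_of tT h12.
  have g23 := crosses_exactly_of tT h23; have g123 := crosses_exactly_of tT h123.
  move: g2 g12 g23 g123; rewrite /= lx l1 l2 l3 /=.
  move=> /(_ isT) g2 /(_ isT) g12 /(_ isT) g23 /(_ isT) g123.
  apply: H3 g2 g12 g23 g123 _; first split; try exact: inT.
    move: u1; rewrite /= !inE !negb_or => /andP[/andP[n12 n13] /andP[n23 _]].
    have := t_irr _ _ t1; have := t_irr _ _ t2; have := t_irr _ _ t3 => x3 x2 x1.
    by rewrite !mk_neq.
  have [/and3P[? ? _] _] := h2; have [/and3P[? ? _] _] := h123.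
  by rewrite crd_mkchord.
have [s ds hs] := snake_classification erefl n0 mT t_tri t_fan.
exists s => // k kn.
have := inT _ _ (hs k kn).
suff -> : act s (snake_chord k) = mkchord (s (snake_label m k)) (s (snake_label m k.+1)) by [].
have l k' : k' <= n -> snake_label m k' < m.
  by move=> lk; rewrite /snake_label; case: ifP; lia.
have lk := l k (ltnW kn); have lk1 := l k.+1 kn.
rewrite /act /snake_chord; set a := snake_label m k in lk *; set b := snake_label m k.+1 in lk1 *.
rewrite [in LHS]/mkchord /= ![in LHS]inordK; [|lia|lia].
by case: (leqP a b) => // _; rewrite mkchordC.
Qed.

End Chords.

(** * The sets S of the alternating sign sequence *)

(* Membership of k in S_ij, for U the extended sign sequence: replacing 0 by i
   puts i into S_ij iff 0 is below the diagonal, that is, iff U i. *)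
Definition hl_mem (U : nat -> bool) (i j k : nat) : bool :=
  if k <= i then U i else if j <= k then U j else ~~ U k.

Definition hl_set (n : nat) (U : nat -> bool) (d : chord n) : {set 'I_n.+1} :=
  [set l : 'I_n.+1 | hl_mem U d.1 d.2 l.+1]%SET.

Definition hl_sign (n : nat) (s : (n.-1).-tuple bool) (k : nat) : bool :=
  nth true (extended_signs s) k.

Lemma hl_sign1 (n : nat) (s : (n.-1).-tuple bool) : hl_sign s 1 = false.
Proof. by []. Qed.

Lemma hl_sign_n1 (n : nat) (s : (n.-1).-tuple bool) : 0 < n -> hl_sign s n.+1 = false.
Proof.
move=> n_ge1; rewrite /hl_sign /extended_signs /=; case: n n_ge1 s => // m _ t /=.
by rewrite nth_cat size_tuple ltnn subnn.
Qed.

Lemma hl_sign_n2 (n : nat) (s : (n.-1).-tuple bool) : 0 < n -> hl_sign s n.+2 = true.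
Proof.
move=> n_ge1; rewrite /hl_sign /extended_signs /=; case: n n_ge1 s => // m _ t /=.
by rewrite nth_cat size_tuple ltnNge leqnSn subSnn.
Qed.

(* The zigzag labelling: reading the cyclic labels 0, 1, m-1, 2, m-2, ... *)
Definition zlab (m a : nat) : nat :=
  if a == 0 then 0 else if a.*2 <= m then a.*2.-1 else (m - a).*2.

Definition even_sign (z : nat) : bool := ~~ odd z.

Lemma zlab_lt m a : a < m -> zlab m a < m.
Proof. by rewrite /zlab; do !case: ifP; lia. Qed.

Lemma zlab_surj m z : z < m -> exists2 a, a < m & zlab m a = z.
Proof.
move=> lz; exists (if z == 0 then 0 else if odd z then z.+1./2 else m - z./2);
  rewrite /zlab; have := odd_double_half z; case: (odd z) => hz; do !case: ifP; lia.
Qed.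

(** Odd positions of the zigzag carry the small labels, increasing, and positive even positions the
    large ones, decreasing. *)
Lemma zlab_order m a b : a < m -> b < m -> zlab m a < zlab m b ->
  (a < b) = (zlab m a == 0) || odd (zlab m a).
Proof.
move=> la lb; rewrite /zlab; do !case: ifP; lia.
Qed.

Lemma zlab_inj m a b : a < m -> b < m -> zlab m a = zlab m b -> a = b.
Proof. by move=> la lb; rewrite /zlab; do !case: ifP; lia. Qed.

Lemma zlab_order2 m a b : a < m -> b < m -> a != b ->
  (a < b) = if zlab m a < zlab m b then (zlab m a == 0) || odd (zlab m a)
            else ~~ ((zlab m b == 0) || odd (zlab m b)).
Proof.
move=> la lb ab; case: (ltngtP (zlab m a) (zlab m b)) => [h|h|h0]; last have h := zlab_inj la lb h0.
- exact: zlab_order.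
- by rewrite -(zlab_order lb la h); lia.
- by rewrite h eqxx in ab.
Qed.

Lemma zlab_snake n k : k <= n -> zlab n.+3 (snake_label n.+3 k) = k.+1.
Proof.
by move=> kn; rewrite /zlab /snake_label; have := odd_double_half k; case: (odd k) => hk;
  do !case: ifP; lia.
Qed.

(** The end [i] is higher than [k] when the boundary is followed from the lower vertices, around the
    left end, to the upper vertices: among lower vertices this means further left, among upper ones
    further right. [above_right] is the mirror image. *)
Definition above_left (U : nat -> bool) (i k : nat) : bool :=
  if U i then (k < i) || ~~ U k else ~~ U k && (i < k).

Definition above_right (U : nat -> bool) (j l : nat) : bool :=
  if U j then (j < l) || ~~ U l else ~~ U l && (l < j).

(** * Uncrossing for an arbitrary sign sequence *)

Section Exchange.
Variable U : nat -> bool.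

(** S collects what lies below a diagonal. Below the chord joining the higher ends [i] and [l] lies
    everything that is below [ij] or [kl]; below the chord of the lower ends [k] and [j] lies what
    is below both. *)
Lemma hl_mem_exchange i j k l x : i < j -> k < l -> i < l -> k < j ->
  above_left U i k -> above_right U l j ->
  hl_mem U i l x = hl_mem U i j x || hl_mem U k l x /\
  hl_mem U k j x = hl_mem U i j x && hl_mem U k l x.
Proof.
move=> ij kl il kj; rewrite /above_left /above_right /hl_mem.
move=> hL hR.
case: (leqP x i) => xi.
  rewrite (ltn_geF (leq_ltn_trans xi ij)) (ltn_geF (leq_ltn_trans xi il)).
  move: hL; case: (U i) => //= /andP[/negPf Uk ik].
  by rewrite (leq_trans xi (ltnW ik)) Uk.
case: (leqP j x) => jx.
  rewrite (ltn_geF (leq_trans kj jx)).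
  move: hR; case: (U j); last by rewrite /=; case: ifP.
  case: (U l); rewrite //= orbF => lj.
  by rewrite (leq_trans (ltnW lj) jx).
case: (leqP x k) => xk.
  rewrite (ltn_geF (leq_ltn_trans xk kl)).
  case: (boolP (U k)) hL => Uk; last by rewrite orbF andbF.
  by case: (U i); rewrite //= orbF ltnNge (ltnW (leq_trans xi xk)).
case: (leqP l x) => lx; last by rewrite orbb andbb.
case: (boolP (U l)) hR => Ul; first by rewrite orbT andbT.
by move=> /andP[_ jl]; rewrite ltnNge (ltnW (leq_trans jl lx)) in jx.
Qed.

Lemma hl_mem_separate i j k l N : i < j -> k < l -> i < l -> k < j ->
  j <= N.+1 -> l <= N.+1 -> above_left U i k -> above_right U l j -> U 0 ->
  (exists x, [/\ 0 < x <= N, hl_mem U i j x & ~~ hl_mem U k l x]) /\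
  (exists x, [/\ 0 < x <= N, ~~ hl_mem U i j x & hl_mem U k l x]).
Proof.
move=> ij kl il kj jN lN; rewrite /above_left /above_right /hl_mem => hL hR U0.
have pos a : ~~ U a -> 0 < a by case: a => //; rewrite U0.
have e (a b : nat) : a = b -> U a = U b by move=> ->.
split.
  (* An upper end belongs to the set of its own diagonal and a lower end does not: so [i], if it is
     an upper vertex, or else [k] separates the two sets. The label 0 is no coordinate and has to be
     avoided. *)
  case: (boolP (U i && (0 < i))) => [/andP[Ui i0]|nUi].
    exists i; split; first by clear -i0 ij jN; lia.
      by rewrite leqnn.
    move: hL (e i k); rewrite Ui; case: (U k) => /= hL ek.
      by clear -hL il; case: (leqP i k) => ?; case: (leqP l i) => ?; lia.
    by clear -il; case: (leqP i k) => ?; case: (leqP l i) => ?; lia.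
  have Uk : ~~ U k.
    by move: hL nUi; case: (U i) => /=; case: (U k) => //=; clear; lia.
  exists k; split; first by rewrite pos //; clear -kj jN; lia.
    move: hL nUi; rewrite Uk /= orbT; case: (U i) => /= hL hi.
      by case: (leqP k i) => // ?; case: (leqP j k) => //; clear -kj; lia.
    by case: (leqP k i) => [|_]; [clear -hL; lia|case: (leqP j k) => //; clear -kj; lia].
  by rewrite leqnn.
(* The same with the right ends, where [N.+1] is the label to avoid. *)
case: (boolP (U l && (l <= N))) => [/andP[Ul lN']|nUl].
  exists l; split; first by clear -lN' kl; lia.
    move: hR (e l j); rewrite Ul; case: (U j) => /= hR ej.
      by clear -hR il; case: (leqP l i) => ?; case: (leqP j l) => ?; lia.
    by clear -il; case: (leqP l i) => ?; case: (leqP j l) => ?; lia.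
  by rewrite (leqNgt l) kl leqnn.
have Uj : ~~ U j.
  by move: hR nUl; case: (U l) => /=; case: (U j) => //=; clear -jN; lia.
have jN' : j <= N.
  have ne : U l -> l != j by move=> Ul; apply: contraNneq Uj => <-.
  move: hR nUl ne jN lN; rewrite Uj /= orbT; case: (U l) => /= hR hl ne; clear -hR hl ne => *.
    by have := ne isT; lia.
  by lia.
exists j; split; first by rewrite pos.
  by rewrite (leqNgt j) ij leqnn.
move: hR nUl; rewrite Uj /= orbT; case: (U l) => /= hR hl.
  by case: (leqP j k) => [|_]; [clear -kj; lia|case: (leqP l j)].
by case: (leqP j k) => [|_]; [clear -kj; lia|case: (leqP l j) => //; clear -hR; lia].
Qed.

End Exchange.

Definition alt_mem (z z' : nat) : nat -> bool := hl_mem even_sign (minn z z') (maxn z z').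

Lemma alt_memC z z' : alt_mem z z' = alt_mem z' z.
Proof. by rewrite /alt_mem minnC maxnC. Qed.

(** * Cyclic order against zigzag order *)

Section Alternating.
Variable n : nat.
Local Notation m := n.+3.

(** Written with positions and parities by [zlab_order2], interleaving becomes a finite Boolean
    condition: the chord that is higher on the left is lower on the right. *)
Lemma crossing_zlab a b c d : a < m -> b < m -> c < m -> d < m ->
  zlab m a < zlab m b -> zlab m c < zlab m d -> cr a b c d ->
  [/\ zlab m a < zlab m d, zlab m c < zlab m b &
   (above_left even_sign (zlab m a) (zlab m c) && above_right even_sign (zlab m d) (zlab m b)) ||
   (above_left even_sign (zlab m c) (zlab m a) && above_right even_sign (zlab m b) (zlab m d))].
Proof.
move=> la lb lc ld; rewrite /cr => ij kl /and5P[ac ad bc bd].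
have zn x y : x < m -> y < m -> x != y -> zlab m x != zlab m y.
  by move=> lx ly; apply: contraNneq => /zlab_inj->.
move: (zn _ _ la lc ac) (zn _ _ la ld ad) (zn _ _ lb lc bc) (zn _ _ lb ld bd).
rewrite (zlab_order2 la lc ac) (zlab_order2 lb lc bc) (zlab_order2 la ld ad) (zlab_order2 lb ld bd).
rewrite /above_left /above_right /even_sign => {ac ad bc bd zn}.
move: (zlab m a) (zlab m b) (zlab m c) (zlab m d) ij kl => i j k l ij kl ik il jk jl h.
have j0 : (j == 0) = false by case: j ij {jk jl h}.
have l0 : (l == 0) = false by case: l kl {il jl h}.
move: h; rewrite j0 l0 /= {j0 l0}.
have zero z : (z == 0) ==> ~~ odd z by case: z.
move: (zero i) (zero k) => {zero}.
case: (ltngtP i k) ik => // ik _.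
  rewrite (ltn_trans ik kl).
  have -> : (k == 0) = false by case: k ik {kl jk}.
  case: (ltngtP j k) jk => // jk _; first rewrite (ltn_trans jk kl).
    by case: (i == 0); case: (odd i); case: (odd j); case: (odd k).
  case: (ltngtP j l) jl => // jl _;
  by case: (i == 0); case: (odd i); case: (odd j); case: (odd k); case: (odd l).
have kj := ltn_trans ik ij; rewrite kj (ltnNge j) (ltnW kj) /=.
have -> : (i == 0) = false by case: i ik {ij il}.
case: (ltngtP i l) il => // il _.
  case: (ltngtP j l) jl => // jl _;
  by case: (k == 0); case: (odd i); case: (odd j); case: (odd k); case: (odd l).
have -> : (j < l) = false by rewrite ltnNge (ltnW (ltn_trans il ij)).
by case: (k == 0); case: (odd i); case: (odd j); case: (odd k); case: (odd l).
Qed.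

Lemma alt_mem_exchange x x' y y' : x < m -> x' < m -> y < m -> y' < m -> cr x x' y y' ->
  let S a b := alt_mem (zlab m a) (zlab m b) in
  exists a a' b b',
  [/\ (a = x /\ a' = x') \/ (a = x' /\ a' = x), (b = y /\ b' = y') \/ (b = y' /\ b' = y),
    forall k, S a b k = S x x' k || S y y' k, forall k, S a' b' k = S x x' k && S y y' k &
    (exists k, [/\ 0 < k <= n.+1, S x x' k & ~~ S y y' k]) /\
    (exists k, [/\ 0 < k <= n.+1, ~~ S x x' k & S y y' k])].
Proof.
move=> lx lx' ly ly'.
wlog xx' : x x' lx lx' / zlab m x < zlab m x'.
  move=> H c; case: (ltngtP (zlab m x) (zlab m x')) => [h|h|/(zlab_inj lx lx') h].
  - exact: H.
  - rewrite crC in c; have /= [a [a' [b [b' [ha hb h1 h2 h3]]]]] := H _ _ lx' lx h c.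
    rewrite (alt_memC (zlab m x') (zlab m x)) in h1 h2 h3.
    by exists a, a', b, b'; split=> //; case: ha; [right|left].
  - by move: c; rewrite h /cr; lia.
wlog yy' : y y' ly ly' / zlab m y < zlab m y'.
  move=> H c; case: (ltngtP (zlab m y) (zlab m y')) => [h|h|/(zlab_inj ly ly') h].
  - exact: H.
  - rewrite crCr in c; have /= [a [a' [b [b' [ha hb h1 h2 h3]]]]] := H _ _ ly' ly h c.
    rewrite (alt_memC (zlab m y') (zlab m y)) in h1 h2 h3.
    by exists a, a', b, b'; split=> //; case: hb; [right|left].
  - by move: c; rewrite h /cr; lia.
move=> c; have [xy' yx' h] := crossing_zlab lx lx' ly ly' xx' yy' c.
have E u w : zlab m u < zlab m w ->
    alt_mem (zlab m u) (zlab m w) = hl_mem even_sign (zlab m u) (zlab m w).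
  by move=> lt; rewrite /alt_mem (minn_idPl (ltnW lt)) (maxn_idPr (ltnW lt)).
rewrite /= (E x x') // (E y y') //.
have bx := zlab_lt lx'; have by' := zlab_lt ly'.
case/orP: h => /andP[hL hR].
  exists x, x', y', y; rewrite E // (alt_memC (zlab m x')) E //; split; try tauto.
  - by move=> k; have [-> _] := hl_mem_exchange k xx' yy' xy' yx' hL hR.
  - by move=> k; have [_ ->] := hl_mem_exchange k xx' yy' xy' yx' hL hR.
  - exact: hl_mem_separate.
exists x', x, y, y'; rewrite (alt_memC (zlab m x')) !E //; split; try tauto.
- by move=> k; have [-> _] := hl_mem_exchange k yy' xx' yx' xy' hL hR; rewrite orbC.
- by move=> k; have [_ ->] := hl_mem_exchange k yy' xx' yx' xy' hL hR; rewrite andbC.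
- have [|[k [h1 h2 h3]] [l [g1 g2 g3]]] := hl_mem_separate (N := n.+1) yy' xx' yx' xy' by' bx hL hR; first by [].
  by split; [exists l|exists k].
Qed.

(** Edges of the polygon join zigzag positions at distance 2, or the first two, or the last two
    positions. In the first case the skipped vertex has the opposite sign, so that all membership
    conditions agree. *)
Lemma alt_mem_edge a b : a < m -> b < m -> a != b -> ~~ nonadj m a b ->
  exists c : bool, forall k, 0 < k <= n.+1 -> alt_mem (zlab m a) (zlab m b) k = c.
Proof.
wlog ab : a b / zlab m a < zlab m b.
  move=> H la lb nab ne; case: (ltngtP (zlab m a) (zlab m b)) => [h|h|/(zlab_inj la lb) h].
  - exact: H.
  - by rewrite alt_memC; apply: H; rewrite // 1?eq_sym // nonadjC.
  - by rewrite h eqxx in nab.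
move=> la lb nab ne.
exists (if zlab m a == n.+1 then even_sign (zlab m a) else even_sign (zlab m b)) => k k0.
rewrite /alt_mem (minn_idPl (ltnW ab)) (maxn_idPr (ltnW ab)).
have : [|| zlab m b == (zlab m a).+2, (zlab m a == 0) && (zlab m b == 1) |
    (zlab m a == n.+1) && (zlab m b == n.+2)].
  move: la lb nab ne ab; rewrite /nonadj /zlab; clear; do !case: ifP; lia.
have := zlab_lt lb.
move: ab; move: (zlab m a) (zlab m b) => i j ij ltj; rewrite /hl_mem /even_sign.
have e : (k == i.+1) ==> (odd k == odd i.+1) by apply/implyP => /eqP->.
by move: e; clear -ij k0 ltj; do !case: ifP; lia.
Qed.

Lemma cr_snake a b i : a < m -> b < m -> zlab m a < zlab m b -> 0 < i <= n ->
  cr a b (snake_label m i.-1) (snake_label m i) = (zlab m a < i) && (i.+1 < zlab m b).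
Proof.
move=> la lb ab i0.
have eu : zlab m (snake_label m i.-1) = i by rewrite zlab_snake; lia.
have ew : zlab m (snake_label m i) = i.+1 by rewrite zlab_snake; lia.
have lu : snake_label m i.-1 < m by rewrite /snake_label; case: ifP; lia.
have lw : snake_label m i < m by rewrite /snake_label; case: ifP; lia.
set u := snake_label m i.-1 in eu lu *; set w := snake_label m i in ew lw *.
apply/idP/idP.
  move=> c; have [|h1 h2 h3] := crossing_zlab la lb lu lw ab _ c; first by lia.
  move: h3; rewrite /above_left /above_right eu ew in h1 h2 *.
  have ei : (zlab m a == i) ==> (odd (zlab m a) == odd i) by apply/implyP => /eqP->.
  have ej : (zlab m b == i.+1) ==> (odd (zlab m b) == odd i.+1) by apply/implyP => /eqP->.
  rewrite /even_sign; move: h1 h2 ei ej; clear; move: (zlab m a) (zlab m b) => x y.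
  by rewrite /=; do !case: ifP; lia.
move=> /andP[h1 h2]; rewrite /cr.
have D x y : zlab m x != zlab m y -> x != y by apply: contraNneq => ->.
have au : a != u by apply: D; lia.
have aw : a != w by apply: D; lia.
have bu : b != u by apply: D; lia.
have bw : b != w by apply: D; lia.
rewrite au aw bu bw (zlab_order2 la lu au) (zlab_order2 la lw aw).
rewrite (zlab_order2 lb lu bu) (zlab_order2 lb lw bw) eu ew.
have -> : (zlab m b < i) = false by clear -h2; lia.
have -> : (zlab m b < i.+1) = false by clear -h2; lia.
rewrite h1 (ltn_trans h1 (ltnSn i)) /=; clear -h1.
by case: (odd i); case: (_ || odd _); lia.
Qed.

(* The segment of the zigzag path from z = i to z = i + 1 is a seed diagonal;
   its S-set is an initial or a final segment. *)
Lemma alt_mem_snake a b i : a < m -> b < m -> nonadj m a b -> 0 < i <= n ->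
  let S := alt_mem (zlab m a) (zlab m b) in
  let u := snake_label m i.-1 in let w := snake_label m i in
  [/\ same_chord a b (u, w) -> (S i = ~~ odd i) /\ S i.+1 = odd i,
      cr a b u w -> (S i = odd i) /\ S i.+1 = ~~ odd i &
      ~~ same_chord a b (u, w) -> ~~ cr a b u w -> S i = S i.+1].
Proof.
wlog ab : a b / zlab m a < zlab m b.
  move=> H la lb ne i0; case: (ltngtP (zlab m a) (zlab m b)) => [h|h|/(zlab_inj la lb) h].
  - exact: H.
  - rewrite nonadjC in ne; have := H _ _ h lb la ne i0; rewrite /= alt_memC.
    have sc c : same_chord b a c = same_chord a b c by rewrite /same_chord orbC.
    by rewrite (crC b a) !sc.
  - by move: ne; rewrite h /nonadj; lia.
move=> la lb ne i0 /=.
have eu : zlab m (snake_label m i.-1) = i by rewrite zlab_snake; lia.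
have ew : zlab m (snake_label m i) = i.+1 by rewrite zlab_snake; lia.
have lu : snake_label m i.-1 < m by rewrite /snake_label; case: ifP; lia.
have lw : snake_label m i < m by rewrite /snake_label; case: ifP; lia.
set u := snake_label m i.-1 in eu lu *; set w := snake_label m i in ew lw *.
have sc : same_chord a b (u, w) = (zlab m a == i) && (zlab m b == i.+1).
  rewrite /same_chord !xpair_eqE -[in RHS]ew -[in RHS]eu.
  have inj x y : x < m -> y < m -> (zlab m x == zlab m y) = (x == y).
    by move=> ? ?; apply/eqP/eqP => [/zlab_inj->|->].
  rewrite !inj //; apply/orP/idP => [[//|/andP[/eqP eb /eqP ea]]|->]; last by left.
  by move: ab; rewrite eb ea eu ew; lia.
rewrite sc /alt_mem (minn_idPl (ltnW ab)) (maxn_idPr (ltnW ab)).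
have crE : cr a b u w = (zlab m a < i) && (i.+1 < zlab m b) by exact: cr_snake.
rewrite crE; move: (zlab m a) (zlab m b) ab => x y xy; rewrite /hl_mem /even_sign.
clear -xy i0; split.
- by move=> /andP[/eqP-> /eqP->]; rewrite leqnn ltnn leqnn /= negbK.
- move=> /andP[xi iy]; have -> : (i <= x) = false by lia.
  have -> : (i < x) = false by lia.
  have -> : (y <= i) = false by lia.
  have -> : (y <= i.+1) = false by lia.
  by rewrite /= !negbK.
case: (ltngtP i x) xy => [//|xi _|<- iy] /=.
  rewrite -leqNgt => _ yi1; rewrite yi1; case: leqP => // iy.
  have -> : y = i.+1 by apply/eqP; rewrite eqn_leq yi1.
  by rewrite /= !negbK.
case: (leqP y i.+1) => [yi1|_ _ _]; last by rewrite !negbK.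
by rewrite eqn_leq yi1 iy.
Qed.

End Alternating.

(** A chord entering the quadrilateral [abcd] through [ab] without crossing [bd] cuts off the corner
    [a], hence crosses [ac]. So uncrossing against a member of a triangulation creates no new
    crossing with that triangulation. *)
Lemma cr_side a b c d x y :
  cr a c b d -> cr a b x y -> ~~ cr b d x y -> cr a c x y.
Proof. rewrite /cr; lia. Qed.

Lemma cr_side4 a b c d x y : cr a c b d -> ~~ cr b d x y ->
  [|| cr a b x y, cr a d x y, cr c b x y | cr c d x y] -> cr a c x y.
Proof.
move=> h n; have h' : cr a c d b by rewrite crCr.
have n' : ~~ cr d b x y by rewrite crC.
case/or4P => [k|k|k|k]; first exact: (cr_side h k n).
- exact: (cr_side h' k n').
- by rewrite crC; apply: (cr_side (b := b) _ k n); rewrite crC.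
- by rewrite crC; apply: (cr_side (b := d) _ k n'); rewrite crC.
Qed.

(** * The alternating polygon and the sets of its chords *)

Section AlternatingSigns.
Variable n : nat.
Local Notation m := n.+3.
Hypothesis n_ge1 : 0 < n.

(** The index [i] is the vertex [i.+2], of the same parity. *)
Definition alt_signs : (n.-1).-tuple bool := [tuple ~~ odd i | i < n.-1].

Lemma hl_sign_alt k : k <= n -> hl_sign alt_signs k = even_sign k.
Proof.
rewrite /hl_sign /extended_signs /even_sign; case: k => [|[|k]] //= kn.
have lk : k < n.-1 by lia.
rewrite negbK nth_cat size_tuple card_ord lk (nth_map (Ordinal lk)) ?size_enum_ord //.
by rewrite nth_enum_ord.
Qed.

(* For odd n the alternating pattern is broken at the end: both ends of the
   extended sign sequence are prescribed. Exchanging the last two labels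
   restores it, and does not change the sets S. *)
Definition swap_last (k : nat) : nat := if odd n && (n < k) then n.+1 + n.+2 - k else k.

Lemma swap_lastK k : k < m -> swap_last (swap_last k) = k.
Proof.
rewrite /swap_last => lk; case: (odd n) => //=; case: (ltnP n k) => h.
  have -> : n < n.+1 + n.+2 - k by lia.
  lia.
by rewrite ltnNge h.
Qed.

Lemma swap_last_lt k : k < m -> swap_last k < m.
Proof. by rewrite /swap_last; do 2?case: ifP; lia. Qed.

Lemma swap_last_mono i j : i <= n -> i < j -> j < m -> swap_last i = i /\ i < swap_last j.
Proof. by rewrite /swap_last; do 2?case: ifP; lia. Qed.

Lemma hl_mem_alt i j x : i <= n -> i < j -> j < m -> 0 < x <= n.+1 ->
  hl_mem (hl_sign alt_signs) i j x = hl_mem even_sign i (swap_last j) x.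
Proof.
move=> li ij lj x0.
have H := hl_sign_alt; have Hn1 := hl_sign_n1 alt_signs n_ge1.
have Hn2 := hl_sign_n2 alt_signs n_ge1.
rewrite /hl_mem (H i) //; case: (leqP x i) => // ix.
case: (leqP j n) => jn.
  have -> : swap_last j = j by rewrite /swap_last; case: ifP; lia.
  by rewrite (H j) //; case: (leqP j x) => // xj; rewrite H //; lia.
have : (j == n.+1) || (j == n.+2) by lia.
rewrite /swap_last jn andbT /even_sign => /orP[]/eqP ej; rewrite ej ?Hn1 ?Hn2.
- case on: (odd n).
    case: (leqP n.+1 x) => xn.
      have -> : (n.+1 + n.+2 - n.+1 <= x) = false by lia.
      have -> : x = n.+1 by lia.
      by rewrite /= on.
    have -> : (n.+1 + n.+2 - n.+1 <= x) = false by lia.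
    by rewrite H //; lia.
  case: (leqP n.+1 x) => xn; first by rewrite /= on.
  by rewrite H //; lia.
case on: (odd n).
  have -> : (n.+2 <= x) = false by lia.
  have -> : n.+1 + n.+2 - n.+2 = n.+1 by lia.
  case: (leqP n.+1 x) => xn; last by rewrite H //; lia.
  have -> : x = n.+1 by lia.
  by rewrite Hn1 /= on.
have -> : (n.+2 <= x) = false by lia.
case: (leqP x n) => xn; first by rewrite H.
have -> : x = n.+1 by lia.
by rewrite Hn1 /= on.
Qed.

Definition aset (d : chord n) : {set 'I_n.+1} :=
  [set l : 'I_n.+1 | alt_mem (zlab m d.1) (zlab m d.2) l.+1]%SET.

Lemma aset_mk u w : u < m -> w < m ->
  aset (mkchord n u w) = [set l : 'I_n.+1 | alt_mem (zlab m u) (zlab m w) l.+1]%SET.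
Proof.
move=> lu lw; apply/finset.setP => l; rewrite !inE /mkchord /= !inordK; [|lia|lia].
by case: (leqP u w) => // _; rewrite alt_memC.
Qed.

Lemma alt_mem_lt z z' : z < z' -> alt_mem z z' = hl_mem even_sign z z'.
Proof. by move=> lt; rewrite /alt_mem (minn_idPl (ltnW lt)) (maxn_idPr (ltnW lt)). Qed.

(** The ends are moved to cyclic labels by inverting [zlab] after [swap_last]. The exceptional chord
    joins the last two labels, whose exchange would reverse it; its set is empty. *)
Lemma hl_set_aset (d : chord n) : d.1 < d.2 ->
  hl_set (hl_sign alt_signs) d = finset.set0 \/
  exists2 e : chord n, e.1 < e.2 & hl_set (hl_sign alt_signs) d = aset e.
Proof.
move=> ld; have l2 := ltn_ord d.2.
case: (leqP d.1 n) => l1; last first.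
  have e1 : nat_of_ord d.1 = n.+1 by lia.
  left; apply/finset.setP => l; rewrite !inE /hl_mem e1.
  by have -> : l < n.+1 by []; rewrite hl_sign_n1.
right; have [s1 s2] := swap_last_mono l1 ld l2.
have [a la ea] := zlab_surj (ltn_ord d.1).
have [b lb eb] := zlab_surj (swap_last_lt l2).
have ab : a != b by apply/eqP => e; move: s2; rewrite -ea -eb e ltnn.
exists (mkchord n a b).
  by rewrite /mkchord /= !inordK; lia.
rewrite aset_mk // ea eb; apply/finset.setP => l; rewrite !inE alt_mem_lt //.
by rewrite hl_mem_alt //; have := ltn_ord l; lia.
Qed.

Lemma aset_hl_set (e : chord n) : e.1 < e.2 ->
  (exists2 d : chord n, d.1 < d.2 & aset e = hl_set (hl_sign alt_signs) d) \/
  aset e = finset.set0 \/ aset e = [set: 'I_n.+1]%SET.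
Proof.
move=> le.
have : zlab m e.1 != zlab m e.2.
  by apply/eqP => /zlab_inj; move=> /(_ (ltn_ord _) (ltn_ord _)); lia.
have lz1 := zlab_lt (ltn_ord e.1); have lz2 := zlab_lt (ltn_ord e.2).
have W z z' : z < m -> z' < m -> z < z' ->
    (exists2 d : chord n, d.1 < d.2 &
       [set l : 'I_n.+1 | alt_mem z z' l.+1]%SET = hl_set (hl_sign alt_signs) d) \/
    ([set l : 'I_n.+1 | alt_mem z z' l.+1]%SET = finset.set0 \/
     [set l : 'I_n.+1 | alt_mem z z' l.+1]%SET = [set: 'I_n.+1]%SET).
  move=> lz lz' zz'; case: (leqP z n) => zn; last first.
    have lz0 (l : 'I_n.+1) : l < z by have := ltn_ord l; lia.
    by right; case on: (even_sign z); [right|left]; apply/finset.setP => l;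
      rewrite !inE alt_mem_lt // /hl_mem lz0 on.
  left; have [s1 s2] := swap_last_mono zn zz' lz'.
  have ls := swap_last_lt lz'.
  exists (inord z, inord (swap_last z')); rewrite /= ?inordK //.
  apply/finset.setP => l; rewrite !inE alt_mem_lt //= !inordK //.
  by rewrite hl_mem_alt ?swap_lastK //; have := ltn_ord l; lia.
rewrite neq_ltn => /orP[lt|lt]; first exact: W.
by have := W _ _ lz2 lz1 lt; rewrite /aset alt_memC.
Qed.

Section ChordLevel.
Implicit Types d e : chord n.

Lemma aset_edge u w : u < m -> w < m -> u != w -> ~~ nonadj m u w ->
  aset (mkchord n u w) = finset.set0 \/ aset (mkchord n u w) = [set: 'I_n.+1]%SET.
Proof.
move=> lu lw uw na; rewrite aset_mk //.
have [[] H] := alt_mem_edge lu lw uw na; [right|left]; apply/finset.setP => l;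
  by rewrite !inE H //; have := ltn_ord l; lia.
Qed.

(** Union and intersection belong to opposite sides of the quadrilateral spanned by both chords. The
    clause on [t] says that passing from [d] to these sides adds no crossing with chords that do not
    cross [e], while the crossing with [e] is lost: this drives the induction on crossings. *)
Lemma aset_exchange d e : crd d e -> exists u w u' w',
  [/\ (u < m) && (w < m) && (u' < m) && (w' < m),
      u != w, u' != w',
      (forall t, ~~ crd e t ->
        (cr u w t.1 t.2 -> crd d t) /\ (cr u' w' t.1 t.2 -> crd d t)) /\
      ~~ cr u w e.1 e.2 /\ ~~ cr u' w' e.1 e.2 &
    [/\ aset (mkchord n u w) = (aset d :|: aset e)%SET,
        aset (mkchord n u' w') = (aset d :&: aset e)%SET,
        ~~ (aset d \subset aset e) & ~~ (aset e \subset aset d)]].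
Proof.
move=> c; have l1 := ltn_ord d.1; have l2 := ltn_ord d.2.
have l3 := ltn_ord e.1; have l4 := ltn_ord e.2.
have /= [a [a' [b [b' [ha hb h1 h2 [[x [x1 x2 x3]] [y [y1 y2 y3]]]]]]]] := alt_mem_exchange l1 l2 l3 l4 c.
exists a, b, a', b'.
have la : (a < m) && (b < m) && (a' < m) && (b' < m).
  by case: ha => -[-> ->]; case: hb => -[-> ->]; rewrite !ltn_ord.
have /andP[/andP[/andP[la1 lb1] la2] lb2] := la.
split=> //.
- by case/and5P: c => *; case: ha => -[-> _]; case: hb => -[-> _].
- by case/and5P: c => *; case: ha => -[_ ->]; case: hb => -[_ ->].
- split.
    move=> t nt; split=> h; apply: (cr_side4 c nt).
      by move: h; case: ha => -[-> _]; case: hb => -[-> _] ->; rewrite ?orbT.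
    by move: h; case: ha => -[_ ->]; case: hb => -[_ ->] ->; rewrite ?orbT.
  by case: hb => -[-> ->]; rewrite /cr !eqxx ?andbF.
rewrite !aset_mk //; split.
- by apply/finset.setP => l; rewrite !inE h1.
- by apply/finset.setP => l; rewrite !inE h2.
- apply/fintype.subsetPn; exists (inord x.-1); rewrite inE inordK ?prednK //; lia.
- apply/fintype.subsetPn; exists (inord y.-1); rewrite inE inordK ?prednK //; lia.
Qed.

(** A flip of [d] crosses [d], and sets of crossing diagonals are incomparable, whereas the empty
    and the full set are comparable with every set. *)
Lemma aset_proper d : diag d -> aset d != finset.set0 /\ aset d != [set: 'I_n.+1]%SET.
Proof.
move=> dd.
have nc : noncrossing [set d]%SET.
  by split=> [e|e f]; rewrite !inE => /eqP-> //; move=> /eqP->; rewrite crd_same.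
have [T sT tT] := noncrossing_extend nc.
have dT : d \in T by apply: (fintype.subsetP sT); rewrite inE.
have [e [_ /(_ _ dT)]] := flip_chord tT dT.
rewrite inE eqxx => c.
have [u [w [u' [w' [_ _ _ _ [_ _ h1 h2]]]]]] := aset_exchange c.
split; first by apply: contraNneq h2 => ->; rewrite finset.sub0set.
by apply: contraNneq h1 => ->; rewrite finset.subsetT.
Qed.

Lemma snake_label_lt k : k <= n -> snake_label m k < m.
Proof. by move=> kn; rewrite /snake_label; case: ifP; lia. Qed.

Lemma snake_chord_diag (i : 'I_n) : diag (snake_chord n i).
Proof.
have li := ltn_ord i; apply: diag_mkchord; rewrite /nonadj !snake_label_lt //; last exact: ltnW.
by rewrite /snake_label /=; have := odd_double_half i; case: (odd i) => /=; lia.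
Qed.

Lemma crd_snake (i j : 'I_n) : crd (snake_chord n i) (snake_chord n j) = false.
Proof.
have li := ltn_ord i; have lj := ltn_ord j.
rewrite crd_mkchord ?snake_label_lt // ?(ltnW li) ?(ltnW lj) //.
have zi : zlab m (snake_label m i) = i.+1 by rewrite zlab_snake // ltnW.
have zi1 : zlab m (snake_label m i.+1) = i.+2 by rewrite zlab_snake.
have := @cr_snake n (snake_label m i) (snake_label m i.+1) j.+1.
rewrite /= zi zi1 !snake_label_lt ?(ltnW li) //.
move=> -> //; lia.
Qed.

Lemma snake_chord_inj : injective (fun i : 'I_n => snake_chord n i).
Proof.
move=> i j /(congr1 (@nat_chord n)); rewrite /snake_chord /nat_chord /mkchord /=.
have li := ltn_ord i; have lj := ltn_ord j.
have l k : k <= n -> snake_label m k < m by exact: snake_label_lt.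
have z k : k <= n -> zlab m (snake_label m k) = k.+1 by exact: zlab_snake.
have [l1 l2 l3 l4] := And4 (l i (ltnW li)) (l _ li) (l j (ltnW lj)) (l _ lj).
rewrite !inordK; [|lia|lia|lia|lia] => -[e1 e2].
have : (snake_label m i == snake_label m j) || (snake_label m i == snake_label m j.+1) &&
       (snake_label m i.+1 == snake_label m j) by clear -e1 e2; lia.
case/orP => [/eqP|/andP[/eqP h1 /eqP h2]].
  by move=> /(congr1 (zlab m)); rewrite (z i (ltnW li)) (z j (ltnW lj)) => -[] /val_inj.
have := congr1 (zlab m) h1; have := congr1 (zlab m) h2.
rewrite (z _ li) (z _ lj) (z i (ltnW li)) (z j (ltnW lj)); clear; lia.
Qed.

Lemma ctri_snake_set : ctri [set snake_chord n i | i : 'I_n]%SET.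
Proof.
split; first by rewrite card_imset ?card_ord //; exact: snake_chord_inj.
split=> [_ /imsetP[i _ ->]|_ _ /imsetP[i _ ->] /imsetP[j _ ->]].
  exact: snake_chord_diag.
by rewrite crd_snake.
Qed.

End ChordLevel.
End AlternatingSigns.

Local Open Scope classical_set_scope.
Local Open Scope ring_scope.

(** * Convex polygons *)

Section ConvexHull.
Variables (R : realType) (W : lmodType R) (I : finType) (D : pred I) (p : I -> W).

Lemma sum_pick (v : I -> W) (i : I) : D i ->
  \sum_(x | D x) (x == i)%:R *: v x = v i.
Proof.
move=> Di; rewrite (bigD1 i) //= eqxx scale1r big1 ?addr0 // => j /andP[_ /negPf->].
by rewrite scale0r.
Qed.

Lemma conv_hull_point (i : I) : D i -> conv_hull D p (p i).
Proof.
move=> Di; exists (fun x => (x == i)%:R); split; last by rewrite sum_pick.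
  by move=> x; exact: ler0n.
rewrite (bigD1 i) //= eqxx big1 ?addr0 // => j /andP[_ /negPf->//].
Qed.

Lemma conv_hull_comb3 (x y z : W) (a b c : R) :
  conv_hull D p x -> conv_hull D p y -> conv_hull D p z ->
  0 <= a -> 0 <= b -> 0 <= c -> a + b + c = 1 ->
  conv_hull D p (a *: x + b *: y + c *: z).
Proof.
move=> [t [t0 t1 ->]] [u [u0 u1 ->]] [v [v0 v1 ->]] a0 b0 c0 abc.
exists (fun i => a * t i + b * u i + c * v i); split.
- by move=> i; rewrite !addr_ge0 ?mulr_ge0.
- by rewrite !big_split /= -!mulr_sumr t1 u1 v1 !mulr1.
rewrite !scaler_sumr -!big_split /=; apply: eq_bigr => i _.
by rewrite !scalerDl !scalerA.
Qed.

Lemma conv_hull_comb (x y : W) (a b : R) :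
  conv_hull D p x -> conv_hull D p y -> 0 <= a -> 0 <= b -> a + b = 1 ->
  conv_hull D p (a *: x + b *: y).
Proof.
move=> hx hy a0 b0 ab.
have := conv_hull_comb3 hx hy hx a0 b0 (lexx 0); rewrite addr0 => /(_ ab).
by rewrite scale0r addr0.
Qed.

End ConvexHull.

(** * Orientations of points in the plane *)

Section Plane.
Variable R : realType.
Implicit Types a b c d x : 'rV[R]_2.

Lemma rv2P a b : abscissa a = abscissa b -> ordinate a = ordinate b -> a = b.
Proof.
move=> e1 e2; apply/rowP => -[[|[|//]] i2].
  by rewrite (_ : Ordinal i2 = 0) //; apply: val_inj.
by rewrite (_ : Ordinal i2 = 1) //; apply: val_inj.
Qed.

Lemma abscissaD a b : abscissa (a + b) = abscissa a + abscissa b.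
Proof. by rewrite /abscissa mxE. Qed.
Lemma abscissaZ (t : R) a : abscissa (t *: a) = t * abscissa a.
Proof. by rewrite /abscissa mxE. Qed.
Lemma ordinateD a b : ordinate (a + b) = ordinate a + ordinate b.
Proof. by rewrite /ordinate mxE. Qed.
Lemma ordinateZ (t : R) a : ordinate (t *: a) = t * ordinate a.
Proof. by rewrite /ordinate mxE. Qed.

Definition coordE := (abscissaD, abscissaZ, ordinateD, ordinateZ).

Lemma orient_cycle a b c : orient a b c = orient b c a.
Proof. by rewrite /orient; ring. Qed.

Lemma orient_swap a b c : orient b a c = - orient a b c.
Proof. by rewrite /orient; ring. Qed.

Lemma orient_self a b : orient a b a = 0 /\ orient a b b = 0.
Proof. by rewrite /orient; split; ring. Qed.

Lemma orient_affine a b x y (t : R) :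
  orient a b ((1 - t) *: x + t *: y) = (1 - t) * orient a b x + t * orient a b y.
Proof. by rewrite /orient !coordE; ring. Qed.

(** Cramer's rule: the affine dependency of four points, whose two sides have equal total weight by
    [orient_sum]. It yields the common point of two crossing diagonals, and in [orient4] a vertex
    inside a triangle. *)
Lemma orient_dependency a b c d :
  orient b c d *: a + orient a b d *: c = orient a c d *: b + orient a b c *: d.
Proof. by apply: rv2P; rewrite !coordE /orient; ring. Qed.

Lemma orient_sum a b c d :
  orient b c d + orient a b d = orient a c d + orient a b c.
Proof. by rewrite /orient; ring. Qed.

Lemma open_segment_barycenter a b (t u : R) : 0 < t -> 0 < u ->
  open_segment a b ((t + u)^-1 *: (t *: a + u *: b)).
Proof.
move=> t0 u0; have n0 : t + u != 0 by rewrite gt_eqF ?addr_gt0.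
exists (u / (t + u)); split.
  by rewrite divr_gt0 ?addr_gt0 //= ltr_pdivrMr ?addr_gt0 // mul1r ltrDr.
by apply: rv2P; rewrite !coordE; field.
Qed.

End Plane.

Section ConvexPolygon.
Variables (R : realType) (m : nat) (p : 'I_m -> 'rV[R]_2).
Hypothesis p_convex : convex_polygon p.

Lemma convex_polygon_between (i j k : 'I_m) (t : R) : i != k -> j != k ->
  0 <= t <= 1 -> p k <> (1 - t) *: p i + t *: p j.
Proof.
move=> ik jk /andP[t0 t1] e; apply: (p_convex (k := k)); rewrite e.
by apply: conv_hull_comb; rewrite ?subr_ge0 ?subrK //; apply: conv_hull_point.
Qed.

(** Of three collinear points one lies between the other two, against convexity. The parameter [s]
    is read off a coordinate that varies along the line; its position relative to 0 and 1 tells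
    which point is in the middle. *)
Lemma orient_neq0 (i j k : 'I_m) : i != j -> i != k -> j != k ->
  orient (p i) (p j) (p k) != 0.
Proof.
move=> ij ik jk; apply/eqP => o0.
have [s es] : exists s, p k = (1 - s) *: p i + s *: p j.
  case: (eqVneq (abscissa (p j)) (abscissa (p i))) => [ex|nx]; last first.
    exists ((abscissa (p k) - abscissa (p i)) / (abscissa (p j) - abscissa (p i))).
    have n0 : abscissa (p j) - abscissa (p i) != 0 by rewrite subr_eq0.
    apply: rv2P; rewrite !coordE; first by field.
    apply: (mulfI n0); move: o0; rewrite /orient => o0.
    rewrite -[LHS]subr0 -[in LHS]o0; by field.
  case: (eqVneq (ordinate (p j)) (ordinate (p i))) => [ey|ny].
    exfalso; apply: (@convex_polygon_between i i j 0); rewrite ?lexx ?ler01 //.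
    by apply: rv2P; rewrite !coordE ?ex ?ey; ring.
  exists ((ordinate (p k) - ordinate (p i)) / (ordinate (p j) - ordinate (p i))).
  have n0 : ordinate (p j) - ordinate (p i) != 0 by rewrite subr_eq0.
  apply: rv2P; rewrite !coordE; last by field.
  apply: (mulfI n0); move: o0; rewrite /orient ex => o0.
  rewrite -[LHS]addr0 -[in LHS]o0; by field.
have [s0|s0] := ltP s 0.
  have n0 : 1 - s != 0 by lra.
  apply: (@convex_polygon_between j k i (1 / (1 - s))); rewrite // 1?eq_sym //.
    by rewrite divr_ge0 ?ler01 ?ler_pdivrMr; lra.
  rewrite es; apply: rv2P; rewrite !coordE; by field.
have [s1|s1] := ltP 1 s.
  have n0 : s != 0 by lra.
  apply: (@convex_polygon_between i k j (1 / s)); rewrite // 1?eq_sym //.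
    by rewrite divr_ge0 ?ler01 ?ler_pdivrMr; lra.
  rewrite es; apply: rv2P; rewrite !coordE; by field.
apply: (@convex_polygon_between i j k s) => //; exact/andP.
Qed.

(** With the wrong last sign, all coefficients of [p l] in the affine dependency would be
    nonnegative, and [p l] would lie in the triangle of the other three. The factor [s] covers both
    orientations of the polygon. *)
Lemma orient4 (i j k l : 'I_m) (s : R) : i != l -> j != l -> k != l ->
  0 < s * orient (p i) (p j) (p l) -> 0 < s * orient (p j) (p k) (p l) ->
  0 < s * orient (p i) (p j) (p k) -> 0 < s * orient (p i) (p k) (p l).
Proof.
move=> il jl kl h1 h2 h3; rewrite ltNge; apply/negP => h4.
apply: (p_convex (k := l)).
have n0 : s * orient (p i) (p j) (p k) != 0 by rewrite gt_eqF.
have e := orient_dependency (p i) (p j) (p k) (p l).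
have es := orient_sum (p i) (p j) (p k) (p l).
set A := orient (p j) (p k) (p l) in h2 e es; set B := orient (p i) (p j) (p l) in h1 e es.
set C := orient (p i) (p k) (p l) in h4 e es; set N := orient (p i) (p j) (p k) in h3 n0 e es.
have -> : p l = ((s * A) / (s * N)) *: p i + (- (s * C) / (s * N)) *: p j
               + ((s * B) / (s * N)) *: p k.
  apply: (scalerI n0); rewrite !scalerDr !scalerA !(mulrCA (s * N)) !mulfV // !mulr1.
  rewrite -!scalerA -[s *: _]/(s *: (N *: _)).
  have -> : N *: p l = A *: p i + B *: p k - C *: p j by rewrite e addrAC subrr add0r.
  by rewrite !(scalerDr, scalerN) !scalerA -!scaleNr addrAC.
have hs : (s * A) / (s * N) + - (s * C) / (s * N) + (s * B) / (s * N) = 1.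
  rewrite -!mulrDl; apply: (mulIf n0); rewrite divfK // mul1r.
  have -> : N = A + B - C by lra.
  ring.
apply: conv_hull_comb3 hs.
- exact: conv_hull_point.
- exact: conv_hull_point.
- exact: conv_hull_point.
- by rewrite divr_ge0 // ltW.
- by rewrite divr_ge0 ?oppr_ge0 // ltW.
- by rewrite divr_ge0 // ltW.
Qed.

End ConvexPolygon.

(** * Cyclically labelled polygons: from geometry to the order of labels *)

Section CyclicPolygon.
Variables (R : realType) (n : nat) (q : 'I_n.+3 -> 'rV[R]_2).
Hypothesis q_convex : convex_polygon q.
Hypothesis q_cyclic : cyclically_labelled q.

Let Q (i : nat) := q (inord i).

Let s : R := Num.sg (orient (Q 0) (Q 1) (Q 2)).

Let Q_neq0 i j k : (i < n.+3)%N -> (j < n.+3)%N -> (k < n.+3)%N ->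
  i != j -> i != k -> j != k -> orient (Q i) (Q j) (Q k) != 0.
Proof.
have I a b : (a < n.+3)%N -> (b < n.+3)%N -> a != b -> (inord a : 'I_n.+3) != inord b.
  by move=> la lb; rewrite -(inj_eq val_inj) /= !inordK.
by move=> *; apply: orient_neq0; rewrite ?I.
Qed.

Let s_neq0 : s != 0. Proof. by rewrite sgr_eq0 Q_neq0. Qed.

(** All vertices lie on one side of an edge, by the cyclic labelling. The side is passed on from an
    edge to the next, since both see the triple [i], [i.+1], [i.+2]. *)
Let edge i k : (i.+1 < n.+3)%N -> (k < n.+3)%N -> k != i -> k != i.+1 ->
  0 < s * orient (Q i) (Q i.+1) (Q k).
Proof.
have key j l x : (j.+1 < n.+3)%N -> (l < n.+3)%N -> l != j -> l != j.+1 ->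
    (x < n.+3)%N ->
    0 < s * orient (Q j) (Q j.+1) (Q x) -> 0 < s * orient (Q j) (Q j.+1) (Q l).
  move=> lj ll lj1 lj2 lx ox; rewrite ltNge; apply/negP => ol.
  have ol' : s * orient (Q j) (Q j.+1) (Q l) < 0.
    by rewrite lt_neqAle ol andbT mulf_neq0 ?s_neq0 // Q_neq0 //; lia.
  have := q_cyclic (inord j); rewrite /internal.
  have -> : ordS (inord j : 'I_n.+3) = inord j.+1.
    by apply: val_inj => /=; rewrite !inordK ?modn_small //; lia.
  rewrite negb_and => /orP[]/existsPn H.
    have := H (inord x); have := H (inord l); rewrite -!leNgt -/(Q j) -/(Q j.+1) -/(Q x) -/(Q l).
    by move=> o1 o2; have [s0|s0] := leP 0 s; nra.
  have := H (inord x); have := H (inord l); rewrite -!leNgt -/(Q j) -/(Q j.+1) -/(Q x) -/(Q l).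
  by move=> o1 o2; have [s0|s0] := leP 0 s; nra.
elim: i k => [|i IH] k li lk ki ki1.
  apply: (key _ _ 2) => //.
  by rewrite /s -normrEsg normr_gt0 Q_neq0.
apply: (key _ _ i) => //; first by lia.
by rewrite -orient_cycle; apply: IH; lia.
Qed.

(** Induction on the gap between [i] and [j]: the step to [j] from its predecessor is an edge, and
    [orient4] extends the sign across it. *)
Let triple i j k : (i < j)%N -> (j < k)%N -> (k < n.+3)%N ->
  0 < s * orient (Q i) (Q j) (Q k).
Proof.
move=> ij; have [d ->] : exists d, j = (i + d).+1 by exists (j - i.+1)%N; lia.
elim: d k => [|d IH] k jk lk; first by rewrite addn0; apply: edge; lia.
have I a : (a < k)%N -> (inord a : 'I_n.+3) != inord k.
  by move=> la; rewrite -(inj_eq val_inj) /= !inordK; lia.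
apply: (orient4 q_convex (j := inord (i + d).+1)); try (by apply: I; lia).
- by apply: IH; lia.
- by rewrite addnS; apply: edge; lia.
- by apply: IH; lia.
Qed.

Lemma cyclic_orientation : exists2 s : R, s != 0 & forall i j k : 'I_n.+3,
  (i < j)%N -> (j < k)%N -> 0 < s * orient (q i) (q j) (q k).
Proof.
exists s => // i j k ij jk; have := triple ij jk (ltn_ord k).
by rewrite /Q !inord_val.
Qed.

End CyclicPolygon.

Section CyclicPolygonChords.
Variables (R : realType) (n : nat) (q : 'I_n.+3 -> 'rV[R]_2).
Hypothesis q_convex : convex_polygon q.
Hypothesis q_cyclic : cyclically_labelled q.

Lemma diagonal_orient : exists2 s : R, s != 0 & forall (d : chord n) (k : 'I_n.+3), (d.1 < d.2)%N ->
  ((d.1 < k < d.2)%N -> s * orient (q d.1) (q d.2) (q k) < 0) /\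
  ((k < d.1)%N || (d.2 < k)%N -> 0 < s * orient (q d.1) (q d.2) (q k)).
Proof.
have [s s0 H] := cyclic_orientation q_convex q_cyclic; exists s => // d k ld; split.
  move=> /andP[h1 h2]; rewrite orient_cycle orient_cycle orient_swap mulrN oppr_lt0.
  by rewrite -orient_cycle -orient_cycle orient_cycle orient_cycle; exact: H.
by case/orP => h; [rewrite -orient_cycle|]; apply: H.
Qed.

Lemma chord_position : exists2 s : R, s != 0 & forall (d : chord n) (k : 'I_n.+3), (d.1 < d.2)%N ->
  [\/ s * orient (q d.1) (q d.2) (q k) = 0 /\ ((k == d.1 :> nat) || (k == d.2 :> nat)),
      s * orient (q d.1) (q d.2) (q k) < 0 /\ (d.1 < k < d.2)%N |
      0 < s * orient (q d.1) (q d.2) (q k) /\ ((k < d.1)%N || (d.2 < k)%N)].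
Proof.
have [s s0 H] := diagonal_orient; exists s => // d k ld; have [h1 h2] := H d k ld.
have [k1|k1] := eqVneq k d.1; first by constructor 1; rewrite k1 eqxx (orient_self _ _).1 mulr0.
have [k2|k2] := eqVneq k d.2; first by constructor 1; rewrite k2 eqxx orbT (orient_self _ _).2 mulr0.
have : (d.1 < k < d.2)%N || ((k < d.1)%N || (d.2 < k)%N).
  by move: k1 k2; rewrite -!(inj_eq val_inj) /=; lia.
by case/orP => h; [constructor 2|constructor 3]; auto.
Qed.

Lemma is_diagonalE d : is_diagonal q d = diag d.
Proof.
have [s s0 H] := chord_position.
rewrite /is_diagonal /diag; case: (ltnP d.1 d.2) => //= ld.
apply/idP/idP.
  rewrite /internal => /andP[/existsP[k ok] /existsP[l ol]].
  have /andP[lk ll] : (d.1.+1 < d.2)%N && (d.2 < d.1 + n.+2)%N.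
    have := H d k ld; have := H d l ld; have := ltn_ord k; have := ltn_ord l.
    have := ltn_ord d.2 => bd bl bk.
    have [sn|sp|s00] := ltgtP s 0; last by rewrite s00 eqxx in s0.
      rewrite -(nmulr_rgt0 _ sn) in ok; rewrite -(nmulr_rlt0 _ sn) in ol.
      move=> [] [tl tl1] [] [tk tk1]; try (by exfalso; clear -ok ol tk tl; lra).
      by clear -tl1 tk1 bd bl bk; lia.
    rewrite -(pmulr_rlt0 _ sp) in ok; rewrite -(pmulr_rgt0 _ sp) in ol.
    move=> [] [tl tl1] [] [tk tk1]; try (by exfalso; clear -ok ol tk tl; lra).
    by clear -tl1 tk1 bd bl bk; lia.
  by rewrite /nonadj !ltn_ord /= lk ll.
move=> na.
have [k hk] : exists k : 'I_n.+3, (d.1 < k < d.2)%N.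
  by exists (inord d.1.+1); rewrite inordK; move: na; rewrite /nonadj; have := ltn_ord d.2; lia.
have [l hl] : exists k : 'I_n.+3, (k < d.1)%N || (d.2 < k)%N.
  have [d0|d0] := posnP d.1.
    by exists ord_max => /=; move: na; rewrite /nonadj; have := ltn_ord d.2; lia.
  by exists ord0; rewrite /= d0.
have ok : s * orient (q d.1) (q d.2) (q k) < 0.
  by case: (H d k ld) => -[h h'] //; exfalso; clear -h' hk ld; lia.
have ol : 0 < s * orient (q d.1) (q d.2) (q l).
  by case: (H d l ld) => -[h h'] //; exfalso; clear -h' hl ld; lia.
rewrite /internal; have [sn|sp|s00] := ltgtP s 0; last by rewrite s00 eqxx in s0.
  rewrite nmulr_rlt0 // in ok; rewrite nmulr_rgt0 // in ol.
  by apply/andP; split; apply/existsP; [exists l|exists k].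
rewrite pmulr_rlt0 // in ok; rewrite pmulr_rgt0 // in ol.
by apply/andP; split; apply/existsP; [exists k|exists l].
Qed.

Lemma crosses_sym (d e : chord n) : crosses q d e -> crosses q e d.
Proof. by move=> [x [xd xe]]; exists x. Qed.

(** If the labels do not interleave, the ends of [e] lie weakly on one side of the line of [d] and
    not both on it, so no inner point of [e] is on that line. If they do, the affine dependency of
    the four ends has coefficients of one sign and gives a common point. *)
Lemma crossesE d e : diag d -> diag e -> d != e -> crosses q d e <-> crd d e.
Proof.
move=> /andP[ld _] /andP[le _] nde; split.
  move=> [x [[t [/andP[t0 t1] ex]] [u [/andP[u0 u1] ex']]]].
  apply/negPn/negP => ncr.
  have [s s0 H] := chord_position.
  have : s * orient (q d.1) (q d.2) x = 0.
    by rewrite ex orient_affine (orient_self _ _).1 (orient_self _ _).2 !mulr0 addr0 mulr0.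
  rewrite ex' orient_affine mulrDr !(mulrCA s).
  set a := s * _; set b := s * _ => ab.
  have ne : (d.1 != e.1 :> nat) || (d.2 != e.2 :> nat).
    rewrite -negb_and; apply: contra nde => /andP[/eqP/val_inj h1 /eqP/val_inj h2].
    by rewrite [d]surjective_pairing [e]surjective_pairing h1 h2.
  move: ncr; rewrite /crd /cr => ncr.
  have := H d e.1 ld; have := H d e.2 ld; rewrite -/a -/b.
  move=> [] [b0 b1] [] [a0 a1]; try (by clear -a0 b0 ab t0 t1 u0 u1; nra);
    try (by clear -a1 b1 ne ncr ld le; lia).
wlog [h1 h2 h3] : d e ld le nde / [/\ (d.1 < e.1)%N, (e.1 < d.2)%N & (d.2 < e.2)%N].
  move=> W cde; case: (ltngtP d.1 e.1) => h.
  - by apply: W => //; apply/and3P; move: cde; rewrite /crd /cr; clear -h ld le; lia.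
  - apply: crosses_sym; apply: W => //; [by rewrite eq_sym| |by rewrite crdC].
    by apply/and3P; move: cde; rewrite /crd /cr; clear -h ld le; lia.
  - by move: cde; rewrite /crd /cr h eqxx.
move=> _; have [s s0 H] := cyclic_orientation q_convex q_cyclic.
have dep := orient_dependency (q d.1) (q e.1) (q d.2) (q e.2).
have es := orient_sum (q d.1) (q e.1) (q d.2) (q e.2).
have A0 := H _ _ _ h2 h3; have B0 := H _ _ _ h1 (ltn_trans h2 h3).
have C0 := H _ _ _ (ltn_trans h1 h2) h3; have D0 := H _ _ _ h1 h2.
set A := orient _ _ _ in A0 dep es; set B := orient _ _ _ in B0 dep es.
set C := orient _ _ _ in C0 dep es; set D := orient _ _ _ in D0 dep es.
exists ((s * A + s * B)^-1 *: (s *: (A *: q d.1 + B *: q d.2))); split.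
  by rewrite scalerDr !scalerA; exact: open_segment_barycenter.
rewrite dep -mulrDr es mulrDr scalerDr !scalerA.
exact: open_segment_barycenter.
Qed.

Lemma triangulationE T : triangulation q T <-> ctri T.
Proof.
split=> [[cT dT xT]|[cT [dT xT]]].
  have dT' d : d \in T -> diag d by move/dT; rewrite is_diagonalE.
  split=> //; split=> // d e dd ee; apply/negP => cr.
  have nde : d != e by apply: contraTneq cr => ->; rewrite crd_same.
  by apply: (xT d e) => //; apply/crossesE => //; exact: dT'.
split=> // [d /dT|d e dd ee nde /crossesE cr]; first by rewrite is_diagonalE.
by have := xT _ _ dd ee; rewrite cr //; exact: dT.
Qed.

End CyclicPolygonChords.

Definition tri_num (R : realType) (k : nat) : R := (k * k.+1)%:R / 2.

Definition set_sum (R : realType) (n : nat) (x : 'rV[R]_n) (S : {set 'I_n}) : R :=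
  \sum_(l in S) x 0 l.

(** * The inequalities of a Hohlweg-Lange polygon *)

Section HLPolygon.
Variables (R : realType) (n : nat) (s : (n.-1).-tuple bool).
Variable p : 'I_n.+3 -> 'rV[R]_2.
Hypothesis n_ge1 : (1 <= n)%N.
Hypothesis p_HL : HL_polygon s p.

Local Notation U := (hl_sign s).

Let p_convex : convex_polygon p. Proof. by case: p_HL. Qed.

Let lt_abs (i j : 'I_n.+3) : (i < j)%N -> abscissa (p i) < abscissa (p j).
Proof. by case: p_HL => _ H _; exact: H. Qed.

Let sep : exists h : R, forall k : 'I_n.+3,
  (U k -> h < ordinate (p k)) /\ (~~ U k -> ordinate (p k) < h).
Proof.
by case: p_HL => _ _ [h H]; exists h => k; have := H k; rewrite -/(U k); case: (U k).
Qed.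

(** On the vertical line through [p k], the chord [ab] passes below [p k] and [cd] weakly above it,
    so [p k] would lie in the hull of the other vertices. *)
Let between_lines (a b c d k : 'I_n.+3) : a != k -> b != k -> c != k -> d != k ->
  (a < k)%N -> (k < b)%N -> (c < k)%N -> (k < d)%N ->
  0 < orient (p a) (p b) (p k) -> orient (p c) (p d) (p k) <= 0 -> False.
Proof.
move=> ak bk ck dk /lt_abs la /lt_abs lb /lt_abs lc /lt_abs ld o1 o2.
apply: (p_convex (k := k)).
pose D1 := abscissa (p b) - abscissa (p a); pose D2 := abscissa (p d) - abscissa (p c).
have D1p : 0 < D1 by rewrite /D1; lra.
have D2p : 0 < D2 by rewrite /D2; lra.
pose t := (abscissa (p k) - abscissa (p a)) / D1.
pose u := (abscissa (p k) - abscissa (p c)) / D2.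
have hL : conv_hull (predC1 k) p ((1 - t) *: p a + t *: p b).
  apply: conv_hull_comb; [exact: conv_hull_point|exact: conv_hull_point| | |by rewrite subrK].
    by rewrite subr_ge0 ler_pdivrMr // mul1r /D1; lra.
  by rewrite divr_ge0 // ltW // subr_gt0.
have hM : conv_hull (predC1 k) p ((1 - u) *: p c + u *: p d).
  apply: conv_hull_comb; [exact: conv_hull_point|exact: conv_hull_point| | |by rewrite subrK].
    by rewrite subr_ge0 ler_pdivrMr // mul1r /D2; lra.
  by rewrite divr_ge0 // ltW // subr_gt0.
pose A := orient (p a) (p b) (p k) / D1; pose B := - (orient (p c) (p d) (p k) / D2).
have A0 : 0 < A by rewrite divr_gt0.
have B0 : 0 <= B by rewrite oppr_ge0 mulr_le0_ge0 // invr_ge0 ltW.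
have AB : A + B != 0 by rewrite gt_eqF // ltr_pwDl.
have D1n : D1 != 0 by rewrite gt_eqF.
have D2n : D2 != 0 by rewrite gt_eqF.
have e1 : abscissa ((1 - t) *: p a + t *: p b) = abscissa (p k).
  by rewrite !coordE /t; move: D1n; rewrite /D1 => D1n; field.
have e2 : abscissa ((1 - u) *: p c + u *: p d) = abscissa (p k).
  by rewrite !coordE /u; move: D2n; rewrite /D2 => D2n; field.
have f1 : ordinate ((1 - t) *: p a + t *: p b) = ordinate (p k) - A.
  by rewrite !coordE /t /A /orient; move: D1n; rewrite /D1 => D1n; field.
have f2 : ordinate ((1 - u) *: p c + u *: p d) = ordinate (p k) + B.
  by rewrite !coordE /u /B /orient; move: D2n; rewrite /D2 => D2n; field.
have -> : p k = (B / (A + B)) *: ((1 - t) *: p a + t *: p b)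
    + (A / (A + B)) *: ((1 - u) *: p c + u *: p d).
  apply: rv2P.
    by rewrite abscissaD !abscissaZ e1 e2; field.
  by rewrite ordinateD !ordinateZ f1 f2; field.
apply: conv_hull_comb => //.
- by rewrite divr_ge0 // addr_ge0 // ltW.
- by rewrite divr_ge0 ?addr_ge0 // ltW.
- by rewrite -mulrDl addrC mulfV.
Qed.

(** The prescribed outer signs enter here. An upper vertex lies above the chord from 1 to [n.+1],
    whose ends are lower vertices; if it were also below [ij], it would lie between two chords. A
    lower vertex is compared likewise with the chord from 0 to [n.+2], whose ends are upper
    vertices. *)
Lemma orient_mid (i j k : 'I_n.+3) : (i < k)%N -> (k < j)%N ->
  (U k -> 0 < orient (p i) (p j) (p k)) /\ (~~ U k -> orient (p i) (p j) (p k) < 0).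
Proof.
move=> ik kj; have [h H] := sep.
have ne (a b : 'I_n.+3) : a != b :> nat -> a != b by rewrite (inj_eq val_inj).
have lj := ltn_ord j.
have [ik' jk'] : i != k /\ j != k by split; apply: ne; lia.
split=> Uk.
  rewrite ltNge; apply/negP => ok.
  have k1 : nat_of_ord k <> 1%N by move=> e; move: Uk; rewrite e hl_sign1.
  have k2 : nat_of_ord k <> n.+1 by move=> e; move: Uk; rewrite e (hl_sign_n1 s n_ge1).
  have v1 : (inord 1 : 'I_n.+3) = 1%N :> nat by rewrite inordK.
  have v2 : (inord n.+1 : 'I_n.+3) = n.+1 :> nat by rewrite inordK //; lia.
  have lt1 : ((inord 1 : 'I_n.+3) < k)%N by rewrite v1; lia.
  have lt2 : (k < (inord n.+1 : 'I_n.+3))%N by rewrite v2; lia.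
  apply: (@between_lines (inord 1) (inord n.+1) i j k) => //.
  - by apply: ne; rewrite neq_ltn lt1.
  - by apply: ne; rewrite neq_ltn lt2 orbT.
  have := (H (inord 1)).2; rewrite v1 hl_sign1 => /(_ isT) y1.
  have := (H (inord n.+1)).2; rewrite v2 (hl_sign_n1 s n_ge1) => /(_ isT) y2.
  have := (H k).1 Uk => y3.
  have x1 := lt_abs lt1; have x2 := lt_abs lt2.
  by rewrite /orient; nra.
rewrite ltNge; apply/negP => ok.
have v2 : (ord_max : 'I_n.+3) = n.+2 :> nat by [].
have lt1 : ((ord0 : 'I_n.+3) < k)%N by rewrite /=; lia.
have lt2 : (k < (ord_max : 'I_n.+3))%N by rewrite v2; lia.
have y1 : h < ordinate (p ord0) by apply: (H ord0).1.
have y2 : h < ordinate (p ord_max) by apply: (H ord_max).1; rewrite v2 (hl_sign_n2 s n_ge1).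
have y3 := (H k).2 Uk.
have x1 := lt_abs lt1; have x2 := lt_abs lt2.
have o0 : orient (p ord0) (p ord_max) (p k) < 0 by rewrite /orient; nra.
move: ok; rewrite le_eqVlt => /orP[/eqP ok|ok].
  have := orient_neq0 p_convex (i := i) (j := j) (k := k).
  by rewrite -ok eqxx ik' jk' (ne i j) // => [/(_ isT isT isT)|]; rewrite ?neq_ltn ?(ltn_trans ik kj).
apply: (@between_lines i j ord0 ord_max k) => //.
- by apply: ne; rewrite neq_ltn lt1.
- by apply: ne; rewrite neq_ltn lt2 orbT.
- exact: ltW.
Qed.

Lemma orient_sign (i j k : 'I_n.+3) : (i < j)%N -> k != i -> k != j ->
  let b := if (k < i)%N then U i else if (j < k)%N then U j else ~~ U k in
  (b -> orient (p i) (p j) (p k) < 0) /\ (~~ b -> 0 < orient (p i) (p j) (p k)).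
Proof.
move=> ij; rewrite -!(inj_eq val_inj) /= => ki kj.
case: (ltnP k i) => [ltki|leik].
  have [h1 h2] := orient_mid ltki ij.
  rewrite orient_cycle orient_cycle orient_cycle -orient_cycle orient_cycle.
  have -> : orient (p i) (p j) (p k) = - orient (p k) (p j) (p i).
    by rewrite orient_cycle orient_cycle orient_swap orient_cycle orient_cycle /orient; ring.
  split=> b; first by rewrite oppr_lt0; exact: h1.
  by rewrite oppr_gt0; exact: h2.
case: (ltnP j k) => [ltjk|lekj].
  have [h1 h2] := orient_mid ij ltjk.
  have -> : orient (p i) (p j) (p k) = - orient (p i) (p k) (p j) by rewrite /orient; ring.
  split=> b; first by rewrite oppr_lt0; exact: h1.
  by rewrite oppr_gt0; exact: h2.
have ik : (i < k)%N by clear -leik ki; lia.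
have kj' : (k < j)%N by clear -lekj kj; lia.
have [h1 h2] := orient_mid ik kj'.
by rewrite negbK; split.
Qed.

Lemma mem_HL_R (d : chord n) k : (d.1 < d.2)%N ->
  (k \in HL_R p d) = [&& k != d.1, k != d.2 &
    if (k < d.1)%N then U d.1 else if (d.2 < k)%N then U d.2 else ~~ U k].
Proof.
move=> ld; rewrite inE.
have [->|k1] := eqVneq k d.1; first by rewrite (orient_self _ _).1 ltxx.
have [->|k2] := eqVneq k d.2; first by rewrite (orient_self _ _).2 ltxx.
have /= := orient_sign ld k1 k2; set b := if _ then _ else _.
by case: b => -[h1 h2]; [rewrite h1|rewrite lt_gtF ?h2].
Qed.

Lemma mem_HL_S (d : chord n) k : (d.1 < d.2)%N ->
  (k \in HL_S p d) = (0 < k < n.+2)%N && hl_mem U d.1 d.2 k.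
Proof.
move=> ld; have l2 := ltn_ord d.2; have l1 := ltn_ord d.1; have lk := ltn_ord k.
apply/imsetP/andP.
  move=> [x]; rewrite mem_HL_R // => /and3P[x1 x2].
  rewrite -!(inj_eq val_inj) /= in x1 x2.
  case: eqP => [ex|x0] /=; first subst x.
    case: (ltnP 0 d.1) => [d1 U1 ->|d10]; last by exfalso; clear -d10 x1; move: x1 => /=; lia.
    by rewrite /hl_mem leqnn; split=> //; clear -d1 ld l2; lia.
  case: eqP => [ex|xm] /=; first subst x.
    case: (ltnP n.+2 d.1) => [d1|_]; first by exfalso; clear -d1 l1; lia.
    case: (ltnP d.2 n.+2) => [d2 U2 ->|d2].
      split; first by clear -d2 ld; lia.
      by rewrite /hl_mem (leqNgt d.2) ld leqnn.
    by exfalso; clear -d2 x2 l2; move: x2 => /=; lia.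
  move=> hx ->; have x0' : nat_of_ord x <> 0%N by move=> e; apply: x0; apply: val_inj.
  have xm' : nat_of_ord x <> n.+2 by move=> e; apply: xm; apply: val_inj.
  have lx := ltn_ord x; split; first by clear -x0' xm' lx; lia.
  move: hx; rewrite /hl_mem; case: (ltngtP x d.1) x1 => //= _ _.
  by case: (ltngtP d.2 x) x2 => //= h; rewrite h eqxx.
move=> [/andP[k0 kn] hk].
have kn0 : k != ord0 by rewrite -(inj_eq val_inj) /=; clear -k0; lia.
have knm : k != ord_max by rewrite -(inj_eq val_inj) /=; clear -kn; lia.
have [ek|k1] := eqVneq k d.1.
  rewrite ek in k0 hk; exists ord0; rewrite ?eqxx //.
  move: hk; rewrite mem_HL_R // -!(inj_eq val_inj) /= k0 /hl_mem leqnn => ->.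
  by rewrite andbT; clear -ld k0; lia.
have [ek|k2] := eqVneq k d.2.
  rewrite ek in kn hk; exists ord_max; last by rewrite /= eqxx.
  move: hk; rewrite mem_HL_R // -!(inj_eq val_inj) /= kn.
  rewrite /hl_mem leqnn (leqNgt d.2) ld /= => ->.
  have -> : (n.+2 < d.1)%N = false by clear -l1; lia.
  by rewrite andbT; clear -ld kn; lia.
exists k; last by rewrite (negPf kn0) (negPf knm).
rewrite mem_HL_R // k1 k2 /=; move: hk; rewrite /hl_mem.
rewrite -!(inj_eq val_inj) /= in k1 k2.
by case: (ltngtP k d.1) k1 => //= _ _; case: (ltngtP d.2 k) k2 => //= ->; rewrite eqxx.
Qed.

Lemma HL_is_diagonal (d : chord n) : is_diagonal p d =
  [&& (d.1 < d.2)%N, hl_set U d != finset.set0 & hl_set U d != [set: 'I_n.+1]%SET].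
Proof.
rewrite /is_diagonal; case: (boolP (d.1 < d.2)%N) => //= ld; rewrite /internal.
have l2 := ltn_ord d.2; have l1 := ltn_ord d.1.
have S0 : (hl_set U d != finset.set0) = (HL_R p d != finset.set0).
  apply/set0Pn/set0Pn => [[l]|[k kR]].
    rewrite inE => hl.
    have : inord l.+1 \in HL_S p d.
      by rewrite mem_HL_S // inordK ?hl //; have := ltn_ord l; lia.
    by case/imsetP => k kR _; exists k.
  have : (if k == ord0 then d.1 else if k == ord_max then d.2 else k) \in HL_S p d.
    by apply/imsetP; exists k.
  set k' := if _ then _ else _; rewrite mem_HL_S // => /andP[/andP[k0 kn] hk].
  by exists (inord k'.-1); rewrite inE inordK ?prednK //; lia.
congr andb.
  rewrite S0; apply/existsP/set0Pn => -[k hk]; exists k; first by rewrite inE.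
  by move: hk; rewrite inE.
have -> : (hl_set U d != [set: 'I_n.+1]%SET) = [exists l : 'I_n.+1, ~~ hl_mem U d.1 d.2 l.+1].
  rewrite -finset.subTset; apply/fintype.subsetPn/existsP => [[l _]|[l hl]].
    by rewrite inE => hl; exists l.
  by exists l; rewrite inE.
apply/existsP/existsP => [[k ok]|[l]].
  have k1 : k != d.1 by apply: contraTneq ok => ->; rewrite (orient_self _ _).1 ltxx.
  have k2 : k != d.2 by apply: contraTneq ok => ->; rewrite (orient_self _ _).2 ltxx.
  have /= [h1 _] := orient_sign ld k1 k2.
  set b := if _ then _ else _ in h1.
  have nb : ~~ b by apply/negP => /h1; rewrite ltNge ltW.
  rewrite /b in nb; rewrite -!(inj_eq val_inj) /= in k1 k2.
  have W (v : nat) : (0 < v < n.+2)%N -> ~~ hl_mem U d.1 d.2 v ->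
      exists x : 'I_n.+1, ~~ hl_mem U d.1 d.2 x.+1.
    by move=> v0 hv; exists (inord v.-1); rewrite inordK ?prednK //; clear -v0; lia.
  move: nb; case: (ltnP k d.1) => [kd U1|dk].
    by apply: (W d.1); [clear -kd l2 ld; lia|rewrite /hl_mem leqnn].
  case: (ltnP d.2 k) => [kd U2|dk'].
    have lk := ltn_ord k.
    by apply: (W d.2); [clear -kd lk ld; lia|rewrite /hl_mem leqnn (leqNgt d.2) ld].
  move=> Uk; apply: (W k); first by clear -dk dk' k1 k2 l2; lia.
  have e1 : (k <= d.1)%N = false by clear -dk k1; lia.
  have e2 : (d.2 <= k)%N = false by clear -dk' k2; lia.
  by rewrite /hl_mem e1 e2.
rewrite /hl_mem => hl; have ll := ltn_ord l.
have P (x : 'I_n.+3) : x != d.1 :> nat -> x != d.2 :> nat ->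
    ~~ (if (x < d.1)%N then U d.1 else if (d.2 < x)%N then U d.2 else ~~ U x) ->
    exists x, 0 < orient (p d.1) (p d.2) (p x).
  rewrite !(inj_eq val_inj) => x1 x2 hx; exists x.
  by have /= [_] := orient_sign ld x1 x2; apply.
move: hl; case: (leqP l.+1 d.1) => [l1' U1|l1'].
  by apply: (P ord0) => /=; [clear -l1'; lia|clear -ld; lia|rewrite (leq_trans _ l1')].
case: (leqP d.2 l.+1) => [l2' U2|l2' Ul].
  apply: (P ord_max) => /=; [by clear -ld l2 ; lia|by clear -l2' ll; lia|].
  rewrite ltnNge -ltnS l1 /= (_ : (d.2 < n.+2)%N) //.
  by clear -l2' ll; lia.
apply: (P (inord l.+1)); rewrite inordK; try (by clear -ll l1' l2' ; lia).
have e1 : (l.+1 < d.1)%N = false by clear -l1'; lia.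
have e2 : (d.2 < l.+1)%N = false by clear -l2'; lia.
by rewrite e1 e2.
Qed.

Let lift_vertex (l : 'I_n.+1) : 'I_n.+3 := inord l.+1.

Let lift_vertexE l : lift_vertex l = l.+1 :> nat.
Proof. by rewrite /lift_vertex inordK //; have := ltn_ord l; lia. Qed.

Let lift_vertex_inj : injective lift_vertex.
Proof.
by move=> k l /(congr1 (@nat_of_ord _)); rewrite !lift_vertexE => -[] /val_inj.
Qed.

Let HL_S_image (d : chord n) : (d.1 < d.2)%N ->
  HL_S p d = (lift_vertex @: hl_set U d)%SET.
Proof.
move=> ld; apply/finset.setP => k; rewrite mem_HL_S //; apply/andP/imsetP.
  move=> [k0 hk]; exists (inord k.-1).
    by rewrite inE inordK ?prednK //; clear -k0; lia.
  by apply: val_inj; rewrite /= lift_vertexE inordK ?prednK //; clear -k0; lia.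
move=> [l]; rewrite inE => hl ->; rewrite lift_vertexE; split=> //.
by have := ltn_ord l; lia.
Qed.

Lemma Ass_IE (x : 'rV[R]_n.+1) : Ass_I p x <->
  (forall d : chord n, (d.1 < d.2)%N -> hl_set U d != finset.set0 ->
     hl_set U d != [set: 'I_n.+1]%SET -> tri_num R #|hl_set U d| <= set_sum x (hl_set U d))
  /\ \sum_l x 0 l = tri_num R n.+1.
Proof.
have coordl (l : 'I_n.+1) : coord1 x (lift_vertex l) = x 0 l.
  by rewrite /coord1 lift_vertexE /= inord_val.
have sumE (d : chord n) : (d.1 < d.2)%N ->
    \sum_(k in HL_S p d) coord1 x k = set_sum x (hl_set U d).
  move=> ld; rewrite HL_S_image // big_imset /=; last by move=> ? ? _ _; exact: lift_vertex_inj.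
  by apply: eq_bigr => l _; rewrite coordl.
have cardE (d : chord n) : (d.1 < d.2)%N -> #|HL_S p d| = #|hl_set U d|.
  by move=> ld; rewrite HL_S_image // card_imset.
have totE : \sum_(1 <= k < n.+2) coord1 x k = \sum_l x 0 l.
  rewrite big_add1 /= big_mkord; apply: eq_bigr => l _.
  by rewrite /coord1 /= inord_val.
rewrite /Ass_I /= totE; split=> -[H Ht]; split => //.
  move=> d ld h1 h2; rewrite -sumE // -cardE //; apply: H.
  by rewrite HL_is_diagonal ld h1 h2.
move=> d; rewrite HL_is_diagonal => /and3P[ld h1 h2].
by rewrite sumE // cardE //; exact: H.
Qed.

End HLPolygon.

(** * Normal fans *)

Section LinearMaps.
Variables (K : fieldType) (V W : vectType K).

Lemma lfun_injective_bijective (f : 'Hom(V, W)) :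
  (\dim {:W} <= \dim {:V})%N -> (forall v, f v = 0 -> v = 0) -> bijective f.
Proof.
move=> dWV finj.
have ker0 : lker f == 0%VS.
  apply/lker0P => x y /eqP; rewrite -subr_eq0 -linearB => /eqP/finj/eqP.
  by rewrite subr_eq0 => /eqP.
have im : limg f = fullv.
  apply/eqP; rewrite eqEdim subvf /= limg_dim_eq //.
  by move: ker0 => /eqP->; rewrite capv0.
exists (f^-1)%VF; first exact: lker0_lfunK.
by move=> w; apply: limg_lfunVK; rewrite im memvf.
Qed.

Lemma lfun_bijective_dim (f : 'Hom(V, W)) : bijective f -> \dim {:W} = \dim {:V}.
Proof.
move=> [g fK gK]; have ker0 : lker f == 0%VS by apply/lker0P/(can_inj fK).
rewrite -(limg_dim_eq (f := f) (U := fullv)); last by rewrite (eqP ker0) capv0.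
congr (\dim _); apply/vspaceP => w; rewrite memvf; apply/esym.
by rewrite -(gK w) memv_img // memvf.
Qed.

Lemma lfun_bijectiveV (f : 'Hom(V, W)) : bijective f ->
  exists g : 'Hom(W, V), cancel f g /\ cancel g f.
Proof.
move=> [g fK gK]; exists (f^-1)%VF.
have ker0 : lker f == 0%VS by apply/lker0P/(can_inj fK).
have h := lker0_lfunK ker0; split=> // w.
by rewrite -{2}(gK w) -[g w]h gK.
Qed.

Lemma dim_Hom1 : \dim {: 'Hom(V, K^o)} = \dim {:V}.
Proof. by rewrite !dimvf /= /dim /= muln1. Qed.

End LinearMaps.

Section LinearSpan.
Variables (R : realType) (W : vectType R).
Implicit Types (A : set W) (U : {vspace W}).

(** A containing subspace of least dimension is contained in every other one, as their intersection
    still contains [A]; so [xget] does not return its default value. *)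
Lemma linear_span_spec A : (forall x, A x -> x \in linear_span A) /\
  (forall U, (forall x, A x -> x \in U) -> (linear_span A <= U)%VS).
Proof.
rewrite /linear_span; case: xgetP => [U -> []//|nex]; exfalso.
pose Q k := `[< exists2 U : {vspace W}, (forall x, A x -> x \in U) & \dim U = k >].
have exQ : exists k, Q k.
  by exists (\dim {:W}); apply/asboolP; exists fullv => // x _; exact: memvf.
case: (ex_minnP exQ) => k /asboolP[U AU dU] kmin; apply: (nex U); split => // U' AU'.
have AI x : A x -> x \in (U :&: U')%VS by move=> Ax; rewrite memv_cap AU ?AU'.
have := kmin (\dim (U :&: U')) (asboolT (ex_intro2 _ _ _ AI erefl)).
rewrite -dU => dI; suff -> : U = (U :&: U')%VS by exact: capvSr.
by apply/esym/eqP; rewrite eqEdim capvSl.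
Qed.

Lemma sub_direction (P : set W) x y : P x -> P y -> x - y \in direction P.
Proof. by move=> Px Py; apply: (linear_span_spec _).1; exists x, y. Qed.

Lemma direction_min (P : set W) U :
  (forall x y, P x -> P y -> x - y \in U) -> (direction P <= U)%VS.
Proof. by move=> H; apply: (linear_span_spec _).2 => _ [x [y [Px Py ->]]]; exact: H. Qed.

End LinearSpan.

(** * Faces and normal cones through maximized forms *)

Section ArgMax.
Variables (R : realType) (W : vectType R) (P : set W).
Local Notation D := (direction P).
Local Notation dual := 'Hom(subvs_of D, R^o).
Implicit Types (c : dual) (F : set W).

(* A form on the direction space evaluated at any point: only the differences
   of its values at points of P are meaningful. *)
Definition ev c (z : W) : R := c (vsproj D z).

Lemma evDl c c' z : ev (c + c') z = ev c z + ev c' z.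
Proof. by rewrite /ev add_lfunE. Qed.
Lemma evBl c c' z : ev (c - c') z = ev c z - ev c' z.
Proof. by rewrite /ev add_lfunE opp_lfunE. Qed.
Lemma evZl (a : R) c z : ev (a *: c) z = a * ev c z.
Proof. by rewrite /ev scale_lfunE. Qed.
Lemma evB c y z : ev c (y - z) = ev c y - ev c z.
Proof. by rewrite /ev !linearB. Qed.
Lemma evZ (a : R) c z : ev c (a *: z) = a * ev c z.
Proof. by rewrite /ev !linearZ. Qed.
Lemma ev_sum c (I : finType) (E : pred I) (t : I -> R) (x : I -> W) :
  ev c (\sum_(i | E i) t i *: x i) = \sum_(i | E i) t i * ev c (x i).
Proof. by rewrite /ev !linear_sum /=; apply: eq_bigr => i _; rewrite !linearZ. Qed.

Definition amax c : set W := [set x | P x /\ forall y, P y -> ev c y <= ev c x].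

Lemma normal_coneP F c : F `<=` P -> normal_cone P F c <-> F `<=` amax c.
Proof.
move=> FP; split=> [H x Fx|H x y Fx Py].
  split; first exact: FP.
  by move=> y Py; have := H x y Fx Py; rewrite -/(ev c _) evB subr_le0.
by rewrite -/(ev c _) evB subr_le0; apply: (H x Fx).2.
Qed.

(** Faces are cut out by forms on the ambient space, normal cones consist of forms on the direction
    space. Restriction and composition with [vsproj] pass from one to the other, preserving
    differences of values on [P]. *)
Lemma face_amax F : face P F <-> F !=set0 /\ exists c, F = amax c.
Proof.
split=> -[F0 [c eF]]; (split; first exact: F0); rewrite {F0}eF.
  pose c' : dual := (c \o linfun vsval)%VF.
  exists c'; apply/seteqP.
  have E x y : P x -> P y -> ev c' y - ev c' x = c y - c x.
    move=> Px Py; rewrite -evB /ev /c' comp_lfunE lfunE /= vsprojK ?sub_direction //.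
    by rewrite linearB.
  have le x y : P x -> P y -> (ev c' y <= ev c' x) = ((c y : R) <= c x).
    by move=> Px Py; rewrite -[LHS]subr_le0 E // subr_le0.
  by split=> x [Px H]; split=> // y Py; have := H y Py; rewrite le.
exists (c \o linfun (vsproj D))%VF.
apply/seteqP.
by split=> x [Px H]; split=> // y Py; have := H y Py; rewrite /ev !comp_lfunE !lfunE.
Qed.

Lemma amax_sub c : amax c `<=` P. Proof. by move=> x []. Qed.

Lemma face_sub F : face P F -> F `<=` P.
Proof. by move=> /face_amax[_ [c ->]]; exact: amax_sub. Qed.

Lemma polytope_amax_neq0 c : polytope P -> P !=set0 -> amax c !=set0.
Proof.
move=> [k [p eP]] [x0]; rewrite eP => -[t0 [_ t01 _]].
have k0 : (0 < k)%N.
  by case: k p eP t0 t01 => // p _ t0; rewrite big_ord0 => /esym/eqP; rewrite oner_eq0.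
pose i0 : 'I_k := Ordinal k0.
case: (@arg_maxP _ _ _ i0 xpredT (fun i => ev c (p i)) isT) => i _ imax.
have pP j : P (p j).
  rewrite eP; exists (fun l => (l == j)%:R); split.
  - by move=> l; exact: ler0n.
  - by rewrite (bigD1 j) //= eqxx big1 ?addr0 // => l /negPf->.
  - by rewrite (bigD1 j) //= eqxx scale1r big1 ?addr0 // => l /negPf->; rewrite scale0r.
exists (p i); split=> // y; rewrite {1}eP => -[t [t_ge0 t1 ->]].
rewrite ev_sum -[leRHS]mul1r -t1 mulr_suml; apply: ler_sum => j _.
by apply: ler_wpM2l => //; exact: imax.
Qed.

(* The smallest normal cone containing c0 has c0 in its relative interior. *)
Lemma normal_cone_interior c0 x : polytope P -> amax c0 !=set0 ->
  normal_cone P (amax c0) x ->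
  exists2 e : R, 0 < e & normal_cone P (amax c0) (c0 + e *: (c0 - x)).
Proof.
move=> [k [p eP]] [y1 y1max] /(normal_coneP x (@amax_sub c0)) xmax.
have pP j : P (p j).
  rewrite eP; exists (fun l => (l == j)%:R); split.
  - by move=> l; exact: ler0n.
  - by rewrite (bigD1 j) //= eqxx big1 ?addr0 // => l /negPf->.
  - by rewrite (bigD1 j) //= eqxx scale1r big1 ?addr0 // => l /negPf->; rewrite scale0r.
pose a j := ev c0 y1 - ev c0 (p j); pose b j := ev x y1 - ev x (p j).
have a0 j : 0 <= a j by rewrite subr_ge0; apply: y1max.2.
have b0 j : 0 <= b j by rewrite subr_ge0; apply: (xmax _ y1max).2.
have ab j : a j = 0 -> b j = 0.
  move=> aj; have pm : amax c0 (p j).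
    split=> // y Py; apply: (le_trans (y1max.2 y Py)).
    by move/eqP: aj; rewrite subr_eq0 => /eqP->.
  apply/eqP; rewrite eq_le b0 andbT subr_le0.
  by apply: (xmax _ pm).2; exact: y1max.1.
(* This makes [e * b j <= a j] for every [j] at once. Where [a j] vanishes so does [b j], and the
   quotient is 0 by convention. *)
pose e := (1 + \sum_j b j / a j)^-1.
have s0 : 0 <= \sum_j b j / a j by apply: sumr_ge0 => j _; rewrite divr_ge0.
have e0 : 0 < e by rewrite invr_gt0 ltr_pwDl.
exists e => //; apply/normal_coneP; first exact: amax_sub.
have key j : e * b j <= a j.
  have [aj|aj] := eqVneq (a j) 0; first by rewrite (ab _ aj) aj mulr0.
  have aj0 : 0 < a j by rewrite lt_def aj a0.
  rewrite -[leRHS]mul1r -ler_pdivrMr // -mulrA mulrC ler_pdivrMr ?ltr_pwDl // mul1r.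
  rewrite (bigD1 j) //= addrCA lerDl addr_ge0 // sumr_ge0 // => i _.
  by rewrite divr_ge0.
move=> y2 y2max; split; first exact: y2max.1.
have ey : ev c0 y2 = ev c0 y1.
  by apply/eqP; rewrite eq_le y1max.2 ?y2max.2 //; [exact: y1max.1|exact: y2max.1].
have ex : ev x y2 = ev x y1.
  apply/eqP; rewrite eq_le (xmax _ y1max).2 ?(xmax _ y2max).2 //; [exact: y1max.1|exact: y2max.1].
move=> y; rewrite {1}eP => -[t [t_ge0 t1 ->]].
rewrite ev_sum -[leRHS]mul1r -t1 mulr_suml; apply: ler_sum => j _.
apply: ler_wpM2l => //; rewrite !evDl !evZl !evBl ey ex.
have := key j; have := a0 j; rewrite /a /b => h1 h2.
have := ltW e0 => e0'; have := mulr_ge0 e0' h1; lra.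
Qed.

End ArgMax.

(** * Surjectivity of a normal isomorphism on cones *)

Section IsomorphismSurjective.
Variables (R : realType) (W W' : vectType R) (P : set W) (Q : set W').

(* The image of the smallest cone around g^-1 c' is the smallest cone around c'. *)
Lemma normal_fan_isomorphism_surj (g : 'Hom(conormal_space P, conormal_space Q)) :
  polytope P -> P !=set0 -> bijective g ->
  (forall C, normal_fan P C -> normal_fan Q (g @` C)) ->
  forall C', normal_fan Q C' -> exists2 C, normal_fan P C & C' = g @` C.
Proof.
move=> polP P0 bij H _ [F' [fF' ->]].
have [g' [gK1 gK2]] := lfun_bijectiveV bij.
have [[y' F'y'] [c' eF']] := (face_amax Q F').1 fF'.
pose c0 := g' c'.
have F0n : amax (P := P) c0 !=set0 by exact: polytope_amax_neq0.
have fF0 : face P (amax (P := P) c0) by apply/face_amax; split=> //; exists c0.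
have NC : normal_fan P (normal_cone P (amax (P := P) c0)) by exists (amax (P := P) c0).
exists (normal_cone P (amax (P := P) c0)) => //.
have [G' [fG' eG']] := H _ NC.
have [[y0 G'y0] _] := (face_amax Q G').1 fG'.
have c0in : normal_cone P (amax (P := P) c0) c0.
  by apply/normal_coneP => //; exact: amax_sub.
have imP x : normal_cone P (amax (P := P) c0) x -> G' `<=` amax (P := Q) (g x).
  move=> nx; apply/(normal_coneP _ (face_sub fG')).
  by rewrite -eG'; exists x.
have G'F' : G' `<=` F'.
  by rewrite eF' -[c']gK2; exact: imP.
apply/seteqP; split.
  rewrite eG' => c /(normal_coneP _ (face_sub fF')) h.
  by apply/(normal_coneP _ (face_sub fG')); apply: subset_trans h.
move=> _ [x nx <-].
(* [c0] is a weighted mean of [x] and another form of its cone. The images of both are maximal at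
   [y0], while [c'], their mean, takes the same value at [y] and [y0]; so [g x] cannot drop from
   [y0] to [y]. *)
have [e e0 nw] := normal_cone_interior polP F0n nx.
apply/(normal_coneP _ (face_sub fF')) => y F'y.
have Qy : Q y by exact: face_sub F'y.
have Qy0 : Q y0 by exact: face_sub G'y0.
have mx := imP _ nx _ G'y0; have mw := imP _ nw _ G'y0.
split=> // z Qz; apply: (le_trans (mx.2 z Qz)).
have hw := mw.2 y Qy.
have hc : ev (P := Q) c' y = ev (P := Q) c' y0.
  have := F'y; rewrite eF' => -[_ h1].
  have := G'F' _ G'y0; rewrite eF' => -[_ h2].
  by apply/eqP; rewrite eq_le h1 // h2.
move: hw; rewrite linearD linearZ linearB /= -/c0 /c0 gK2 !evDl !evZl !evBl hc.
by rewrite lerD2l ler_pM2l // lerD2l lerN2.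
Qed.

End IsomorphismSurjective.

Section Restriction.
Variables (R : realType) (W : vectType R) (D : {vspace W}).

Definition restr (c : 'Hom(W, R^o)) : 'Hom(subvs_of D, R^o) :=
  (c \o linfun vsval)%VF.

Lemma restr_is_linear : linear restr.
Proof. by move=> a c c'; rewrite /restr comp_lfunDl -comp_lfunZl. Qed.

HB.instance Definition _ := GRing.isSemilinear.Build R 'Hom(W, R^o) 'Hom(subvs_of D, R^o)
  _ restr (GRing.semilinear_linear restr_is_linear).

Lemma restrE c z : z \in D -> restr c (vsproj D z) = c z.
Proof. by move=> zD; rewrite /restr comp_lfunE lfunE /= vsprojK. Qed.

End Restriction.

Lemma conic_hull_point (R : realType) (V : lmodType R) (E : finType) (D : pred E)
  (v : E -> V) d : D d -> conic_hull D v (v d).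
Proof.
by move=> Dd; exists (fun e => (e == d)%:R); split; [move=> e; exact: ler0n|rewrite sum_pick].
Qed.

(** * A criterion for the normal fan *)

Section NormalFan.
Variables (R : realType) (W V : vectType R) (P : set W) (E : finType).
Variables (tri : {set E} -> Prop) (v : E -> V) (L : 'Hom(V, 'Hom(W, R^o))) (M : E -> R).
Local Notation pairing u y := ((L u : 'Hom(W, R^o)) y : R).

Hypothesis bound : forall T d y, tri T -> d \in T -> P y -> pairing (v d) y <= M d.
Hypothesis vertex : forall T, tri T -> exists x, [/\ P x,
  forall d, d \in T -> pairing (v d) x = M d &
  forall T' d, tri T' -> d \in T' -> pairing (v d) x = M d -> d \in T].
Hypothesis complete : forall u, exists2 T, tri T & conic_hull (mem T) v u.
Hypothesis flips : forall T d, tri T -> d \in T ->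
  exists T' : {set E}, [/\ tri T', T :\ d \subset T' & d \notin T'].
Hypothesis dim_le : (\dim (direction P) <= \dim {:V})%N.

Local Notation D := (direction P).

Let f : 'Hom(V, 'Hom(subvs_of D, R^o)) := (linfun (@restr R W D) \o L)%VF.

Let fE u y z : P y -> P z -> ev (P := P) (f u) y - ev (P := P) (f u) z = pairing u y - pairing u z.
Proof.
move=> Py Pz; rewrite -evB /ev /f comp_lfunE lfunE /= restrE ?sub_direction //.
by rewrite linearB.
Qed.

Let pairing_sum (T : {set E}) (t : E -> R) y :
  pairing (\sum_(d in T) t d *: v d) y = \sum_(d in T) t d * pairing (v d) y.
Proof.
rewrite linear_sum sum_lfunE; apply: eq_bigr => d _.
by rewrite linearZ /= scale_lfunE.
Qed.

Let tight (S : {set E}) : set W := [set y | P y /\ forall d, d \in S -> pairing (v d) y = M d].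

Let supp (T : {set E}) (t : E -> R) : {set E} := [set d in T | t d != 0]%SET.

Let suppS T t : supp T t \subset T.
Proof. by apply/fintype.subsetP => d; rewrite inE => /andP[]. Qed.

Let sum_supp (T : {set E}) (t : E -> R) : \sum_(d in T) t d *: v d = \sum_(d in supp T t) t d *: v d.
Proof.
rewrite (bigID (fun d => t d != 0)) /= [X in _ + X]big1 ?addr0.
  by apply: eq_bigl => d; rewrite inE.
by move=> d /andP[_ /negPn/eqP->]; rewrite scale0r.
Qed.

(** A nonnegative combination of inequalities attains its bound exactly where every inequality with
    a positive coefficient is tight; the vertex of [T] shows that the bound is attained. *)
Let amax_tight (T : {set E}) (t : E -> R) : tri T -> (forall d, 0 <= t d) ->
  amax (P := P) (f (\sum_(d in T) t d *: v d)) = tight (supp T t).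
Proof.
move=> tT t0; set u := \sum_(d in T) _.
have [x [Px xT xtight]] := vertex tT.
have ux : pairing u x = \sum_(d in T) t d * M d.
  by rewrite pairing_sum; apply: eq_bigr => d dT; rewrite xT.
have le_ux y : P y -> pairing u y <= \sum_(d in T) t d * M d.
  by move=> Py; rewrite pairing_sum; apply: ler_sum => d dT; rewrite ler_wpM2l // (bound tT).
have eq_ux y : P y -> pairing u y = \sum_(d in T) t d * M d ->
    forall d, d \in T -> t d != 0 -> pairing (v d) y = M d.
  move=> Py e d dT td; apply/eqP; rewrite eq_le (bound tT) //= leNgt; apply/negP => lt.
  move: e; rewrite pairing_sum => /eqP; apply/negP; rewrite lt_eqF //.
  rewrite (bigD1 d) //= [ltRHS](bigD1 d) //=; apply: ltr_leD.
    by rewrite ltr_pM2l // lt_def td t0.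
  by apply: ler_sum => e /andP[eT _]; rewrite ler_wpM2l // (bound tT).
apply/seteqP; split => y.
  move=> [Py ymax]; split=> // d; rewrite inE => /andP[dT td].
  apply: eq_ux => //; apply/eqP; rewrite eq_le le_ux //= -ux.
  by rewrite -subr_le0 -fE // subr_le0; exact: ymax.
move=> [Py yt]; split=> // z Pz.
rewrite -subr_le0 fE // subr_le0.
suff -> : pairing u y = \sum_(d in T) t d * M d by exact: le_ux.
rewrite pairing_sum; apply: eq_bigr => d dT.
have [->|td] := eqVneq (t d) 0; first by rewrite !mul0r.
by rewrite yt // inE dT.
Qed.

(** The vertices of all triangulations containing [S] lie in [tight S], so each [d] in [S'] belongs
    to all of them; if [d] were not in [S], a flip would give one that still contains [S] and avoids
    [d]. *)
Let tight_antimono (S T S' T' : {set E}) : tri T -> S \subset T -> tri T' -> S' \subset T' ->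
  tight S `<=` tight S' -> S' \subset S.
Proof.
move=> tT ST tT' ST' sub; apply/fintype.subsetP => d dS'.
have inT T'' : tri T'' -> S \subset T'' -> d \in T''.
  move=> tT'' ST''; have [x [Px xT xtight]] := vertex tT''.
  have /sub[_ h] : tight S x.
    by split=> // e eS; apply: xT; exact: (fintype.subsetP ST'' _ eS).
  by apply: (xtight T' d tT'); [exact: (fintype.subsetP ST' _ dS')|exact: h].
apply/negPn/negP => ndS.
have [T'' [tT'' sT'' ndT'']] := flips tT (inT T tT ST).
move/negP: ndT''; apply; apply: inT => //; apply: fintype.subset_trans sT''.
by rewrite finset.subsetD1 ST ndS.
Qed.

Let tight_neq0 (S T : {set E}) : tri T -> S \subset T -> tight S !=set0.
Proof.
move=> tT ST; have [x [Px xT _]] := vertex tT; exists x; split=> // d dS.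
by apply: xT; exact: (fintype.subsetP ST _ dS).
Qed.

(** By completeness [u] is a combination over a triangulation; if its form vanishes, all of [P] is
    tight for the support, which is therefore empty. *)
Let f_inj u : f u = 0 -> u = 0.
Proof.
move=> fu; have [T tT [t [t0 eu]]] := complete u.
have := amax_tight tT t0; rewrite -[\sum_(d in T) _]eu fu => e.
have sub : tight finset.set0 `<=` tight (supp T t).
  rewrite -e => y [Py _]; split=> // z Pz.
  by rewrite /ev !zero_lfunE.
have := tight_antimono tT (finset.sub0set _) tT (suppS T t) sub.
rewrite finset.subset0 => /eqP s0.
by rewrite eu -[LHS]/(\sum_(d in T) _) sum_supp s0 big_set0.
Qed.

Let f_bij : bijective f.
Proof.
by apply: lfun_injective_bijective f_inj; rewrite dim_Hom1 dimvf /=.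
Qed.

Let normal_cone_tight (S T : {set E}) : tri T -> S \subset T ->
  normal_cone P (tight S) = f @` conic_hull (mem S) v.
Proof.
move=> tT ST.
have tP : tight S `<=` P by move=> y [].
apply/seteqP; split=> [c /(normal_coneP c tP) cS|_ [u [t [t0 ->]] <-]].
  have [g fK gK] := f_bij.
  have [T' tT' [t [t0 eu]]] := complete (g c).
  exists (g c) => //.
  have ec : c = f (\sum_(d in T') t d *: v d) by rewrite -[in RHS]eu gK.
  rewrite ec amax_tight // in cS.
  have sS := tight_antimono tT ST tT' (suppS T' t) cS.
  exists (fun d => if d \in supp T' t then t d else 0); split.
    by move=> d; case: ifP.
  rewrite eu -[LHS]/(\sum_(d in T') _) sum_supp.
  rewrite [RHS](bigID [in supp T' t]) /= [X in _ + X]big1 ?addr0; last first.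
    by move=> d /andP[_ /negPf->]; rewrite scale0r.
  apply: eq_big => [d|d ->//].
  apply/idP/andP => [h|[]//]; split=> //.
  exact: (fintype.subsetP sS _ h).
apply/(normal_coneP _ tP); pose t' d := if d \in S then t d else 0.
have -> : \sum_(d | mem S d) t d *: v d = \sum_(d in T) t' d *: v d.
  rewrite [RHS](bigID [in S]) /= [X in _ + X]big1 ?addr0; last first.
    by move=> d /andP[_ /negPf dS]; rewrite /t' dS scale0r.
  apply: eq_big => [d|d dS]; last by rewrite /t' dS.
  by apply/idP/andP => [h|[]//]; split=> //; exact: (fintype.subsetP ST _ h).
rewrite amax_tight //; last by move=> d; rewrite /t'; case: ifP.
move=> y [Py yt]; split=> // d; rewrite inE /t' => /andP[_].
by case: ifP => [dS _|]; [exact: yt|rewrite eqxx].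
Qed.

(** Subsets [S] of triangulations correspond to the faces [tight S], and the normal cone of such a
    face is the image under [f] of the cone over [S]. Every form on the directions is reached
    because the cones cover the space and [f] is bijective. *)
Theorem normal_fan_of_vertices : has_normal_fan P
  [set C | exists T S : {set E}, [/\ tri T, S \subset T & C = conic_hull (mem S) v]].
Proof.
exists f; split; first exact: f_bij.
apply/seteqP; split=> [C [F [fF ->]]|_ [_ [T [S [tT ST ->]]] <-]].
  have [F0 [c eF]] := (face_amax P F).1 fF.
  have [g fK gK] := f_bij.
  have [T tT [t [t0 eu]]] := complete (g c).
  exists (conic_hull (mem (supp T t)) v); first by exists T, (supp T t).
  rewrite -(normal_cone_tight tT (suppS T t)).
  by rewrite -amax_tight // -[X in f X]/(\sum_(d | mem T d) _) -eu gK eF.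
exists (tight S); split; last by rewrite (normal_cone_tight tT ST).
apply/face_amax; split; first exact: tight_neq0 ST.
exists (f (\sum_(d in T) (d \in S)%:R *: v d)).
rewrite amax_tight; [|exact: tT|by move=> d; exact: ler0n].
suff -> : supp T (fun d => (d \in S)%:R) = S by [].
apply/finset.setP => d; rewrite inE pnatr_eq0 eqb0 negbK.
by case: (boolP (d \in S)) => dS; rewrite ?andbF // (fintype.subsetP ST _ dS).
Qed.

End NormalFan.

(** * The fan of the snake triangulation *)

Section LinearForm.
Variables (R : realType) (k : nat).

Definition lform (c : 'I_k -> R) (x : 'rV[R]_k) : R^o := \sum_l c l * x 0 l.

Lemma lform_is_linear c : linear (lform c).
Proof.
move=> t x y; rewrite /lform /GRing.scale /= mulr_sumr -big_split /=.
by apply: eq_bigr => l _; rewrite !mxE; ring.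
Qed.

HB.instance Definition _ c := GRing.isSemilinear.Build R 'rV[R]_k R^o _ (lform c)
  (GRing.semilinear_linear (lform_is_linear c)).

End LinearForm.

Section BasisExtension.
Variables (K : fieldType) (V U : vectType K) (n : nat).

Lemma basis_extension (a : 'I_n -> V) (phi : 'I_n -> U) :
  free (codom a) -> exists h : 'Hom(V, U), forall i, h (a i) = phi i.
Proof.
move=> fa; have [f Hf] := linear_of_free (codom a) (codom phi).
exists (linfun f) => i; rewrite lfunE /=.
have : map f (codom a) = codom phi by apply: Hf => //; rewrite !size_map.
rewrite /codom -map_comp => /eq_in_map; apply; exact: mem_enum.
Qed.

End BasisExtension.

(** Strict convexity of [k(k+1)/2]: the cardinalities of union and intersection have the same sum as
    those of [A] and [B] but lie further apart. *)
Lemma tri_num_strict (R : realType) (k : nat) (A B : {set 'I_k}) :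
  ~~ (A \subset B) -> ~~ (B \subset A) ->
  tri_num R #|A| + tri_num R #|B| < tri_num R #|A :|: B|%SET + tri_num R #|A :&: B|%SET.
Proof.
move=> AB BA.
have h1 : (#|A :&: B|%SET < #|A|)%N.
  apply: proper_card; rewrite properE subsetIl /=.
  by apply: contra AB => /fintype.subset_trans; apply; exact: subsetIr.
have h2 : (#|A :&: B|%SET < #|B|)%N.
  apply: proper_card; rewrite properE subsetIr /=.
  by apply: contra BA => /fintype.subset_trans; apply; exact: subsetIl.
have := cardsUI A B; move: h1 h2.
move: #|A|%N #|B|%N #|A :|: B|%SET #|A :&: B|%SET => p q u c pc qc e.
have [p' ep] : exists p', p = (c + p'.+1)%N by exists (p - c.+1)%N; lia.
have [q' eq] : exists q', q = (c + q'.+1)%N by exists (q - c.+1)%N; lia.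
have -> : u = (c + p'.+1 + q'.+1)%N by lia.
rewrite ep eq /tri_num -!mulrDl ltr_pM2r ?invr_gt0 ?ltr0n // -!natrD ltr_nat; nia.
Qed.

(** Summation by parts, which passes from sums over sets to prefix sums, the coordinates in the
    simple roots. *)
Lemma abel_sum (R : realType) (n : nat) (s x : nat -> R) :
  \sum_(i < n) (s i.+1 - s i) * \sum_(l < i.+1) x l =
  s n * \sum_(l < n.+1) x l - \sum_(l < n.+1) s l * x l.
Proof.
elim: n => [|n IH]; first by rewrite big_ord0 !big_ord1; ring.
by rewrite big_ord_recr IH /= ![\sum_(l < n.+2) _]big_ord_recr /=; ring.
Qed.

(** * Santos vectors of the snake seed *)

Section SnakeVectors.
Variables (R : realType) (n : nat) (V : vectType R) (a : 'I_n -> V).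
Hypothesis a_basis : basis_of fullv (codom a).
Hypothesis n_ge1 : (0 < n)%N.
Implicit Types (d e : chord n) (S A B : {set 'I_n.+1}) (T : {set chord n}).
Local Notation m := n.+3.
Local Notation W := 'rV[R]_n.+1.
Local Notation lo i := (widen_ord (leqnSn n) i).
Local Notation hi i := (lift ord0 i).

(** Compensates the alternation along the zigzag: the indicator of a chord crossing a segment steps
    up or down according to the parity of [i], but its coefficient has to be 1. *)
Definition bsign (i : nat) : R := (-1) ^+ i.+1.

Lemma bsign_sqr i : bsign i * bsign i = 1.
Proof. by rewrite -expr2 sqrr_sign. Qed.

(* The Santos vector of a diagonal with set S, for the snake seed. *)
Definition vset S : V :=
  \sum_(i < n) (bsign i * ((hi i \in S)%:R - (lo i \in S)%:R)) *: a i.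

Lemma vset_modular A B : vset A + vset B = vset (A :|: B)%SET + vset (A :&: B)%SET.
Proof.
rewrite -!big_split /=; apply: eq_bigr => i _; rewrite -!scalerDl -!mulrDr !inE.
congr (_ * _ *: _).
by do !case: (_ \in _); rewrite /=; ring.
Qed.

Lemma vset0 : vset finset.set0 = 0.
Proof. by apply: big1 => i _; rewrite !inE subrr mulr0 scale0r. Qed.

Lemma vsetT : vset [set: 'I_n.+1]%SET = 0.
Proof. by apply: big1 => i _; rewrite !inE subrr mulr0 scale0r. Qed.

Lemma vset_coord d (i : 'I_n) : diag d ->
  bsign i * ((hi i \in aset d)%:R - (lo i \in aset d)%:R) =
  if snake_chord n i == d then -1 else (crd d (snake_chord n i))%:R.
Proof.
move=> /andP[ld nd].
have li : (0 < i.+1 <= n)%N by rewrite /=.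
have /= [h1 h2 h3] := alt_mem_snake (ltn_ord d.1) (ltn_ord d.2) nd li.
have lu : (snake_label m i < m)%N by rewrite snake_label_lt // ltnW.
have lw : (snake_label m i.+1 < m)%N by rewrite snake_label_lt.
rewrite (same_chord_mk lu lw (ltnW ld)) -/(snake_chord n i) in h1 h3.
have cE : crd d (snake_chord n i) = cr d.1 d.2 (snake_label m i) (snake_label m i.+1).
  by rewrite crdC crd_mkchordl // cr_swap.
rewrite !inE lift0 /= cE eq_sym.
have bs : bsign i = if odd i.+1 then -1 else 1 by rewrite /bsign -signr_odd; case: odd.
rewrite bs; case: eqP => [ed|nd'].
  by have [-> ->] := h1 (introT eqP ed); rewrite /=; case: (odd i); rewrite /=; ring.
move/eqP: nd' => nd'.
case: (boolP (cr _ _ _ _)) => [c|nc].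
  by have [-> ->] := h2 c; rewrite /=; case: (odd i); rewrite /=; ring.
by rewrite h3 // subrr mulr0.
Qed.

Lemma vset_diag d : diag d ->
  vset (aset d) = \sum_(i < n) (if snake_chord n i == d then -1 else (crd d (snake_chord n i))%:R) *: a i.
Proof. by move=> dd; apply: eq_bigr => i _; rewrite vset_coord. Qed.

Lemma vset_snake (i : 'I_n) : vset (aset (snake_chord n i)) = - a i.
Proof.
rewrite vset_diag ?snake_chord_diag // (bigD1 i) //= eqxx scaleN1r big1 ?addr0 // => j ji.
have -> : (snake_chord n j == snake_chord n i) = false.
  by apply/negbTE; apply: contraNneq ji => /(snake_chord_inj n_ge1)->.
by rewrite crd_snake // scale0r.
Qed.

Lemma vset_nonsnake d : diag d -> (forall i : 'I_n, snake_chord n i != d) ->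
  vset (aset d) = \sum_(i < n | crd d (snake_chord n i)) a i.
Proof.
move=> dd nd; rewrite vset_diag // [RHS]big_mkcond /=; apply: eq_bigr => i _.
by rewrite (negPf (nd i)); case: (crd _ _); rewrite ?scale1r ?scale0r.
Qed.

(* Uncrossing: S(d) and S(e) are replaced by their union and intersection,
   which belong to chords crossing fewer diagonals of T. *)
Lemma chord_induction T (Q : {set 'I_n.+1} -> Prop) : ctri T ->
  Q finset.set0 -> Q [set: 'I_n.+1]%SET -> (forall d, d \in T -> Q (aset d)) ->
  (forall d e, diag d -> d \notin T -> e \in T ->
     ~~ (aset d \subset aset e) -> ~~ (aset e \subset aset d) ->
     Q (aset d :|: aset e)%SET -> Q (aset d :&: aset e)%SET -> Q (aset d)) ->
  forall d, diag d -> Q (aset d).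
Proof.
move=> tT Q0 QT QTin Qex d dd.
have [k] : exists k, (#|[set t in T | crd d t]%SET| <= k)%N by eexists.
elim: k d dd => [|k IH] d dd hk.
  apply: QTin; apply: ctri_max => // e eT; apply/negP => c.
  move: hk; rewrite leqn0 cards_eq0 => /eqP/finset.setP/(_ e).
  by rewrite !inE eT c.
case: (boolP (d \in T)) => [/QTin//|ndT].
have [e eT c] : exists2 e, e \in T & crd d e.
  apply: contrapT => nex; move/negP: ndT; apply; apply: ctri_max => // e eT.
  by apply/negP => c; apply: nex; exists e.
have [u [w [u' [w' [la uw uw' [cr1 [cr2 cr3]] [e1 e2 s1 s2]]]]]] := aset_exchange n_ge1 c.
have /andP[/andP[/andP[lu lw] lu'] lw'] := la.
have step x y : (x < m)%N -> (y < m)%N -> x != y -> ~~ cr x y e.1 e.2 ->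
    (forall t : chord n, ~~ crd e t -> cr x y t.1 t.2 -> crd d t) -> Q (aset (mkchord n x y)).
  move=> lx ly xy nxe Hc; case: (boolP (nonadj m x y)) => [na|na]; last first.
    by case: (aset_edge n_ge1 lx ly xy na) => ->.
  apply: IH; first exact: diag_mkchord.
  rewrite -ltnS; apply: leq_trans hk; apply: proper_card; apply/properP; split.
    apply/fintype.subsetP => t; rewrite !inE => /andP[tT']; rewrite crd_mkchordl // tT' /=.
    by apply: Hc; apply: tT.2.2.
  by exists e; rewrite !inE eT ?c // crd_mkchordl.
apply: (Qex d e) => //.
  by rewrite -e1; apply: step => // t nt h; have [h1 _] := cr1 t nt; exact: h1.
by rewrite -e2; apply: step => // t nt h; have [_ h1] := cr1 t nt; exact: h1.
Qed.

(** By uncrossing, the vector of every diagonal lies in the span of those of [T]; the snake chords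
    contribute all [- a i], so these [n] vectors span a space of dimension [n]. *)
Lemma chords_span T : ctri T -> basis_of fullv [seq vset (aset d) | d <- enum T].
Proof.
move=> tT; set X := [seq _ | d <- _].
have inX d : d \in T -> vset (aset d) \in <<X>>%VS.
  by move=> dT; apply/memv_span/map_f; rewrite mem_enum.
have spanX d : diag d -> vset (aset d) \in <<X>>%VS.
  move: d; apply: (chord_induction (Q := fun S => vset S \in <<X>>%VS) tT) => //.
  - by rewrite vset0 mem0v.
  - by rewrite vsetT mem0v.
  move=> d e dd ndT eT _ _ hU hI.
  have -> : vset (aset d) = vset (aset d :|: aset e)%SET + vset (aset d :&: aset e)%SET - vset (aset e).
    by rewrite -vset_modular addrK.
  by rewrite rpredB ?rpredD // inX.
have dimV : \dim {:V} = n by rewrite (size_basis (X := in_tuple (codom a))) // size_codom card_ord.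
rewrite basisEdim dimV size_map -cardE tT.1 leqnn andbT.
rewrite -(span_basis a_basis); apply/span_subvP => _ /codomP[i ->].
by rewrite -[a i]opprK -vset_snake rpredN spanX // snake_chord_diag.
Qed.

Lemma prefix_point (g : 'I_n -> R) (F : R) : exists x : W,
  \sum_l x 0 l = F /\ forall i : 'I_n, \sum_(l < n.+1 | (l <= i)%N) x 0 l = g i.
Proof.
pose Phi k : R := if k == 0%N then 0 else if insub k.-1 is Some i then g i else F.
exists (\row_l (Phi l.+1 - Phi l)).
have pre k : (k <= n)%N -> \sum_(l < n.+1 | (l <= k)%N) (\row_l (Phi l.+1 - Phi l) : W) 0 l = Phi k.+1.
  move=> kn; under eq_bigr do rewrite mxE.
  rewrite -(big_ord_widen n.+1 (fun l => Phi l.+1 - Phi l) (n1 := k.+1)) //.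
  rewrite -(big_mkord xpredT (fun l => Phi l.+1 - Phi l)) telescope_sumr //.
  by rewrite /Phi /= subr0.
split.
  rewrite -[RHS]/(F); have := pre n (leqnn n).
  rewrite (eq_bigl xpredT) => [->|l]; last by rewrite -ltnS ltn_ord.
  by rewrite /Phi /= insubF // ltnn.
by move=> i; rewrite pre ?(ltnW (ltn_ord i)) // /Phi /= valK.
Qed.

(** The slack at [S] of the point with total [tri_num R n.+1] and prefix sums [bsign i * g (a i)].
    It is strictly submodular on incomparable sets and vanishes on the empty and the full set. *)
Definition gap (g : 'Hom(V, R^o)) S : R :=
  (ord_max \in S)%:R * tri_num R n.+1 - tri_num R #|S| - g (vset S).

Lemma set_sum_prefix (x : W) S :
  \sum_(i < n) ((hi i \in S)%:R - (lo i \in S)%:R) * \sum_(l < n.+1 | (l <= i)%N) x 0 l =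
  (ord_max \in S)%:R * (\sum_l x 0 l) - set_sum x S.
Proof.
pose s k : R := (inord k \in S)%:R; pose y k : R := x 0 (inord k).
have ordE (l : 'I_n.+1) : inord l = l by exact: inord_val.
have -> : \sum_l x 0 l = \sum_(l < n.+1) y l by apply: eq_bigr => l _; rewrite /y ordE.
have -> : set_sum x S = \sum_(l < n.+1) s l * y l.
  rewrite /set_sum big_mkcond; apply: eq_bigr => l _; rewrite /s /y ordE.
  by case: (l \in S); rewrite ?mul1r ?mul0r.
have -> : (ord_max \in S)%:R = s n :> R by rewrite /s; congr ((_ \in S)%:R); apply: val_inj; rewrite /= inordK.
rewrite -abel_sum; apply: eq_bigr => i _.
have li := ltn_ord i.
congr ((_ - _) * _).
- by rewrite /s; congr ((_ \in S)%:R); apply: val_inj; rewrite /= inordK.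
- by rewrite /s; congr ((_ \in S)%:R); apply: val_inj; rewrite /= inordK // ltnW.
rewrite (big_ord_widen n.+1 y (n1 := i.+1)) //; last exact: ltnW.
by apply: eq_bigr => l _; rewrite /y ordE.
Qed.

(** The form [g] is chosen on the basis given by [T] so that the slacks of [T] vanish. Uncrossing
    with members of [T] makes every slack nonnegative, and one more uncrossing makes it positive
    outside [T]. *)
Lemma triangulation_point T : ctri T -> exists x : W,
  [/\ \sum_l x 0 l = tri_num R n.+1,
      forall d, d \in T -> set_sum x (aset d) = tri_num R #|aset d| &
      forall d, diag d -> d \notin T -> tri_num R #|aset d| < set_sum x (aset d)].
Proof.
move=> tT; have bX := chords_span tT.
pose M S : R := (ord_max \in S)%:R * tri_num R n.+1 - tri_num R #|S|.
have [g Hg] : exists g : 'Hom(V, R^o), forall d, d \in T -> g (vset (aset d)) = M (aset d).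
  have [g Hg] := linear_of_free [seq vset (aset d) | d <- enum T] [seq (M (aset d) : R^o) | d <- enum T].
  exists (linfun g) => d dT; rewrite lfunE /=.
  have := Hg (basis_free bX); rewrite !size_map => /(_ erefl).
  by rewrite -map_comp => /eq_in_map; apply; rewrite mem_enum.
have [x [xF xg]] := prefix_point (fun i => bsign i * g (a i)) (tri_num R n.+1).
have xgap S : set_sum x S - tri_num R #|S| = gap g S.
  have := set_sum_prefix x S; rewrite xF /gap => e.
  have -> : g (vset S) = (ord_max \in S)%:R * tri_num R n.+1 - set_sum x S; last by ring.
  rewrite -e linear_sum; apply: eq_bigr => i _ /=.
  by rewrite linearZ /= xg /GRing.scale /=; ring.
have gT d : d \in T -> gap g (aset d) = 0.
  by move=> dT; rewrite /gap Hg // subrr.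
have gapM d e : ~~ (aset d \subset aset e) -> ~~ (aset e \subset aset d) ->
    gap g (aset d :|: aset e)%SET + gap g (aset d :&: aset e)%SET <
    gap g (aset d) + gap g (aset e).
  move=> s1 s2; have := tri_num_strict R s1 s2; rewrite /gap.
  have := congr1 g (vset_modular (aset d) (aset e)); rewrite !linearD /= => eg.
  have : (ord_max \in aset d)%:R + (ord_max \in aset e)%:R =
         (ord_max \in aset d :|: aset e)%SET%:R + (ord_max \in aset d :&: aset e)%SET%:R :> R.
    by rewrite finset.in_setU finset.in_setI; do !case: (_ \in _); rewrite /=; ring.
  move: (ord_max \in aset d)%:R (ord_max \in aset e)%:R.
  move: (ord_max \in aset d :|: aset e)%SET%:R (ord_max \in aset d :&: aset e)%SET%:R.
  move=> p q p' q' epq lt.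
  have eF : p' * tri_num R n.+1 + q' * tri_num R n.+1 = p * tri_num R n.+1 + q * tri_num R n.+1.
    by rewrite -!mulrDl epq.
  move: eg lt eF; clear; lra.
have gap0 : gap g finset.set0 = 0.
  by rewrite /gap inE cards0 vset0 linear0 /tri_num mul0n !mul0r !subr0.
have gap1 : gap g [set: 'I_n.+1]%SET = 0.
  by rewrite /gap inE cardsT card_ord vsetT linear0 mul1r subrr subr0.
have gap_ge0 d : diag d -> 0 <= gap g (aset d).
  move: d; apply: (chord_induction (Q := fun S => 0 <= gap g S) tT).
  - by rewrite gap0.
  - by rewrite gap1.
  - by move=> d dT; rewrite gT.
  move=> d e dd ndT eT s1 s2 hU hI; have := gapM _ _ s1 s2.
  by rewrite (gT e eT) addr0 => /ltW; apply: le_trans; exact: addr_ge0.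
exists x; split=> // [d dT|d dd ndT].
  by apply/eqP; rewrite -subr_eq0 xgap gT.
rewrite -subr_gt0 xgap.
have [e eT c] : exists2 e, e \in T & crd d e.
  apply: contrapT => nex; move/negP: ndT; apply; apply: ctri_max => // e eT.
  by apply/negP => c; apply: nex; exists e.
have [u [w [u' [w' [la uw uw' _ [e1 e2 s1 s2]]]]]] := aset_exchange n_ge1 c.
have /andP[/andP[/andP[lu lw] lu'] lw'] := la.
have step x' y : (x' < m)%N -> (y < m)%N -> x' != y -> 0 <= gap g (aset (mkchord n x' y)).
  move=> lx ly xy; case: (boolP (nonadj m x' y)) => [na|na]; last first.
    by case: (aset_edge n_ge1 lx ly xy na) => ->; rewrite ?gap0 ?gap1.
  by apply: gap_ge0; exact: diag_mkchord.
have := gapM _ _ s1 s2; rewrite (gT e eT) addr0; apply: le_lt_trans.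
by rewrite -e1 -e2; apply: addr_ge0; apply: step.
Qed.

End SnakeVectors.

(** * Representations of least cost *)

Section LinearOptimization.
Variable R : realType.

Lemma linear_form_continuous (k : nat) (c : 'I_k -> R) :
  continuous (fun x : 'rV[R]_k => \sum_l c l * x 0 l).
Proof.
rewrite /index_enum; elim: (Finite.enum _) => [|i r IH].
  have -> : (fun x : 'rV[R]_k => \sum_(l <- [::]) c l * x 0 l) = (fun=> 0).
    by apply/funext => x; rewrite big_nil.
  exact: cst_continuous.
have -> : (fun x : 'rV[R]_k => \sum_(l <- i :: r) c l * x 0 l) =
          (fun x : 'rV[R]_k => c i * x 0 i + \sum_(l <- r) c l * x 0 l).
  by apply/funext => x; rewrite big_cons.
move=> x; apply: (@continuousD _ _ _ (fun x : 'rV[R]_k => c i * x 0 i)); last exact: IH.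
apply: (@continuousM _ _ (fun=> c i) (fun x : 'rV[R]_k => x 0 i)).
  exact: cst_continuous.
exact: coord_continuous.
Qed.

Lemma box_minimum (k p : nat) (c B : 'I_k -> R) (A : 'I_p -> 'I_k -> R) (b : 'I_p -> R)
    (K := [set x : 'rV[R]_k | (forall i, 0 <= x 0 i <= B i) /\
                              forall j, \sum_l A j l * x 0 l = b j]) :
  K !=set0 -> exists2 x, K x & forall y, K y -> \sum_l c l * x 0 l <= \sum_l c l * y 0 l.
Proof.
move=> K0.
have boxc : compact [set v : 'rV[R]_k | forall i, `[0, B i]%classic (v 0 i)].
  by apply: (rV_compact (A := fun i => `[0, B i]%classic)) => i; exact: segment_compact.
have eqc : closed (\bigcap_(j in [set: 'I_p]) [set x : 'rV[R]_k | \sum_l A j l * x 0 l = b j]).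
  apply: closed_bigI => j _.
  apply: (@preimage_closed _ _ (fun x : 'rV[R]_k => \sum_l A j l * x 0 l) [set b j]).
    by move=> x _; exact: linear_form_continuous.
  exact: closed_eq.
have Kc : compact K.
  have -> : K = [set v : 'rV[R]_k | forall i, `[0, B i]%classic (v 0 i)] `&`
      (\bigcap_(j in [set: 'I_p]) [set x : 'rV[R]_k | \sum_l A j l * x 0 l = b j]).
    apply/seteqP; split=> x.
      by move=> [h1 h2]; split=> [i|j _]; [rewrite /= in_itv /= h1|exact: h2].
    by move=> [h1 h2]; split=> [i|j]; [have := h1 i; rewrite /= in_itv|exact: h2].
  exact: compact_closedI.
have cf : {within K, continuous (fun x : 'rV[R]_k => \sum_l c l * x 0 l)}.
  by apply: continuous_subspaceT; exact: linear_form_continuous.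
have [x xK xmin] := EVT_min_rV K0 Kc cf.
exists x; first by move: xK; rewrite inE.
by move=> y Ky; apply: xmin; rewrite inE.
Qed.

(** A representation not dearer than the given one has coefficients at most [C / c i], the costs
    being positive; so the minimum may be sought in a compact set. *)
Lemma nonneg_combination_min (I : finType) (V : vectType R) (v : I -> V) (c : I -> R) (u : V) :
  (forall i, 0 < c i) -> conic_hull xpredT v u -> exists t : I -> R,
  [/\ forall i, 0 <= t i, u = \sum_i t i *: v i &
      forall t' : I -> R, (forall i, 0 <= t' i) -> u = \sum_i t' i *: v i ->
      \sum_i t i * c i <= \sum_i t' i * c i].
Proof.
move=> c0 [t0 [t0_ge0 eu0]].
pose C := \sum_i t0 i * c i.
pose b := vbasis {:V}.
have b_coord w : w = \sum_j coord b j w *: b`_j by apply: coord_vbasis; exact: memvf.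
have reidx (F : I -> R) : \sum_(l < #|I|) F (enum_val l) = \sum_i F i.
  by rewrite -(big_enum_val F) /=; apply: eq_bigl.
have eqE (t : I -> R) : u = \sum_i t i *: v i <->
    forall j, \sum_(l < #|I|) coord b j (v (enum_val l)) * (\row_(l < #|I|) t (enum_val l)) 0 l = coord b j u.
  have E j : \sum_(l < #|I|) coord b j (v (enum_val l)) * (\row_(l < #|I|) t (enum_val l)) 0 l =
      coord b j (\sum_i t i *: v i).
    rewrite linear_sum /= -[RHS](reidx (fun i => coord b j (t i *: v i))).
    by apply: eq_bigr => l _; rewrite mxE linearZ /= mulrC.
  split=> [-> j|H]; first by rewrite E.
  by rewrite [LHS]b_coord [RHS]b_coord; apply: eq_bigr => j _; rewrite -H E.
have le_one t i : (forall i, 0 <= t i) -> \sum_i t i * c i <= C -> t i <= C / c i.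
  move=> t_ge0 h; rewrite ler_pdivlMr //; apply: le_trans h.
  by rewrite (bigD1 i) //= lerDl sumr_ge0 // => j _; rewrite mulr_ge0 // ltW.
pose K := [set x : 'rV[R]_#|I| | (forall l, 0 <= x 0 l <= C / c (enum_val l)) /\
   forall j, \sum_l coord b j (v (enum_val l)) * x 0 l = coord b j u].
have K0 : K !=set0.
  exists (\row_(l < #|I|) t0 (enum_val l)); split; last exact/eqE.
  by move=> l; rewrite mxE t0_ge0 /=; exact: le_one.
have [x [xB xE] xmin] := @box_minimum _ _ (fun l => c (enum_val l)) (fun l => C / c (enum_val l))
  (fun j l => coord b j (v (enum_val l))) (fun j => coord b j u) K0.
pose t i := x 0 (enum_rank i).
have xt : x = \row_(l < #|I|) t (enum_val l) by apply/rowP => l; rewrite mxE /t enum_valK.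
have costE (s : I -> R) : \sum_(l < #|I|) c (enum_val l) * (\row_(l < #|I|) s (enum_val l)) 0 l = \sum_i s i * c i.
  rewrite -[RHS](reidx (fun i => s i * c i)).
  by apply: eq_bigr => l _; rewrite mxE mulrC.
have tmin t' : (forall i, 0 <= t' i) -> u = \sum_i t' i *: v i -> \sum_i t' i * c i <= C ->
    \sum_i t i * c i <= \sum_i t' i * c i.
  move=> t'0 eu h; have := xmin (\row_(l < #|I|) t' (enum_val l)).
  rewrite {1}xt !costE; apply; split; last exact/eqE.
  by move=> l; rewrite mxE t'0 /=; exact: le_one.
exists t; split.
- by move=> i; have /andP[] := xB (enum_rank i).
- by apply/eqE; rewrite -xt.
move=> t' t'0 eu; case: (leP (\sum_i t' i * c i) C) => h; first exact: tmin.
by apply: le_trans (ltW h); apply: tmin.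
Qed.

End LinearOptimization.

Section ConicHull.
Variables (R : realType) (V : lmodType R) (I : finType) (D : pred I) (v : I -> V).

Lemma conic_hullD x y : conic_hull D v x -> conic_hull D v y -> conic_hull D v (x + y).
Proof.
move=> [t [t0 ->]] [u [u0 ->]]; exists (fun i => t i + u i); split.
  by move=> i; exact: addr_ge0.
by rewrite -big_split; apply: eq_bigr => i _; rewrite scalerDl.
Qed.

Lemma conic_hullZ (k : R) x : 0 <= k -> conic_hull D v x -> conic_hull D v (k *: x).
Proof.
move=> k0 [t [t0 ->]]; exists (fun i => k * t i); split.
  by move=> i; exact: mulr_ge0.
by rewrite scaler_sumr; apply: eq_bigr => i _; rewrite scalerA.
Qed.

Lemma conic_hull0 : conic_hull D v 0.
Proof. by exists (fun=> 0); split=> //; rewrite big1 // => i _; rewrite scale0r. Qed.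

Lemma conic_hull_sum (J : finType) (x : J -> V) :
  (forall j, conic_hull D v (x j)) -> conic_hull D v (\sum_j x j).
Proof.
move=> H; elim/big_ind: _ => [|y z|j _]; [exact: conic_hull0|exact: conic_hullD|exact: H].
Qed.

End ConicHull.

(** * Completeness of the snake fan *)

Section Completeness.
Variables (R : realType) (n : nat) (V : vectType R) (a : 'I_n -> V).
Hypothesis a_basis : basis_of fullv (codom a).
Hypothesis n_ge1 : (0 < n)%N.
Implicit Types (d e : chord n) (S A B : {set 'I_n.+1}) (T : {set chord n}).
Local Notation m := n.+3.

(* Strictly submodular, so that a representation of minimal cost has a
   non-crossing support. *)
Definition scost S : R := n.+2%:R * #|S|%:R - 2 * tri_num R #|S|.

Let scostE S : scost S = (#|S| * (n.+1 - #|S|))%:R.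
Proof.
have le : (#|S| <= n.+1)%N by rewrite -[X in (_ <= X)%N](card_ord n.+1) max_card.
rewrite /scost /tri_num mulrCA mulfV ?pnatr_eq0 // mulr1 -natrM.
rewrite (_ : n.+2 * #|S| = #|S| * (n.+1 - #|S|) + #|S| * #|S|.+1)%N ?natrD ?addrK //.
by rewrite -mulnDr mulnC addnS subnK.
Qed.

Lemma scost_gt0 S : S != finset.set0 -> S != [set: 'I_n.+1]%SET -> 0 < scost S.
Proof.
move=> S0 S1; rewrite scostE ltr0n muln_gt0 card_gt0 S0 subn_gt0.
by rewrite -[X in (_ < X)%N](card_ord n.+1) -cardsT proper_card // properT.
Qed.

Lemma scost0 : scost finset.set0 = 0.
Proof. by rewrite scostE cards0 mul0n. Qed.

Lemma scostT : scost [set: 'I_n.+1]%SET = 0.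
Proof. by rewrite scostE cardsT card_ord subnn muln0. Qed.

Lemma scost_strict A B : ~~ (A \subset B) -> ~~ (B \subset A) ->
  scost (A :|: B)%SET + scost (A :&: B)%SET < scost A + scost B.
Proof.
move=> s1 s2; have := tri_num_strict R s1 s2; rewrite /scost.
have := congr1 (fun k => k%:R : R) (cardsUI A B); rewrite !natrD => e.
have -> : #|A :|: B|%SET%:R = #|A|%:R + #|B|%:R - #|A :&: B|%SET%:R :> R by rewrite -e addrK.
by move: (tri_num R _) (tri_num R _) (tri_num R _) (tri_num R _) => *; lra.
Qed.

Local Notation vs d := (vset a (aset d)).

(** Pairs that are no diagonals get the vector 0, and below the cost 1, so that sums may range over
    all pairs with positive costs. *)
Let w d : V := if diag d then vs d else 0.

(** Snake chords give [- a i], and the flip of a snake chord, which crosses it alone, gives [a i];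
    both signs together generate the space as a cone. *)
Let cone_all u : conic_hull xpredT w u.
Proof.
have aN i : conic_hull xpredT w (- a i).
  rewrite -(vset_snake a n_ge1) (_ : vset a _ = w (snake_chord n i)).
    exact: conic_hull_point.
  by rewrite /w snake_chord_diag.
have aP i : conic_hull xpredT w (a i).
  have tS := ctri_snake_set n_ge1.
  have iS : snake_chord n i \in [set snake_chord n i | i : 'I_n]%SET by apply: imset_f.
  have [e [de He]] := flip_chord tS iS.
  rewrite (_ : a i = w e); first exact: conic_hull_point.
  rewrite /w de (vset_nonsnake a n_ge1 de).
    rewrite (bigD1 i) /=; last by rewrite He // inE.
    rewrite big1 ?addr0 // => j /andP[c ji]; exfalso; move: c.
    rewrite He ?imset_f // inE => /eqP/(snake_chord_inj n_ge1) ej.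
    by rewrite ej eqxx in ji.
  move=> j; apply/eqP => ej; have := He _ iS; rewrite inE eqxx -ej.
  by rewrite crd_snake.
have -> : u = \sum_i coord (in_tuple (codom a)) (cast_ord (esym (etrans (size_codom a) (card_ord n))) i) u *: a i.
  have bt : basis_of fullv (in_tuple (codom a)) by [].
  rewrite [LHS](coord_basis bt (memvf u)) /=.
  have sz := etrans (size_codom a) (card_ord n).
  rewrite (reindex (cast_ord (esym sz))) /=; last first.
    by exists (cast_ord sz) => j _; rewrite ?cast_ordK ?cast_ordKV.
  apply: eq_bigr => i _; congr (coord _ _ _ *: _); first exact: val_inj.
  rewrite (nth_map i) /= ?size_enum_ord //.
  by rewrite nth_ord_enum.
apply: conic_hull_sum => i; set k := coord _ _ _.
case: (leP 0 k) => k0; first exact: conic_hullZ.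
by rewrite -[k]opprK scaleNr -scalerN; apply: conic_hullZ => //; rewrite oppr_ge0 ltW.
Qed.

Let sum_pick_mul (I : finType) (F : I -> R) i : \sum_x (x == i)%:R * F x = F i.
Proof.
by rewrite (bigD1 i) //= eqxx mul1r big1 ?addr0 // => j /negPf->; rewrite mul0r.
Qed.

Lemma chord_cones_complete u : exists2 T, ctri T & conic_hull (mem T) (fun d => vs d) u.
Proof.
pose c d : R := if diag d then scost (aset d) else 1.
have c0 d : 0 < c d.
  rewrite /c; case: ifP => // dd; have [h1 h2] := aset_proper n_ge1 dd.
  exact: scost_gt0.
have [t [t0 eu tmin]] := nonneg_combination_min c0 (cone_all u).
pose D := [set d | diag d && (t d != 0)]%SET.
have ncD : noncrossing D.
  split=> [d|d e]; first by rewrite inE => /andP[].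
  rewrite !inE => /andP[dd td] /andP[de te]; apply/negP => crde.
  have [x [y [x' [y' [la xy xy' _ [e1 e2 s1 s2]]]]]] := aset_exchange n_ge1 crde.
  have /andP[/andP[/andP[lx ly] lx'] ly'] := la.
  (* The sides [g] and [h] may be edges, whose set is empty or full. The weights [b1] and [b2] then
     drop them, at no change of vector or cost. *)
  pose g := mkchord n x y; pose h := mkchord n x' y'.
  pose b1 : R := (nonadj m x y)%:R; pose b2 : R := (nonadj m x' y')%:R.
  have P (z z' : nat) : (z < m)%N -> (z' < m)%N -> z != z' ->
     (nonadj m z z')%:R *: w (mkchord n z z') = vs (mkchord n z z') /\
     (nonadj m z z')%:R * c (mkchord n z z') = scost (aset (mkchord n z z')).
    move=> lz lz' zz; case: (boolP (nonadj m z z')) => na.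
      by rewrite scale1r mul1r /w /c diag_mkchord.
    rewrite scale0r mul0r.
    by case: (aset_edge n_ge1 lz lz' zz na) => ->; rewrite ?vset0 ?vsetT ?scost0 ?scostT.
  have [g1 g2] := P _ _ lx ly xy; have [h1 h2] := P _ _ lx' ly' xy'.
  rewrite -/g -/b1 in g1 g2; rewrite -/h -/b2 in h1 h2.
  pose eps := Num.min (t d) (t e).
  have td0 : 0 < t d by rewrite lt_def td t0.
  have te0 : 0 < t e by rewrite lt_def te t0.
  have eps0 : 0 < eps by rewrite lt_min td0 te0.
  have nde : d != e by apply: contraTneq crde => ->; rewrite crd_same.
  (* The amount [eps] is moved from the crossing chords [d] and [e] to the sides [g] and [h]: the
     vector is kept and the cost decreases strictly. *)
  pose t' z := t z - eps * (z == d)%:R - eps * (z == e)%:R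
               + eps * b1 * (z == g)%:R + eps * b2 * (z == h)%:R.
  have t'0 z : 0 <= t' z.
    rewrite /t'; have B1 : 0 <= eps * b1 * (z == g)%:R by rewrite !mulr_ge0 // ltW.
    have B2 : 0 <= eps * b2 * (z == h)%:R by rewrite !mulr_ge0 // ltW.
    have : 0 <= t z - eps * (z == d)%:R - eps * (z == e)%:R.
      have [->|zd] := eqVneq z d.
        by rewrite (negPf nde) mulr0 subr0 mulr1 subr_ge0 ge_min lexx.
      have [->|ze] := eqVneq z e.
        by rewrite mulr0 subr0 mulr1 subr_ge0 ge_min lexx orbT.
      by rewrite !mulr0 !subr0.
    by move: B1 B2; move: (eps * b1 * _) (eps * b2 * _) (t z - _ - _) => *; lra.
  have wd : w d = vs d by rewrite /w dd.
  have we : w e = vs e by rewrite /w de.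
  have eu' : u = \sum_z t' z *: w z.
    have -> : \sum_z t' z *: w z = \sum_z t z *: w z - eps *: w d - eps *: w e
        + (eps * b1) *: w g + (eps * b2) *: w h.
      rewrite /t'; under eq_bigr do rewrite !scalerDl !scaleNr -!scalerA.
      rewrite !big_split /= !sumrN -!scaler_sumr.
      have K z0 : \sum_z (z == z0)%:R *: w z = w z0 by rewrite (sum_pick (D := xpredT)).
      by rewrite !K !scalerA.
    rewrite -eu -!scalerA g1 h1 wd we -addrA -[X in _ + X]scalerDr.
    rewrite /g /h e1 e2 -(vset_modular a) scalerDr.
    by rewrite -[u - _ - _]addrA -opprD addrNK.
  have := tmin t' t'0 eu'.
  have -> : \sum_z t' z * c z = \sum_z t z * c z - eps * c d - eps * c e
        + eps * (b1 * c g) + eps * (b2 * c h).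
    rewrite /t'; under eq_bigr do rewrite !mulrDl !mulNr -!mulrA.
    by rewrite !big_split /= !sumrN -!mulr_sumr !sum_pick_mul.
  have -> : c d = scost (aset d) by rewrite /c dd.
  have -> : c e = scost (aset e) by rewrite /c de.
  rewrite g2 h2 /g /h e1 e2; have := scost_strict s1 s2; move: eps0; clear.
  move: (scost _) (scost _) (scost _) (scost _) => p q r s; move: (\sum_z _) => C.
  by move=> eps0 lt le; nra.
have [T DT tT] := noncrossing_extend ncD.
exists T => //; exists (fun d => if d \in D then t d else 0); split.
  by move=> d; case: ifP.
rewrite eu (bigID [in D]) /= [X in _ + X]big1 ?addr0; last first.
  move=> d; rewrite inE negb_and negbK => /orP[dd|/eqP->]; last by rewrite scale0r.
  by rewrite /w (negPf dd) scaler0.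
rewrite [RHS](bigID [in D]) /= [X in _ + X]big1 ?addr0; last first.
  by move=> d /andP[_ /negPf->]; rewrite scale0r.
apply: eq_big => [d|d dD].
  by apply/idP/andP => [dD|[]//]; split=> //; exact: (fintype.subsetP DT _ dD).
by rewrite dD; move: dD; rewrite inE /w => /andP[->].
Qed.

End Completeness.

Lemma rVB_E (R : realType) (k : nat) (x y : 'rV[R]_k) l : (x - y) 0 l = x 0 l - y 0 l.
Proof. by rewrite !mxE. Qed.

(** * Simple roots and prefix sums *)

Section SumZero.
Variables (R : realType) (n : nat).
Local Notation W := 'rV[R]_n.+1.
Local Notation lo i := (widen_ord (leqnSn n) i).
Local Notation hi i := (lift ord0 i).

Let sum_form : W -> R^o := lform (fun=> 1).

Let sum_formE x : sum_form x = \sum_l x 0 l.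
Proof. by apply: eq_bigr => l _; rewrite mul1r. Qed.

Lemma mem_sum_zero (x : W) : (x \in sum_zero R n) = (\sum_l x 0 l == 0).
Proof.
rewrite /sum_zero memv_ker.
have -> : (fun x : W => \sum_i x 0 i : R^o) = lform (fun=> 1).
  by apply/funext => y; rewrite -[RHS]/(sum_form y) sum_formE.
by rewrite lfunE /= -[lform _ x]/(sum_form x) sum_formE.
Qed.

Lemma dim_sum_zero : \dim (sum_zero R n) = n.
Proof.
have := limg_ker_dim (linfun (lform (fun _ : 'I_n.+1 => 1 : R))) fullv.
rewrite capfv.
have -> : lker (linfun (lform (fun _ : 'I_n.+1 => 1 : R))) = sum_zero R n.
  apply/vspaceP => x; rewrite mem_sum_zero memv_ker lfunE /=.
  by rewrite -[lform _ x]/(sum_form x) sum_formE.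
rewrite [\dim (fullv : {vspace W})]dimvf /dim /= mul1n.
set U := limg _ => e.
have : (0 < \dim U <= 1)%N.
  apply/andP; split; last by have := dimvS (subvf U); rewrite [X in (_ <= X)%N]dimvf.
  rewrite lt0n dimv_eq0; apply/eqP => U0.
  have : linfun (lform (fun _ : 'I_n.+1 => 1 : R)) (delta_mx 0 0) \in U.
    by apply: memv_img; exact: memvf.
  rewrite U0 memv0 lfunE /= -[lform _ _]/(sum_form _) sum_formE.
  rewrite (bigD1 0) //= big1 ?addr0; last by move=> l /negPf l0; rewrite mxE l0 andbF.
  by rewrite mxE !eqxx oner_eq0.
move=> /andP[u1 u2]; have u : \dim U = 1%N by apply/eqP; rewrite eqn_leq u2 u1.
by move: e; rewrite u addn1 => -[].
Qed.

Definition simple_root (i : 'I_n) : W := delta_mx 0 (lo i) - delta_mx 0 (hi i).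

Lemma sum_delta (k : 'I_n.+1) (P : pred 'I_n.+1) :
  \sum_(j | P j) (delta_mx 0 k : W) 0 j = (P k)%:R.
Proof.
case: (boolP (P k)) => Pk.
  rewrite (bigD1 k) //= big1 ?addr0; first by rewrite mxE !eqxx.
  by move=> j /andP[_ /negPf jk]; rewrite mxE jk andbF.
rewrite big1 // => j Pj; rewrite mxE; case: (eqVneq j k) => [ej|]; last by rewrite andbF.
by rewrite -ej Pj in Pk.
Qed.

Lemma sum_simple_root (i : 'I_n) (P : pred 'I_n.+1) :
  \sum_(j | P j) (simple_root i) 0 j = (P (lo i))%:R - (P (hi i))%:R.
Proof.
rewrite /simple_root; under eq_bigr do rewrite rVB_E.
by rewrite big_split sumrN /= !sum_delta.
Qed.

Lemma simple_root_sum_zero i : simple_root i \in sum_zero R n.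
Proof. by rewrite mem_sum_zero (sum_simple_root i xpredT) /= subrr eqxx. Qed.

Lemma val_root_A i : vsval (root_A R i) = simple_root i.
Proof. by rewrite /root_A vsprojK // simple_root_sum_zero. Qed.

Lemma simple_root_prefix (i j : 'I_n) :
  \sum_(l < n.+1 | (l <= i)%N) (simple_root j) 0 l = (j == i)%:R.
Proof.
rewrite (sum_simple_root j (fun l : 'I_n.+1 => (l <= i)%N)) lift0 /=.
rewrite -(inj_eq val_inj) /=; case: (ltngtP j i) => h; rewrite /= ?subr0 ?subrr //.
Qed.

Lemma root_A_basis : basis_of fullv (codom (@root_A R n)).
Proof.
have sz : size (codom (@root_A R n)) = n by rewrite size_codom card_ord.
rewrite basisEfree subvf sz dimvf /= /dim /= dim_sum_zero leqnn andbT.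
suff: free (in_tuple (codom (@root_A R n))) by [].
apply/freeP => k k0 i.
have szi : (i < n)%N by rewrite -[X in (_ < X)%N]sz.
pose i' := Ordinal szi.
have E : \sum_j k (cast_ord (esym sz) j) *: root_A R j = 0.
  rewrite -[RHS]k0 [RHS](reindex (cast_ord (esym sz))) /=; last first.
    by exists (cast_ord sz) => j _; rewrite ?cast_ordK ?cast_ordKV.
  apply: eq_bigr => j _; congr (_ *: _).
  by rewrite (nth_map j) /= ?size_enum_ord // nth_ord_enum.
have := congr1 (fun z : subvs_of (sum_zero R n) => \sum_(l < n.+1 | (l <= i')%N) (vsval z : W) 0 l) E.
rewrite /= linear_sum /=.
under eq_bigr => l _.
  rewrite summxE; under eq_bigr do rewrite val_root_A mxE; over.
rewrite exchange_big /=.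
under eq_bigr => j _ do rewrite -mulr_sumr (simple_root_prefix i' j).
rewrite (bigD1 i') //= eqxx mulr1 [X in _ + X]big1 ?addr0; last first.
  by move=> j /negPf->; rewrite mulr0.
rewrite big1; last by move=> l _; rewrite mxE.
by move=> <-; congr (k _); apply: val_inj.
Qed.

Lemma sum_zero_expand (z : W) : z \in sum_zero R n ->
  z = \sum_(i < n) (\sum_(l < n.+1 | (l <= i)%N) z 0 l) *: simple_root i.
Proof.
move=> z0; have sz : size (codom (@root_A R n)) = n by rewrite size_codom card_ord.
have bt : basis_of fullv (in_tuple (codom (@root_A R n))) by exact: root_A_basis.
have [c ec] : exists c : 'I_n -> R, z = \sum_i c i *: simple_root i.
  exists (fun i => coord (in_tuple (codom (@root_A R n))) (cast_ord (esym sz) i) (vsproj _ z)).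
  rewrite -[LHS](vsprojK z0) [X in vsval X = _](coord_basis bt (memvf _)) linear_sum /=.
  rewrite (reindex (cast_ord (esym sz))) /=; last first.
    by exists (cast_ord sz) => j _; rewrite ?cast_ordK ?cast_ordKV.
  apply: eq_bigr => i _; rewrite -val_root_A; congr (_ *: vsval _).
  by rewrite (nth_map i) /= ?size_enum_ord // nth_ord_enum.
rewrite {1}ec; apply: eq_bigr => i _; congr (_ *: _).
rewrite ec; under eq_bigr => l _.
  rewrite summxE; under eq_bigr do rewrite mxE; over.
rewrite exchange_big /=.
under eq_bigr => j _ do rewrite -mulr_sumr simple_root_prefix.
rewrite (bigD1 i) //= eqxx mulr1 big1 ?addr0 // => j /negPf->; exact: mulr0.
Qed.

End SumZero.

(** * Polytopes with the snake fan *)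

Section SnakeFan.
Variables (R : realType) (n : nat).
Hypothesis n_ge1 : (0 < n)%N.
Variable q : 'I_n.+3 -> 'rV[R]_2.
Hypotheses (q_convex : convex_polygon q) (q_cyclic : cyclically_labelled q).
Local Notation W := 'rV[R]_n.+1.

Lemma snakeE (i : 'I_n) : snake i = snake_chord n i.
Proof.
have li := ltn_ord i.
have vE k : snake_vertex n k = inord (snake_label n.+3 k).
  by rewrite /snake_vertex /snake_label addn3.
have l1 := snake_label_lt n_ge1 (ltnW li); have l2 := snake_label_lt n_ge1 li.
rewrite /snake !vE /snake_chord /mkchord !inordK //.
by case: (ltngtP (snake_label n.+3 i) (snake_label n.+3 i.+1)) => // ->.
Qed.

Section Vector.
Variables (V : vectType R) (a : 'I_n -> V).

Lemma santos_vectorE (t : 'I_n -> chord n) d : (forall i, diag (t i)) -> diag d ->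
  santos_vector q t a d =
  if [pick i | t i == d] is Some i then - a i else \sum_(i < n | crd d (t i)) a i.
Proof.
move=> td dd; rewrite /santos_vector; case: pickP => // nt.
apply: eq_bigl => i; apply/asboolP/idP.
  by move/crossesE; apply=> //; rewrite eq_sym nt.
by move=> c; apply/crossesE => //; rewrite eq_sym nt.
Qed.

Lemma santos_vector_snake d : diag d ->
  santos_vector q (@snake n) a d = vset a (aset d).
Proof.
move=> dd; rewrite santos_vectorE //; last by move=> i; rewrite snakeE; exact: snake_chord_diag.
case: pickP => [i|nt].
  by rewrite snakeE => /eqP<-; rewrite vset_snake.
rewrite vset_nonsnake //; last by move=> i; rewrite -snakeE nt.
by apply: eq_bigl => i; rewrite snakeE.
Qed.

Lemma eq_conic_hull (v w : chord n -> V) (D : {set chord n}) :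
  (forall d, d \in D -> v d = w d) -> conic_hull (mem D) v = conic_hull (mem D) w.
Proof.
move=> vw; apply/seteqP; split=> x [t [t0 ->]]; exists t; split=> //;
  by apply: eq_bigr => d dD; rewrite vw.
Qed.

Lemma santos_fan_snake : santos_fan q (@snake n) a =
  [set C | exists T D : {set chord n},
    [/\ ctri T, D \subset T & C = conic_hull (mem D) (fun d => vset a (aset d))]].
Proof.
have E (T D : {set chord n}) : ctri T -> D \subset T -> conic_hull (mem D) (santos_vector q (@snake n) a) =
     conic_hull (mem D) (fun d => vset a (aset d)).
  move=> tT DT; apply: eq_conic_hull => d dD; apply: santos_vector_snake.
  by apply: tT.2.1; exact: (fintype.subsetP DT _ dD).
apply/seteqP; split=> C [T [D [tT DT ->]]].
  have tT' : ctri T by apply/triangulationE.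
  by exists T, D; rewrite (E T).
by exists T, D; rewrite (E T) //; split => //; apply/triangulationE.
Qed.

End Vector.

Lemma triangulation_points : exists x : {set chord n} -> W, forall T, ctri T ->
  [/\ \sum_l x T 0 l = tri_num R n.+1,
      forall d, d \in T -> set_sum (x T) (aset d) = tri_num R #|aset d| &
      forall d, diag d -> d \notin T -> tri_num R #|aset d| < set_sum (x T) (aset d)].
Proof.
have /boolp.choice[x Hx] : forall T, exists x : W, ctri T ->
  [/\ \sum_l x 0 l = tri_num R n.+1,
      forall d, d \in T -> set_sum x (aset d) = tri_num R #|aset d| &
      forall d, diag d -> d \notin T -> tri_num R #|aset d| < set_sum x (aset d)].
  move=> T; case: (pselect (ctri T)) => [tT|nT]; last by exists 0.
  by have [x Hx] := triangulation_point (@root_A_basis R n) n_ge1 tT; exists x.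
by exists x.
Qed.

(** Serves both the alternating Hohlweg-Lange polytope, given by inequalities, and the convex hull
    of the points [x T]: it suffices to contain these points and to satisfy the inequalities. [L] is
    chosen so that the vector of [S] becomes the outer normal [- set_sum y S], up to a constant on
    the hyperplane of the given total. *)
Lemma snake_fan_sandwich (V : vectType R) (a : 'I_n -> V) (x : {set chord n} -> W) (P : set W) :
  basis_of fullv (codom a) ->
  (forall T, ctri T ->
    [/\ \sum_l x T 0 l = tri_num R n.+1,
      forall d, d \in T -> set_sum (x T) (aset d) = tri_num R #|aset d| &
      forall d, diag d -> d \notin T -> tri_num R #|aset d| < set_sum (x T) (aset d)]) ->
  (forall T, ctri T -> P (x T)) ->
  (forall y, P y -> \sum_l y 0 l = tri_num R n.+1 /\
     forall d, diag d -> tri_num R #|aset d| <= set_sum y (aset d)) ->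
  has_normal_fan P (santos_fan q (@snake n) a).
Proof.
move=> ba xH xP PH; rewrite santos_fan_snake.
have [L HL] := basis_extension
  (fun i : 'I_n => linfun (lform (fun l : 'I_n.+1 => bsign R i * (l <= i)%N%:R)))
  (basis_free ba).
have pair S y : (L (vset a S) : 'Hom(W, R^o)) y =
    (ord_max \in S)%:R * (\sum_l y 0 l) - set_sum y S :> R.
  rewrite -set_sum_prefix /vset linear_sum sum_lfunE; apply: eq_bigr => i _.
  rewrite linearZ /= scale_lfunE HL lfunE /= /lform.
  have -> : \sum_(l < n.+1) bsign R i * (l <= i)%N%:R * y 0 l = bsign R i * \sum_(l < n.+1 | (l <= i)%N) y 0 l.
    rewrite [in RHS]big_mkcond mulr_sumr; apply: eq_bigr => l _.
    by case: ifP => _; rewrite ?mulr1 ?mulr0 ?mul0r.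
  by rewrite /GRing.scale /= mulrACA bsign_sqr mul1r.
apply: (@normal_fan_of_vertices R W V P _ (@ctri n) (fun d => vset a (aset d)) L
  (fun d => (ord_max \in aset d)%:R * tri_num R n.+1 - tri_num R #|aset d|)).
- move=> T d y tT dT /PH[ys yd]; rewrite pair ys lerD2l lerN2; apply: yd.
  exact: tT.2.1.
- move=> T tT; have [xs xT xn] := xH T tT; exists (x T); split.
  + exact: xP.
  + by move=> d dT; rewrite pair xs xT.
  move=> T' d tT' dT'; rewrite pair xs => /addrI/oppr_inj e.
  apply/negPn/negP => ndT; have := xn d (tT'.2.1 _ dT') ndT.
  by rewrite e ltxx.
- move=> u; exact: chord_cones_complete.
- exact: ctri_flip.
have -> : \dim {:V} = \dim (sum_zero R n).
  by rewrite dim_sum_zero (size_basis (X := in_tuple (codom a))) // size_codom card_ord.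
apply/dimvS/direction_min => y z /PH[ys _] /PH[zs _].
rewrite mem_sum_zero; under eq_bigr do rewrite rVB_E.
by rewrite big_split sumrN /= ys zs subrr.
Qed.

(** The chords of the Hohlweg-Lange polygon and the cyclic chords have the same sets S apart from
    the empty and the full one, and in both polygons the diagonals are the chords whose set is
    neither of these. *)
Lemma alternating_Ass_I_fan (V : vectType R) (a : 'I_n -> V) (p : 'I_n.+3 -> 'rV[R]_2) :
  basis_of fullv (codom a) -> HL_polygon (alt_signs n) p ->
  has_normal_fan (Ass_I p) (santos_fan q (@snake n) a).
Proof.
move=> ba pHL; have [x xH] := triangulation_points.
have tri_numT (y : W) : set_sum y [set: 'I_n.+1]%SET = \sum_l y 0 l.
  by rewrite /set_sum; apply: eq_bigl => l; rewrite inE.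
apply: (snake_fan_sandwich ba xH) => [T tT|y /(Ass_IE n_ge1 pHL)[yd ys]].
  have [xs xT xn] := xH T tT; apply/(Ass_IE n_ge1 pHL); split=> // d ld d0 d1.
  have [/eqP|[e le ee]] := hl_set_aset n_ge1 ld; first by rewrite (negPf d0).
  rewrite ee in d0 d1 *.
  have de : diag e.
    rewrite /diag le; apply/negPn/negP => nd.
    have := aset_edge n_ge1 (ltn_ord e.1) (ltn_ord e.2) _ nd.
    rewrite mkchord_id ?(ltnW le) // neq_ltn le /= => /(_ isT)[e0|e1].
      by rewrite e0 eqxx in d0.
    by rewrite e1 eqxx in d1.
  by case: (boolP (e \in T)) => eT; [rewrite xT|exact: ltW (xn _ _ _)].
split=> // d dd; have /andP[ld _] := dd.
have [h0 h1] := aset_proper n_ge1 dd.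
have [[e le ee]|[/eqP|/eqP]] := aset_hl_set n_ge1 ld; rewrite ?(negPf h0) ?(negPf h1) //.
by rewrite ee in h0 h1 *; exact: yd.
Qed.

Lemma CFZ_exists : exists (W : vectType R) (Q : set W), is_CFZ q Q.
Proof.
have [x xH] := triangulation_points.
pose D : pred {set chord n} := fun T => `[< ctri T >].
exists 'rV[R]_n.+1, (conv_hull D x); split.
  exists #|[set T | D T]%SET|, (fun i => x (enum_val i)).
  have E (F : {set chord n} -> 'rV[R]_n.+1) :
      \sum_(i < #|[set T | D T]%SET|) F (enum_val i) = \sum_(T | D T) F T.
    by rewrite -(big_enum_val F) /=; apply: eq_bigl => T; rewrite inE.
  have E' (F : {set chord n} -> R) :
      \sum_(i < #|[set T | D T]%SET|) F (enum_val i) = \sum_(T | D T) F T.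
    by rewrite -(big_enum_val F) /=; apply: eq_bigl => T; rewrite inE.
  apply/seteqP; split=> y [t [t0 t1 ->]].
    by exists (fun i => t (enum_val i)); rewrite E' (E (fun T => t T *: x T)).
  have [T0 DT0] : exists T0, T0 \in [set T | D T]%SET.
    have [i _] : exists i : 'I_#|[set T | D T]%SET|, true.
      case: #|[set T | D T]%SET| t t0 t1 => [t _|k t _ _]; last by exists ord0.
      by rewrite big_ord0 => /esym/eqP; rewrite oner_eq0.
    by exists (enum_val i); exact: enum_valP.
  exists (fun T => if T \in [set T | D T]%SET then t (enum_rank_in DT0 T) else 0).
  have V i : (if enum_val i \in [set T | D T]%SET then t (enum_rank_in DT0 (enum_val i)) else 0) = t i.
    by rewrite enum_valP enum_valK_in.
  split.
  - by move=> T; case: ifP.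
  - by rewrite -E' -[RHS]t1; apply: eq_bigr => i _; rewrite V.
  - rewrite -(E (fun T => (if T \in [set T | D T]%SET then t (enum_rank_in DT0 T) else 0) *: x T)).
    by apply: eq_bigr => i _; rewrite V.
apply: (snake_fan_sandwich (@root_A_basis R n) xH) => [T tT|y [t [t0 t1 ->]]].
  by apply: conv_hull_point; apply/asboolP.
have sumE (P : pred 'I_n.+1) : \sum_(l | P l) (\sum_(T | D T) t T *: x T) 0 l =
    \sum_(T | D T) t T * \sum_(l | P l) x T 0 l.
  under eq_bigr => l _.
    rewrite summxE; under eq_bigr do rewrite mxE; over.
  by rewrite exchange_big /=; apply: eq_bigr => T _; rewrite mulr_sumr.
split.
  rewrite sumE -[RHS]mul1r -t1 mulr_suml; apply: eq_bigr => T /asboolP tT.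
  by have [-> _ _] := xH T tT.
move=> d dd; rewrite /set_sum sumE -[leLHS]mul1r -t1 mulr_suml.
apply: ler_sum => T /asboolP tT; have [_ xT xn] := xH T tT.
apply: ler_wpM2l => //; rewrite -/(set_sum _ _).
by case: (boolP (d \in T)) => dT; [rewrite xT|exact: ltW (xn _ _ _)].
Qed.

End SnakeFan.

(** * Rays of the Hohlweg-Lange fans *)

(** Membership of 1 makes [i] an upper and [k] a lower vertex; comparison at [n.+1] makes [j] lower
    and [l] upper. If [x] were missing from the first set although a later [y] is not, both would
    lie between [i] and [j] with [x] upper, so that [x] is in the second set only through [l <= x];
    then [y] is in it as well, a contradiction. *)
Lemma hl_mem_complement_prefix (U : nat -> bool) (n i j k l : nat) :
  U 0%N -> U n.+2 -> ~~ U 1%N -> ~~ U n.+1 -> (i < j)%N -> (k < l)%N ->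
  (j <= n.+2)%N -> (l <= n.+2)%N ->
  (forall x, (0 < x <= n.+1)%N -> hl_mem U k l x = ~~ hl_mem U i j x) ->
  (exists2 x, (0 < x <= n.+1)%N & hl_mem U k l x) ->
  hl_mem U i j 1 -> forall x y, (0 < x)%N -> (x <= y)%N -> (y <= n.+1)%N ->
  hl_mem U i j y -> hl_mem U i j x.
Proof.
move=> U0 Un2 U1 Un1 ij kl jn ln H [w w0 hw] h1 x y x0 xy yn hy.
have Ui : U i.
  move: h1; rewrite /hl_mem; case: (leqP 1 i) => // i0; have -> : i = 0%N by clear -i0; lia.
  by rewrite U0.
have Uk : ~~ U k.
  have := H 1%N isT; rewrite h1 /= => h; apply/negP => Uk; move: h; rewrite /hl_mem.
  case: (leqP 1 k) => k0; first by rewrite Uk.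
  case: (leqP l 1) => l1; last by rewrite U1.
  have k00 : k = 0%N by clear -k0; lia.
  have l01 : l = 1%N by clear -kl l1; lia.
  move: hw; rewrite /hl_mem k00 l01; case: (leqP w 0) => // ; first by clear -w0; lia.
  by rewrite (negPf U1).
have last a b : (a < b)%N -> (b <= n.+2)%N -> ~~ ((a == n.+1) && (b == n.+2)) -> hl_mem U a b n.+1 = U b.
  move=> ab bn ne; rewrite /hl_mem; have -> : (n.+1 <= a)%N = false by clear -ab bn ne; lia.
  case: (leqP b n.+1) => // b1; have -> : b = n.+2 by clear -b1 bn; lia.
  by rewrite Un1 Un2.
have kl1 : ~~ ((k == n.+1) && (l == n.+2)).
  apply/negP => /andP[/eqP ek /eqP el]; move: hw; rewrite /hl_mem ek.
  by case/andP: w0 => _ ->; rewrite (negPf Un1).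
have ij1 : ~~ ((i == n.+1) && (j == n.+2)).
  by apply/negP => /andP[/eqP ei _]; move: Ui; rewrite ei (negPf Un1).
have Ujl : U l = ~~ U j by have := H n.+1 (leqnn _); rewrite !last.
have Uj : ~~ U j.
  apply/negP => Uj; rewrite Uj /= in Ujl.
  have := H w w0; rewrite hw => /esym/negP; apply.
  move: hw; rewrite /hl_mem; case: (leqP w k) => [_ h|_]; first by rewrite h in Uk.
  case: (leqP l w) => [_|_ Uw]; first by rewrite Ujl.
  by case: ifP => // _; case: ifP.
rewrite Uj in Ujl.
move: hy; rewrite /hl_mem.
case: (leqP x i) => // xi.
have yi : (y <= i)%N = false by clear -xi xy; lia.
rewrite yi; case: (leqP j y) => [_ h|yj Uy]; first by rewrite h in Uj.
have jx : (j <= x)%N = false by clear -yj xy; lia.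
rewrite jx; apply/negP => Ux.
have hx : hl_mem U k l x.
  by rewrite H ?x0 ?(leq_trans xy) // /hl_mem leqNgt xi jx /= Ux.
have lx : (l <= x)%N.
  move: hx; rewrite /hl_mem; case: (leqP x k) => [_ h|_]; first by rewrite h in Uk.
  by case: (leqP l x) => // _; rewrite Ux.
have yn' : (0 < y <= n.+1)%N by rewrite (leq_trans x0 xy).
have := H y yn'; rewrite /hl_mem.
have -> : (y <= k)%N = false by clear -kl lx xy; lia.
by rewrite (leq_trans lx xy) yi (leqNgt j) yj /= Ujl Uy.
Qed.

(** * Steps of indicators along the simple roots *)

Section SetProfile.
Variables (R : realType) (n : nat).
Implicit Types (S A B : {set 'I_n.+1}).
Local Notation lo i := (widen_ord (leqnSn n) i).
Local Notation hi i := (lift ord0 i).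

Lemma set_sum_root S (i : 'I_n) :
  set_sum (simple_root R i) S = (lo i \in S)%:R - (hi i \in S)%:R.
Proof. by rewrite /set_sum (sum_simple_root R i [in S]). Qed.

Lemma proper_change S : S != finset.set0 -> S != [set: 'I_n.+1]%SET ->
  exists i : 'I_n, (lo i \in S) != (hi i \in S).
Proof.
move=> S0 S1; apply: contrapT => H.
have step (i : 'I_n) : (lo i \in S) = (hi i \in S).
  by apply/eqP/negPn/negP => h; apply: H; exists i.
have const k (kn : (k < n.+1)%N) : (Ordinal kn \in S) = (ord0 \in S).
  elim: k kn => [|k IH] kn; first by congr (_ \in S); apply: val_inj.
  have kn' : (k < n)%N by [].
  rewrite -(IH (ltnW kn)); have := step (Ordinal kn').
  have -> : lo (Ordinal kn') = Ordinal (ltnW kn) by apply: val_inj.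
  by have -> : hi (Ordinal kn') = Ordinal kn by apply: val_inj.
case: (boolP (ord0 \in S)) => h0.
  move/eqP: S1; apply; apply/finset.setP => -[k kn].
  by rewrite const h0 inE.
move/eqP: S0; apply; apply/finset.setP => -[k kn].
by rewrite const (negPf h0) inE.
Qed.

(** Where one indicator steps up the other steps down, so their sum modulo 2 is constant; it is 1
    because the indicator of [S1] changes somewhere. *)
Lemma complement_of_opposite S1 S2 (k1 k2 : R) :
  S1 != finset.set0 -> S1 != [set: 'I_n.+1]%SET ->
  0 < k1 -> 0 < k2 ->
  (forall i : 'I_n, k1 * set_sum (simple_root R i) S1 = - (k2 * set_sum (simple_root R i) S2)) ->
  forall x, (x \in S2) = (x \notin S1).
Proof.
move=> S0 ST k10 k20 H.
have step (i : 'I_n) : (lo i \in S1) (+) (lo i \in S2) = (hi i \in S1) (+) (hi i \in S2) /\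
    ((lo i \in S1) != (hi i \in S1) -> (lo i \in S1) (+) (lo i \in S2)).
  have := H i; rewrite !set_sum_root.
  by case: (lo i \in S1); case: (hi i \in S1); case: (lo i \in S2); case: (hi i \in S2) => /= e;
   split=> //; exfalso; lra.
have const k (kn : (k < n.+1)%N) :
    (Ordinal kn \in S1) (+) (Ordinal kn \in S2) = (ord0 \in S1) (+) (ord0 \in S2).
  elim: k kn => [|k IH] kn; first by congr ((_ \in S1) (+) (_ \in S2)); apply: val_inj.
  have kn' : (k < n)%N by [].
  rewrite -(IH (ltnW kn)); have := (step (Ordinal kn')).1.
  have -> : lo (Ordinal kn') = Ordinal (ltnW kn) by apply: val_inj.
  by have -> : hi (Ordinal kn') = Ordinal kn by apply: val_inj.
have [i hi1] := proper_change S0 ST.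
have := (step i).2 hi1.
have -> : lo i = Ordinal (ltn_ord (lo i)) by apply: val_inj.
rewrite const => c x; case: x => k kn; have := const k kn; rewrite c.
by case: (_ \in S1); case: (_ \in S2).
Qed.

Lemma prefix_profile S : (forall x y : 'I_n.+1, (x <= y)%N -> y \in S -> x \in S) ->
  S != finset.set0 -> S != [set: 'I_n.+1]%SET ->
  exists m : 'I_n, forall i : 'I_n, set_sum (simple_root R i) S = (i == m)%:R.
Proof.
move=> down S0 ST; have [m hm] := proper_change S0 ST.
have mhi : (hi m \in S) = false.
  apply/negP => h; have hl : lo m \in S by apply: down h; rewrite lift0 /=.
  by rewrite h hl in hm.
have mlo : lo m \in S by move: hm; rewrite mhi; case: (_ \in S).
exists m => i; rewrite set_sum_root; case: (ltngtP i m) => im.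
- have -> : hi i \in S by apply: down mlo; rewrite lift0.
  have -> : lo i \in S by apply: down mlo; rewrite /= ltnW.
  by rewrite subrr -(inj_eq val_inj) /= ltn_eqF.
- have F (x : 'I_n.+1) : (m < x)%N -> x \in S -> False.
    by move=> mx xS; have : hi m \in S by [apply: down xS; rewrite lift0]; rewrite mhi.
  have -> : (lo i \in S) = false by apply/negP; exact: F.
  have -> : (hi i \in S) = false by apply/negP; apply: F; rewrite lift0 ltnS ltnW.
  by rewrite subrr -(inj_eq val_inj) /= gtn_eqF.
- have -> : i = m by apply: val_inj.
  by rewrite mlo mhi eqxx subr0.
Qed.

(** The indicator is its initial value plus unit steps just after the positions [m j], downward
    where [eta j] holds. Integer values allow steps of both signs to be added. *)
Definition jumps (m : 'I_n -> 'I_n) (eta : 'I_n -> bool) (X : seq 'I_n) S : Prop :=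
  forall x : 'I_n.+1, (x \in S)%:R = (ord0 \in S)%:R +
    \sum_(j <- X) (if (m j < x)%N then (-1) ^+ (eta j) else 0) :> int.

(** As [m] is injective on [X], at most one term is present at each position; an indicator only
    changes by 0 or by 1 in either direction, so only the signs of the coefficients survive. *)
Lemma jump_formula S (X : seq 'I_n) (eta : 'I_n -> bool) (mu : 'I_n -> R) (m : 'I_n -> 'I_n) (k : R) :
  uniq X -> 0 < k -> (forall j, 0 < mu j) -> {in X &, injective m} ->
  (forall i : 'I_n, \sum_(j <- X) (-1) ^+ (eta j) * mu j * (i == m j)%:R =
     - (k * set_sum (simple_root R i) S)) ->
  jumps m eta X S.
Proof.
move=> uX k0 mu0 minj H.
have step (i : 'I_n) : (hi i \in S)%:R = (lo i \in S)%:R +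
    \sum_(j <- X) (if i == m j then (-1) ^+ (eta j) else 0) :> int.
  have := H i; rewrite set_sum_root.
  case: (boolP (has (fun j => i == m j) X)) => [/hasP[j jX /eqP ij]|/hasPn nX].
    have E (T : zmodType) (F : 'I_n -> T) : (forall j', i != m j' -> F j' = 0) ->
        \sum_(j' <- X) F j' = F j.
      move=> F0; rewrite (bigD1_seq j) //= big_seq_cond big1 ?addr0 // => j' /andP[j'X nj].
      by apply: F0; rewrite ij (inj_in_eq minj) // eq_sym.
    rewrite !E; last 2 first.
    + by move=> j' /negPf->; rewrite /= ?mulr0.
    + by move=> j' /negPf->; rewrite /= ?mulr0.
    rewrite ij eqxx mulr1 -ij; have := mu0 j; case: (eta j); case: (hi i \in S); case: (lo i \in S) => //= h e;
      exfalso; move: h e k0; rewrite ?expr1 ?expr0; clear; move: (mu j) => u; lra.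
  rewrite !big1_seq; last 2 first.
  + by move=> j /= /nX/negPf->; rewrite /= ?mulr0.
  + by move=> j /= /nX/negPf->; rewrite /= ?mulr0.
  case: (hi i \in S); case: (lo i \in S) => //= e; exfalso; move: e k0; clear; lra.
have main k' (kn : (k' < n.+1)%N) : (Ordinal kn \in S)%:R = (ord0 \in S)%:R +
     \sum_(j <- X) (if (m j < k')%N then (-1) ^+ (eta j) else 0) :> int.
  elim: k' kn => [|k' IH] kn.
    rewrite big1 ?addr0 //; congr ((_ \in S)%:R); exact: val_inj.
  have kn' : (k' < n)%N by [].
  have := step (Ordinal kn').
  have -> : lo (Ordinal kn') = Ordinal (ltnW kn) by apply: val_inj.
  have -> : hi (Ordinal kn') = Ordinal kn by apply: val_inj.
  rewrite IH => ->; rewrite -addrA -big_split /=; congr (_ + _); apply: eq_bigr => j _.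
  rewrite -(inj_eq val_inj) /= ltnS; case: (ltngtP (m j) k') => h; rewrite ?addr0 ?add0r //.
by move=> [k' kn]; exact: main.
Qed.

End SetProfile.

(** The indicator [S123] goes down at [i] and [k] and up at [j]; to stay within 0 and 1 it must
    start at 1 and have [j] between [i] and [k]. This fixes all four indicators. Downward steps are
    written on the left to avoid subtraction in [nat]. *)
Lemma jump_triple (n i j k : nat) (b2 b12 b23 b123 : bool) (S2 S12 S23 S123 : nat -> bool) :
  (i < n)%N -> (j < n)%N -> (k < n)%N -> i != j -> j != k -> i != k ->
  (forall x, (x <= n)%N -> [/\ S2 x = b2 + (j < x) :> nat,
     S12 x + (i < x) = b12 + (j < x) :> nat, S23 x + (k < x) = b23 + (j < x) :> nat &
     S123 x + (i < x) + (k < x) = b123 + (j < x) :> nat]%N) ->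
  [/\ (forall x, (x <= n)%N -> S12 x = S2 x || S123 x /\ S23 x = S2 x && S123 x) \/
      (forall x, (x <= n)%N -> S23 x = S2 x || S123 x /\ S12 x = S2 x && S123 x),
      S2 n && ~~ S123 n & S123 0%N && ~~ S2 0%N].
Proof.
move=> li lj lk ij jk ik H.
have [] := H n (leqnn n); rewrite li lj lk.
case: b2 H => H; first by case: (S2 n).
case: b123 H => H; last by case: (S123 n).
move=> /eqP n2 _ _ /eqP n123.
have ex x : (x <= n)%N -> (S123 x + (i < x) + (k < x) = 1 + (j < x))%N by case/H.
have o : S123 0%N && ~~ S2 0%N by have [] := H 0%N isT; rewrite !ltn0; case: (S123 0%N); case: (S2 0%N).
have m : S2 n && ~~ S123 n by move: n2 n123; case: (S2 n); case: (S123 n).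
split=> //.
have := ex j (ltnW lj); have := ex j.+1 lj; rewrite !ltnS leqnn ltnn.
have [_ j12 j23 _] := H j (ltnW lj); have [_ J12 J23 _] := H j.+1 lj.
move: j12 j23 J12 J23; rewrite !ltnS leqnn ltnn.
case: (ltngtP i j) ij => // ij' _; case: (ltngtP k j) jk => // jk' _ /=.
- by case: (S123 j).
- move=> j12 _ _ j23 _ _; left => x /H[].
  case: b12 j12 H => j12 H; last by case: (S12 j) j12.
  case: b23 j23 H => j23 H; first by case: (S23 j.+1) j23.
  case: (ltnP k x) => kx; first by rewrite (ltn_trans jk' kx) (ltn_trans ij' (ltn_trans jk' kx));
    case: (S2 x); case: (S12 x); case: (S23 x); case: (S123 x).
  case: (ltnP j x) => jx; first by rewrite (ltn_trans ij' jx);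
    case: (S2 x); case: (S12 x); case: (S23 x); case: (S123 x).
  by case: (i < x)%N; case: (S2 x); case: (S12 x); case: (S23 x); case: (S123 x).
- move=> _ j23 j12 _ _ _; right => x /H[].
  case: b23 j23 H => j23 H; last by case: (S23 j) j23.
  case: b12 j12 H => j12 H; first by case: (S12 j.+1) j12.
  case: (ltnP i x) => ix; first by rewrite (ltn_trans ij' ix) (ltn_trans jk' (ltn_trans ij' ix));
    case: (S2 x); case: (S12 x); case: (S23 x); case: (S123 x).
  case: (ltnP j x) => jx; first by rewrite (ltn_trans jk' jx);
    case: (S2 x); case: (S12 x); case: (S23 x); case: (S123 x).
  by case: (k < x)%N; case: (S2 x); case: (S12 x); case: (S23 x); case: (S123 x).
- by case: (S123 j.+1).
Qed.

(** Complementation reverses all steps and exchanges union and intersection. *)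
Lemma jump_triple_opp (n i j k : nat) (b2 b12 b23 b123 : bool) (S2 S12 S23 S123 : nat -> bool) :
  (i < n)%N -> (j < n)%N -> (k < n)%N -> i != j -> j != k -> i != k ->
  (forall x, (x <= n)%N -> [/\ S2 x + (j < x) = b2 :> nat,
     S12 x + (j < x) = b12 + (i < x) :> nat, S23 x + (j < x) = b23 + (k < x) :> nat &
     S123 x + (j < x) = b123 + (i < x) + (k < x) :> nat]%N) ->
  [/\ (forall x, (x <= n)%N -> S12 x = S2 x || S123 x /\ S23 x = S2 x && S123 x) \/
      (forall x, (x <= n)%N -> S23 x = S2 x || S123 x /\ S12 x = S2 x && S123 x),
      S123 n && ~~ S2 n & S2 0%N && ~~ S123 0%N].
Proof.
move=> li lj lk ij jk ik H.
have [|D m o] := @jump_triple n i j k (~~ b2) (~~ b12) (~~ b23) (~~ b123)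
  (fun x => ~~ S2 x) (fun x => ~~ S12 x) (fun x => ~~ S23 x) (fun x => ~~ S123 x) li lj lk ij jk ik.
- move=> x /H[]; case: b2 {H}; case: b12; case: b23; case: b123;
  case: (S2 x); case: (S12 x); case: (S23 x); case: (S123 x);
  case: (i < x)%N; case: (j < x)%N; case: (k < x)%N => //=.
rewrite !negbK in m o; split; [|by rewrite andbC|by rewrite andbC].
case: D => D; [right|left] => x /D[h1 h2].
  by split; apply: negb_inj; rewrite ?h1 ?h2 ?negb_or ?negb_and // -negb_and // negbK.
by split; apply: negb_inj; rewrite ?h1 ?h2 ?negb_or ?negb_and // -negb_and // negbK.
Qed.

Section JumpSets.
Variables (n : nat) (m : 'I_n -> 'I_n) (eta : 'I_n -> bool).
Implicit Types (S : {set 'I_n.+1}) (i j k : 'I_n).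
Local Notation jumps := (jumps m eta).

Lemma jumps_pair i j S : jumps [:: i; j] S -> eta i != eta j.
Proof.
move=> /(_ ord_max); rewrite !big_cons big_nil !ltn_ord.
by case: (eta i); case: (eta j); case: (ord_max \in S); case: (ord0 \in S).
Qed.

Lemma jumps_triple i j k S2 S12 S23 S123 : injective m ->
  i != j -> j != k -> i != k -> eta i != eta j -> eta j != eta k ->
  jumps [:: j] S2 -> jumps [:: i; j] S12 -> jumps [:: j; k] S23 -> jumps [:: i; j; k] S123 ->
  [/\ (S12 = S2 :|: S123 /\ S23 = S2 :&: S123)%SET \/
      (S23 = S2 :|: S123 /\ S12 = S2 :&: S123)%SET,
      ~~ (S2 \subset S123) & ~~ (S123 \subset S2)].
Proof.
move=> m_inj ij jk ik sij sjk.
pose I S x := (inord x : 'I_n.+1) \in S.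
have IE S (x : 'I_n.+1) : (x \in S) = I S x by rewrite /I inord_val.
have X S ks x : (x <= n)%N -> jumps ks S ->
    (I S x)%:R = (ord0 \in S)%:R + \sum_(j <- ks) (if (m j < x)%N then (-1) ^+ (eta j) else 0) :> int.
  by move=> lx /(_ (inord x)); rewrite inordK.
move=> J2 J12 J23 J123.
have {}X x (lx : (x <= n)%N) := And4 (X _ _ _ lx J2) (X _ _ _ lx J12) (X _ _ _ lx J23) (X _ _ _ lx J123).
have val_m i' i'' : i' != i'' -> m i' != m i'' :> nat.
  by rewrite (inj_eq val_inj) (inj_eq m_inj).
have sub A B x : I A x && ~~ I B x -> ~~ (A \subset B).
  by move=> /andP[xA xB]; apply/fintype.subsetPn; exists (inord x).
have fin A B C D : (forall x, (x <= n)%N -> I A x = I B x || I C x /\ I D x = I B x && I C x) ->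
    (A = B :|: C /\ D = B :&: C)%SET.
  move=> H; split; apply/finset.setP => x; rewrite inE !IE; have lx := ltn_ord x;
    by case: (H x _).
have ei : eta i = ~~ eta j by move: sij; case: (eta i); case: (eta j).
have ek : eta k = ~~ eta j by move: sjk; case: (eta k); case: (eta j).
move: X; case: (boolP (eta j)) ei ek => ej ei ek X.
  have [|D d1 d2] := @jump_triple_opp n (m i) (m j) (m k) (ord0 \in S2) (ord0 \in S12) (ord0 \in S23)
    (ord0 \in S123) (I S2) (I S12) (I S23) (I S123) (ltn_ord _) (ltn_ord _) (ltn_ord _)
    (val_m _ _ ij) (val_m _ _ jk) (val_m _ _ ik).
    move=> x /X[]; rewrite !big_cons big_nil ei ek ej => x2 x12 x23 x123; split.
    - by move: x2; case: (I S2 x); case: (ord0 \in S2); case: (m j < x)%N.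
    - by move: x12; case: (I S12 x); case: (ord0 \in S12); case: (m j < x)%N; case: (m i < x)%N.
    - by move: x23; case: (I S23 x); case: (ord0 \in S23); case: (m j < x)%N; case: (m k < x)%N.
    - by move: x123; case: (I S123 x); case: (ord0 \in S123); case: (m j < x)%N;
        case: (m k < x)%N; case: (m i < x)%N.
  split; [by case: D => /fin; [left|right]|exact: sub d2|exact: sub d1].
have [|D d1 d2] := @jump_triple n (m i) (m j) (m k) (ord0 \in S2) (ord0 \in S12) (ord0 \in S23)
  (ord0 \in S123) (I S2) (I S12) (I S23) (I S123) (ltn_ord _) (ltn_ord _) (ltn_ord _)
  (val_m _ _ ij) (val_m _ _ jk) (val_m _ _ ik).
  move=> x /X[]; rewrite !big_cons big_nil ei ek (negPf ej) => x2 x12 x23 x123; split.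
  - by move: x2; case: (I S2 x); case: (ord0 \in S2); case: (m j < x)%N.
  - by move: x12; case: (I S12 x); case: (ord0 \in S12); case: (m j < x)%N; case: (m i < x)%N.
  - by move: x23; case: (I S23 x); case: (ord0 \in S23); case: (m j < x)%N; case: (m k < x)%N.
  - by move: x123; case: (I S123 x); case: (ord0 \in S123); case: (m j < x)%N;
      case: (m k < x)%N; case: (m i < x)%N.
split; [by case: D => /fin; [left|right]|exact: sub d1|exact: sub d2].
Qed.

End JumpSets.

Section SetForm.
Variables (R : realType) (n : nat).
Implicit Types (S : {set 'I_n}) (x y : 'rV[R]_n).

Definition set_form S : 'Hom('rV[R]_n, R^o) := linfun (lform (fun l => (l \in S)%:R)).

Lemma set_formE S x : set_form S x = set_sum x S :> R.
Proof.
rewrite lfunE /= /lform /set_sum [RHS]big_mkcond; apply: eq_bigr => l _.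
by case: ifP => _; rewrite ?mul1r ?mul0r.
Qed.

Lemma set_sumB S x y : set_sum (x - y) S = set_sum x S - set_sum y S.
Proof. by rewrite -!set_formE linearB. Qed.

Lemma set_sumZ S (t : R) x : set_sum (t *: x) S = t * set_sum x S.
Proof. by rewrite -!set_formE linearZ. Qed.

Lemma set_sum_sum S (I : finType) (y : I -> 'rV[R]_n) :
  set_sum (\sum_i y i) S = \sum_i set_sum (y i) S.
Proof. by rewrite -set_formE linear_sum; apply: eq_bigr => i _; exact: set_formE. Qed.

Lemma set_sumUI x A B : set_sum x (A :|: B)%SET + set_sum x (A :&: B)%SET = set_sum x A + set_sum x B.
Proof.
rewrite /set_sum !(big_mkcond (fun l => l \in _)) /= -!big_split /=; apply: eq_bigr => l _.
by rewrite !inE; case: (l \in A); case: (l \in B); rewrite /= ?addr0 ?add0r.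
Qed.

Lemma set_sumT x : set_sum x [set: 'I_n]%SET = \sum_l x 0 l.
Proof. by apply: eq_bigl => l; rewrite inE. Qed.

End SetForm.

(** * Inequalities tight on a face *)

Section Facets.
Variables (R : realType) (n : nat) (s : (n.-1).-tuple bool).
Variable p : 'I_n.+3 -> 'rV[R]_2.
Hypothesis n_ge1 : (1 <= n)%N.
Hypothesis p_HL : HL_polygon s p.
Local Notation W := 'rV[R]_n.+1.
Local Notation P := (Ass_I p).
Local Notation U := (hl_sign s).
Implicit Types (S : {set 'I_n.+1}) (F : set W).

(** The index sets of the inequalities; whether each of them defines a facet is left open. *)
Definition facet_set S : Prop :=
  exists e : chord n, [/\ (e.1 < e.2)%N, S = hl_set U e, S != finset.set0 & S != [set: 'I_n.+1]%SET].

Lemma Ass_I_facets x : P x <->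
  (forall S, facet_set S -> tri_num R #|S| <= set_sum x S) /\ \sum_l x 0 l = tri_num R n.+1.
Proof.
split=> [/(Ass_IE n_ge1 p_HL)[H ->]|[H e]].
  by split=> // S [e [le -> S0 ST]]; exact: H.
apply/(Ass_IE n_ge1 p_HL); split=> // d ld d0 d1.
by apply: H; exists d.
Qed.

Lemma facet_prefix S1 S2 : facet_set S1 -> facet_set S2 -> (forall x, (x \in S2) = (x \notin S1)) ->
  ord0 \in S1 -> forall x y : 'I_n.+1, (x <= y)%N -> y \in S1 -> x \in S1.
Proof.
move=> [e1 [l1 E1 _ _]] [e2 [l2 E2 S0 _]] C.
have M1 x : (x \in S1) = hl_mem U e1.1 e1.2 x.+1 by rewrite E1 inE.
have M2 x : (x \in S2) = hl_mem U e2.1 e2.2 x.+1 by rewrite E2 inE.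
have C' x : (0 < x <= n.+1)%N -> hl_mem U e2.1 e2.2 x = ~~ hl_mem U e1.1 e1.2 x.
  case: x => // x /andP[_ lx]; have lx' : (x < n.+1)%N by [].
  by have := C (Ordinal lx'); rewrite M1 M2.
have ex : exists2 x, (0 < x <= n.+1)%N & hl_mem U e2.1 e2.2 x.
  have [x xS] : exists x, x \in S2 by apply/set0Pn.
  by exists x.+1; [exact: (ltn_ord x)|rewrite -M2].
rewrite M1 => h0 x y xy; rewrite !M1 => hy.
have Un1 : ~~ U n.+1 by rewrite hl_sign_n1.
have Un2 : U n.+2 by rewrite hl_sign_n2.
have le2 (d : chord n) : (d.2 <= n.+2)%N by rewrite -ltnS.
exact: (@hl_mem_complement_prefix U n _ _ _ _ isT Un2 isT Un1 l1 l2 (le2 _) (le2 _) C' ex h0 x.+1 y.+1).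
Qed.

Hypothesis dirP : direction P = sum_zero R n.

Lemma Ass_I_sub_sum_zero x y : P x -> P y -> x - y \in sum_zero R n.
Proof. by rewrite -dirP; exact: sub_direction. Qed.

Lemma ev_eq0 (c : 'Hom(subvs_of (direction P), R^o)) :
  (forall z, z \in sum_zero R n -> ev (P := P) c z = 0) -> c = 0.
Proof.
move=> H; apply/lfunP => u; rewrite zero_lfunE.
by rewrite -[u]vsvalK; apply: H; rewrite -dirP; exact: subvsP.
Qed.

(* If no facet inequality is tight on all of F, averaging points of F gives one
   at which all are strict, hence interior to P. *)
Lemma face_in_facet F (c : 'Hom(subvs_of (direction P), R^o)) :
  F !=set0 -> F `<=` P -> normal_cone P F c -> c != 0 ->
  exists2 S, facet_set S & forall y, F y -> set_sum y S = tri_num R #|S|.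
Proof.
move=> [y0 Fy0] FP nF c0; apply: contrapT => nex.
have Fc : F `<=` amax (P := P) c by apply/normal_coneP.
(* Each index set of an inequality gets a point of [F] where that inequality is strict; every other
   set gets [y0], so that the mean may run over all sets. *)
have /boolp.choice[y Hy] S : exists y : W, F y /\
    (facet_set S -> tri_num R #|S| < set_sum y S).
  case: (pselect (facet_set S)) => fS; last by exists y0.
  apply: contrapT => nS; apply: nex; exists S => // z Fz.
  apply/eqP; apply/negPn/negP => ne; apply: nS; exists z; split=> // _.
  by rewrite lt_def ne; apply: ((Ass_I_facets z).1 (FP _ Fz)).1.
have Py S : P (y S) by apply: FP; exact: (Hy S).1.
pose N : R := #|{: {set 'I_n.+1}}|%:R.
have N0 : 0 < N by rewrite ltr0n; apply/card_gt0P; exists finset.set0.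
pose x0 := N^-1 *: \sum_S y S.
have mean (b : R) : b = N^-1 * \sum_(S : {set 'I_n.+1}) b.
  by rewrite sumr_const -[b *+ _]mulr_natl mulrA mulVf ?mul1r ?gt_eqF.
have sx0 S : set_sum x0 S = N^-1 * \sum_S' set_sum (y S') S by rewrite set_sumZ set_sum_sum.
have strict S : facet_set S -> tri_num R #|S| < set_sum x0 S.
  move=> fS; rewrite sx0 [ltLHS]mean ltr_pM2l ?invr_gt0 //.
  rewrite (bigD1 S) //= [ltRHS](bigD1 S) //=; apply: ltr_leD; first exact: (Hy S).2.
  by apply: ler_sum => S' _; exact: ((Ass_I_facets _).1 (Py S')).1.
have x0s : \sum_l x0 0 l = tri_num R n.+1.
  rewrite -set_sumT sx0 [RHS]mean; congr (_ * _); apply: eq_bigr => S _.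
  by rewrite set_sumT; exact: ((Ass_I_facets _).1 (Py S)).2.
have ex0 : ev (P := P) c x0 = ev (P := P) c y0.
  have -> : ev (P := P) c x0 = N^-1 * \sum_S ev (P := P) c (y S).
    rewrite /ev !linearZ !linear_sum /=.
    by [].
  rewrite [RHS]mean; congr (_ * _); apply: eq_bigr => S _.
  have [_ h1] := Fc _ (Hy S).1; have [_ h2] := Fc _ Fy0.
  by apply/eqP; rewrite eq_le h1 ?h2 //; exact: FP.
clearbody x0; move/eqP: c0; apply; apply: ev_eq0.
suff le0 z : z \in sum_zero R n -> ev (P := P) c z <= 0.
  move=> z z0; apply/eqP; rewrite eq_le le0 //=.
  have := le0 ((-1) *: z); rewrite evZ mulN1r oppr_le0; apply.
  by rewrite memvZ.
move=> z0; pose G S := `|set_sum z S| / (set_sum x0 S - tri_num R #|S|).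
(* A step length respecting every inequality: [e] times the absolute change along [z] does not
   exceed the slack at [x0]. *)
pose e := (1 + \sum_(S | `[< facet_set S >]) G S)^-1.
have G0 S : facet_set S -> 0 <= G S.
  by move=> fS; rewrite divr_ge0 // subr_ge0 ltW // strict.
have Gs0 : 0 <= \sum_(S | `[< facet_set S >]) G S by apply: sumr_ge0 => S /asboolP; exact: G0.
have e0 : 0 < e by rewrite invr_gt0 ltr_pwDl.
have Pz : P (x0 - (- e) *: z).
  apply/Ass_I_facets; split; last first.
    rewrite -set_sumT set_sumB set_sumZ !set_sumT x0s.
    by move: z0; rewrite mem_sum_zero => /eqP->; rewrite mulr0 subr0.
  move=> S fS; rewrite set_sumB set_sumZ.
  have gap : 0 < set_sum x0 S - tri_num R #|S| by rewrite subr_gt0 strict.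
  suff : e * `|set_sum z S| <= set_sum x0 S - tri_num R #|S|.
    have := ler_norm (- set_sum z S); rewrite normrN => h1 h2.
    have := ler_wpM2l (ltW e0) h1; lra.
  rewrite -[leRHS]mul1r -ler_pdivrMr // -mulrA mulrC ler_pdivrMr ?ltr_pwDl // mul1r.
  rewrite (bigD1 S) /=; last exact/asboolP.
  by rewrite addrCA lerDl addr_ge0 // sumr_ge0 // => S' /andP[/asboolP fS' _]; exact: G0.
have := (Fc _ Fy0).2 _ Pz; rewrite -ex0 evB evZ mulNr opprK gerDl.
by rewrite pmulr_rle0.
Qed.

End Facets.

(** * Seeds of Hohlweg-Lange fans *)

Section SantosFan.
Variables (R : realType) (n : nat) (s : (n.-1).-tuple bool).
Variable p : 'I_n.+3 -> 'rV[R]_2.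
Hypothesis n_ge1 : (1 <= n)%N.
Hypothesis p_HL : HL_polygon s p.
Local Notation W := 'rV[R]_n.+1.
Local Notation P := (Ass_I p).
Local Notation fset := (@facet_set n s).
Variables (V : vectType R) (a : 'I_n -> V) (t : 'I_n -> chord n) (w : chord n -> V).
Variable f : 'Hom(V, conormal_space P).
Local Notation T0 := [set t i | i : 'I_n]%SET.
Hypothesis a_basis : basis_of fullv (codom a).
Hypothesis T0_tri : ctri T0.
Hypothesis w_seed : forall i, w (t i) = - a i.
Hypothesis w_cross : forall e ks, uniq ks -> ks != [::] ->
  crosses_exactly T0 e [seq t k | k <- ks] -> w e = \sum_(k <- ks) a k.
Hypothesis f_bij : bijective f.
Hypothesis f_fan : forall T D : {set chord n}, ctri T -> D \subset T ->
  normal_fan P (f @` conic_hull (mem D) w).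

Lemma seed_inj : injective t.
Proof.
have /imset_injP H : #|T0| == #|'I_n| by rewrite T0_tri.1 card_ord.
by move=> i j; exact: H.
Qed.

Let t_in i : t i \in T0. Proof. exact: imset_f. Qed.

Let t_diag i : diag (t i). Proof. by apply: T0_tri.2.1. Qed.

(** The isomorphism [f] forces [P] to have dimension [n], so its directions fill the hyperplane of
    zero sum. *)
Let dirP : direction P = sum_zero R n.
Proof.
apply/eqP; rewrite eqEdim; apply/andP; split.
  apply: direction_min => x y /(Ass_IE n_ge1 p_HL)[_ xs] /(Ass_IE n_ge1 p_HL)[_ ys].
  rewrite mem_sum_zero; under eq_bigr do rewrite rVB_E.
  by rewrite big_split sumrN /= xs ys subrr.
have := lfun_bijective_dim f_bij; rewrite dim_Hom1 [X in X = _ -> _]dimvf /dim /= => ->.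
by rewrite dim_sum_zero (size_basis (X := in_tuple (codom a))) // size_codom card_ord.
Qed.

Local Notation pair u z := (ev (P := P) (f u) z).

Let f_inj u : (forall z, z \in sum_zero R n -> pair u z = 0) -> u = 0.
Proof.
move=> H; apply: (bij_inj f_bij); rewrite linear0.
exact: (ev_eq0 dirP).
Qed.

Let basis_form (c : 'I_n -> R) : exists h : 'Hom(V, R^o), forall i, h (a i) = c i.
Proof. exact: basis_extension (basis_free a_basis). Qed.

Let w_seed_neq0 i : w (t i) != 0.
Proof.
have [h H] := basis_form (fun=> 1); apply/eqP => /(congr1 h).
by rewrite w_seed linearN linear0 /= H => /eqP; rewrite oppr_eq0 oner_eq0.
Qed.

Let w_cross_neq0 e ks : uniq ks -> ks != [::] ->
  crosses_exactly T0 e [seq t k | k <- ks] -> w e != 0.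
Proof.
move=> uks ks0 ce; have [h H] := basis_form (fun=> 1); apply/eqP => /(congr1 h).
rewrite (w_cross uks ks0 ce) linear0 linear_sum /=.
rewrite (eq_bigr (fun=> 1)) => [|i _]; last exact: H.
rewrite big_const_seq count_predT iter_addr_0 => /eqP.
by rewrite pnatr_eq0 size_eq0 (negPf ks0).
Qed.

(** The image of the ray of [d] is the normal cone of a face [F]. Some inequality, of set [S], is
    tight on [F]; its outer normal lies in that cone, hence is a multiple of the image of [w d]. The
    multiple is positive because the form of a proper nonempty set is not zero on the hyperplane. *)
Lemma ray_facet d : diag d -> w d != 0 -> exists (S : {set 'I_n.+1}) (k : R) (y : W),
  [/\ fset S, 0 < k, forall z, z \in sum_zero R n -> pair (w d) z = - (k * set_sum z S),
      P y & set_sum y S = tri_num R #|S|].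
Proof.
move=> dd wd0.
have nc : noncrossing [set d]%SET.
  split=> [e|e e'] /[!inE] /eqP-> //; move=> /eqP->; by rewrite crd_same.
have [T sT tT] := noncrossing_extend nc.
have [F [fF eF]] := f_fan tT sT.
have FP := face_sub fF; have [F0 _] := fF.
have wdF : normal_cone P F (f (w d)).
  by rewrite -eF; exists (w d) => //; apply: conic_hull_point; rewrite /= inE.
have fw0 : f (w d) != 0.
  by apply: contra wd0 => /eqP h; apply/eqP/(bij_inj f_bij); rewrite linear0.
have [S fS St] := face_in_facet n_ge1 p_HL dirP F0 FP wdF fw0.
pose c := restr (direction P) (- set_form R S).
have cE z : z \in sum_zero R n -> ev (P := P) c z = - set_sum z S.
  by move=> z0; rewrite /ev restrE ?dirP // opp_lfunE set_formE.
have : normal_cone P F c.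
  move=> x y Fx Py; rewrite -/(ev (P := P) c _) cE; last first.
    by apply: (Ass_I_sub_sum_zero dirP) => //; exact: FP.
  rewrite set_sumB oppr_le0 subr_ge0 St //.
  exact: ((Ass_I_facets n_ge1 p_HL y).1 Py).1.
rewrite -eF => -[_ [l [l0 ->]]]; rewrite (big_pred1 d) => [|e /=]; last by rewrite inE.
rewrite linearZ /= => fc.
have [e [le Se S0 ST]] := fS.
have ld : 0 < l d.
  rewrite lt_def l0 andbT; apply/eqP => ld; rewrite ld scale0r in fc.
  have [i hi] := proper_change S0 ST.
  have := cE _ (simple_root_sum_zero R i); rewrite -fc /ev zero_lfunE => /esym/eqP.
  rewrite oppr_eq0 set_sum_root; move: hi.
  by case: (_ \in S); case: (_ \in S) => //= _; rewrite ?subr0 ?sub0r ?oppr_eq0 oner_eq0.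
have [y Fy] := F0.
exists S, (l d)^-1, y; split=> //; [by rewrite invr_gt0| |exact: FP|exact: St].
move=> z z0; rewrite -mulrN -cE // -fc evZl mulrA mulVf ?mul1r //.
by rewrite gt_eqF.
Qed.

(** The ray of [a i] is that of the flip of [t i]. The initial segment ends at [m i], [eta i] tells
    whether it comes from the flip or from [t i], and [mu i] is its factor. *)
Let profile : exists (m : 'I_n -> 'I_n) (eta : 'I_n -> bool) (mu : 'I_n -> R), forall i, 0 < mu i /\
  forall l, pair (a i) (simple_root R l) = (-1) ^+ (eta i) * mu i * (l == m i)%:R.
Proof.
have /boolp.choice[x Hx] i : exists x : 'I_n * bool * R, 0 < x.2 /\
    forall l, pair (a i) (simple_root R l) = (-1) ^+ x.1.2 * x.2 * (l == x.1.1)%:R.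
  have [S1 [k1 [y1 [f1 k10 H1 _ _]]]] := ray_facet (t_diag i) (w_seed_neq0 i).
  have [e ce] := flip_chord T0_tri (t_in i).
  have ce' : crosses_exactly T0 e [seq t k | k <- [:: i]] by [].
  have we : w e = a i by rewrite (w_cross _ _ ce') // big_seq1.
  have we0 : w e != 0 by apply: w_cross_neq0 ce'.
  have [S2 [k2 [y2 [f2 k20 H2 _ _]]]] := ray_facet ce.1 we0.
  have H l : k1 * set_sum (simple_root R l) S1 = - (k2 * set_sum (simple_root R l) S2).
    have sz := simple_root_sum_zero R l; have := H1 _ sz; have := H2 _ sz.
    by rewrite we w_seed linearN /ev opp_lfunE => -> /eqP; rewrite eqr_opp => /eqP <-.
  have [e1 [_ _ S10 S1T]] := f1; have [e2 [_ _ S20 S2T]] := f2.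
  have C := complement_of_opposite S10 S1T k10 k20 H.
  case: (boolP (ord0 \in S1)) => o.
    have [m Hm] := prefix_profile R (facet_prefix n_ge1 f1 f2 C o) S10 S1T.
    exists (m, false, k1); split=> //= l.
    by rewrite mul1r -Hm H -we H2 // simple_root_sum_zero.
  have C' x : (x \in S1) = (x \notin S2) by rewrite C negbK.
  have o2 : ord0 \in S2 by rewrite C.
  have [m Hm] := prefix_profile R (facet_prefix n_ge1 f2 f1 C' o2) S20 S2T.
  exists (m, true, k2); split=> //= l.
  by rewrite mulN1r mulNr -Hm -we H2 // simple_root_sum_zero.
by exists (fun i => (x i).1.1), (fun i => (x i).1.2), (fun i => (x i).2).
Qed.

Lemma seed_is_snake : exists2 r, dihedral n.+3 r & forall k, (k < n)%N -> act r (snake_chord n k) \in T0.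
Proof.
have [m [eta [mu H]]] := profile.
have mu0 i : 0 < mu i := (H i).1.
(* Equal ends would make the images of two basis vectors proportional; [u] is the combination that
   [f] would kill. *)
have m_inj : injective m.
  move=> i j mij; apply/eqP/negPn/negP => nij.
  pose u := ((-1) ^+ eta j * mu j) *: a i - ((-1) ^+ eta i * mu i) *: a j.
  have u0 : u = 0.
    apply: f_inj => z /sum_zero_expand ->; rewrite ev_sum big1 // => l _.
    have -> : f u = ((-1) ^+ eta j * mu j) *: f (a i) - ((-1) ^+ eta i * mu i) *: f (a j).
      by rewrite /u linearB !linearZ.
    rewrite evBl !evZl !(H _).2 mij.
    by rewrite mulrCA subrr mulr0.
  have [h Hh] := basis_form (fun k => (k == i)%:R).
  have := congr1 h u0; rewrite linear0 /u linearB !linearZ /= !Hh eqxx eq_sym (negPf nij).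
  rewrite /GRing.scale /= oppr0 mulr0 addr0 mulr1 => /eqP; rewrite mulf_eq0 signr_eq0 /=.
  by rewrite gt_eqF.
have cross e ks : uniq ks -> ks != [::] -> crosses_exactly T0 e [seq t k | k <- ks] ->
    exists (S : {set 'I_n.+1}) (k : R) (y : W),
  [/\ fset S, 0 < k, forall z, z \in sum_zero R n -> pair (w e) z = - (k * set_sum z S),
      P y /\ set_sum y S = tri_num R #|S| & jumps m eta ks S].
  move=> uks ks0 ce.
  have [S [k [y [fS k0 Hz Py yS]]]] := ray_facet ce.1 (w_cross_neq0 uks ks0 ce).
  exists S, k, y; split=> //; apply: (jump_formula uks k0 mu0 (in2W m_inj)) => i.
  rewrite -Hz ?simple_root_sum_zero // (w_cross uks ks0 ce).
  rewrite linear_sum /ev sum_lfunE; apply: eq_bigr => j _; exact/esym/(H j).2.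
have pair_sign e i j : i != j -> crosses_exactly T0 e [:: t i; t j] -> eta i != eta j.
  move=> ij ce; have [||S [k [y [_ _ _ _]]]] := cross e [:: i; j] _ _ ce => //.
    by rewrite /= inE ij.
  exact: jumps_pair.
(* The signs [eta] carried from indices to chords, consistently since [t] is injective. *)
pose sgn d := [exists i, (t i == d) && eta i].
have sgnE i : sgn (t i) = eta i.
  apply/existsP/idP => [[j /andP[/eqP/seed_inj-> //]]|ei].
  by exists i; rewrite eqxx.
apply: (ctri_snake (eta := sgn)) n_ge1 T0_tri _ _.
  move=> e _ _ /imsetP[i _ ->] /imsetP[j _ ->] ij ce; rewrite !sgnE; apply: pair_sign ce.
  by apply: contraNneq ij => ->.
move=> _ _ _ e2 e12 e23 e123 [/imsetP[i _ ->] /imsetP[j _ ->] /imsetP[k _ ->] u3] c2 c12 c23 c123 ncr.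
have u3' : uniq [:: i; j; k] by have := u3; rewrite -[[:: t i; t j; t k]]/(map t [:: i; j; k]) => /map_uniq.
have [ij ik jk] : [/\ i != j, i != k & j != k].
  by move: u3'; rewrite /= !inE negb_or => /and3P[/andP[-> ->] ->].
have sij := pair_sign _ _ _ ij c12; have sjk := pair_sign _ _ _ jk c23.
have [||S2 [l2 [y2 [f2 l20 H2 [Py2 t2] X2]]]] := cross e2 [:: j] _ _ c2 => //.
have [||S12 [l12 [_ [f12 _ _ _ X12]]]] := cross e12 [:: i; j] _ _ c12 => //; first by rewrite /= inE ij.
have [||S23 [l23 [_ [f23 _ _ _ X23]]]] := cross e23 [:: j; k] _ _ c23 => //; first by rewrite /= inE jk.
have [||S123 [l123 [y123 [f123 l1230 H123 [Py123 t123] X123]]]] := cross e123 [:: i; j; k] _ _ c123 => //.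
have [UI n1 n2] := jumps_triple m_inj ij jk ik sij sjk X2 X12 X23 X123.
(* A face on which the facets of e2 and e123 would both be tight. *)
have nc : noncrossing [set e2; e123]%SET.
  split=> [e|e e'] /[!inE]; first by case/orP => /eqP->; [exact: c2.1|exact: c123.1].
  by case/orP => /eqP-> /orP[]/eqP->; rewrite ?crd_same // crdC.
have [T sT tT] := noncrossing_extend nc.
have [F [fF eF]] := f_fan tT sT.
have FP := face_sub fF; have [[y Fy] _] := fF.
have tight e S l y' : e \in [set e2; e123]%SET -> 0 < l ->
    (forall z, z \in sum_zero R n -> pair (w e) z = - (l * set_sum z S)) ->
    P y' -> set_sum y' S = tri_num R #|S| -> set_sum y S <= tri_num R #|S|.
  move=> ein l0 He Py' <-.
  have : normal_cone P F (f (w e)) by rewrite -eF; exists (w e) => //; exact: conic_hull_point.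
  move=> /(_ y y' Fy Py'); rewrite -/(ev (P := P) _ _) He; last first.
    by apply: (Ass_I_sub_sum_zero dirP) => //; exact: FP.
  by rewrite oppr_le0 pmulr_rge0 // set_sumB subr_ge0.
have h2 := tight e2 S2 l2 y2 (finset.set21 _ _) l20 H2 Py2 t2.
have h123 := tight e123 S123 l123 y123 (finset.set22 _ _) l1230 H123 Py123 t123.
have facet_le S : fset S -> tri_num R #|S| <= set_sum y S.
  exact: ((Ass_I_facets n_ge1 p_HL y).1 (FP _ Fy)).1.
have := tri_num_strict R n1 n2; have := set_sumUI y S2 S123.
have hU : tri_num R #|S2 :|: S123|%SET <= set_sum y (S2 :|: S123)%SET.
  by case: UI => [[<- _]|[<- _]]; exact: facet_le.
have hI : tri_num R #|S2 :&: S123|%SET <= set_sum y (S2 :&: S123)%SET.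
  by case: UI => [[_ <-]|[_ <-]]; exact: facet_le.
move: hU hI h2 h123; lra.
Qed.

End SantosFan.

(** * Transport of the Santos fan along a relabelling *)

Section Relabelling.
Variables (R : realType) (n : nat).
Hypothesis n_ge1 : (0 < n)%N.
Variable q : 'I_n.+3 -> 'rV[R]_2.
Hypotheses (q_convex : convex_polygon q) (q_cyclic : cyclically_labelled q).
Variables (V : vectType R) (a : 'I_n -> V) (t : 'I_n -> chord n) (r : nat -> nat).
Local Notation T0 := [set t i | i : 'I_n]%SET.
Local Notation V0 := (subvs_of (sum_zero R n)).
Hypothesis a_basis : basis_of fullv (codom a).
Hypothesis T0_tri : ctri T0.
Hypothesis r_dih : dihedral n.+3 r.
Hypothesis r_snake : forall k, (k < n)%N -> act r (snake_chord n k) \in T0.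

Let t_diag i : diag (t i). Proof. by apply: T0_tri.2.1; exact: imset_f. Qed.

Let diag_lt (d : chord n) : diag d -> (d.1 < d.2)%N. Proof. by case/andP. Qed.

Lemma santos_vector_seed i : santos_vector q t a (t i) = - a i.
Proof.
rewrite santos_vectorE //; case: pickP => [j /eqP/(seed_inj T0_tri)->//|/(_ i)].
by rewrite eqxx.
Qed.

Lemma santos_vector_cross e ks : uniq ks -> ks != [::] ->
  crosses_exactly T0 e [seq t k | k <- ks] -> santos_vector q t a e = \sum_(k <- ks) a k.
Proof.
move=> uks ks0 [de H].
have Ht k : crd e (t k) = (k \in ks).
  by rewrite H ?imset_f // mem_map //; exact: (seed_inj T0_tri).
rewrite santos_vectorE //; case: pickP => [j /eqP ej|_].
  case: ks ks0 Ht {uks H} => // k ks _ Ht; have := Ht k.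
  by rewrite -ej mem_head (negPf (T0_tri.2.2 _ _ _ _)) ?imset_f.
by rewrite big_uniq //; apply: eq_bigl => k; rewrite Ht.
Qed.

Lemma conic_hull_map (U : vectType R) (h : 'Hom(U, V)) (g : chord n -> chord n) (D : {set chord n})
    (v : chord n -> U) (v' : chord n -> V) :
  {in D &, injective g} -> (forall d, d \in D -> h (v d) = v' (g d)) ->
  h @` conic_hull (mem D) v = conic_hull (mem (g @: D)%SET) v'.
Proof.
move=> g_inj H; apply/seteqP; split=> [_ [_ [c [c0 ->]] <-]|_ [c [c0 ->]]].
  exists (fun e => \sum_(d in D | g d == e) c d); split=> [e|]; first by apply: sumr_ge0.
  rewrite linear_sum /= big_imset //=; apply: eq_bigr => d dD.
  rewrite linearZ /= H // (big_pred1 d) // => d'.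
  by apply/andP/eqP => [[d'D /eqP /g_inj->//]|->].
exists (\sum_(d in D) c (g d) *: v d); first by exists (c \o g); split=> // d; exact: c0.
rewrite linear_sum /= [RHS]big_imset //=; apply: eq_bigr => d dD.
by rewrite linearZ /= H.
Qed.

Let r_inj (d e : chord n) : diag d -> diag e -> act r d = act r e -> d = e.
Proof. by move=> /diag_lt ld /diag_lt le; exact: act_inj. Qed.

Lemma ctri_preimage (T : {set chord n}) : ctri T -> ctri [set d : chord n | diag d && (act r d \in T)]%SET.
Proof.
move=> [cT [dT xT]]; set S := [set d : chord n | _]%SET.
have rS : (act r @: S)%SET = T.
  apply/finset.setP => e; apply/imsetP/idP => [[d] |eT].
    by rewrite inE => /andP[_ ?] ->.
  have [d dd ed] := act_surj r_dih (dT _ eT).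
  by exists d => //; rewrite inE dd ed.
split; [|split].
- rewrite -[RHS]cT -rS card_in_imset // => d e; rewrite !inE => /andP[dd _] /andP[de _].
  exact: r_inj.
- by move=> d; rewrite inE => /andP[].
- by move=> d e; rewrite !inE => /andP[_ h1] /andP[_ h2]; rewrite -(crd_act _ _ r_dih) xT.
Qed.

(** A Santos vector depends only on the seed and the crossings with it; [r] preserves crossings and
    carries the snake onto the seed. The linear map sending each root to the basis vector of the
    corresponding seed chord, numbered by [tau], thus matches the vectors. *)
Lemma relabelled_fan : exists2 h : 'Hom(V0, V), bijective h &
  santos_fan q t a = [set h @` C | C in santos_fan q (@snake n) (@root_A R n)].
Proof.
have /boolp.choice[tau Htau] (i : 'I_n) : exists j, t j = act r (snake_chord n i).
  by have /imsetP[j _ ->] := r_snake (ltn_ord i); exists j.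
have tau_inj : injective tau.
  move=> i j eij; apply: (snake_chord_inj n_ge1); apply: r_inj; rewrite ?snake_chord_diag //.
  by rewrite -!Htau eij.
have [h Hh] := basis_extension (a \o tau) (basis_free (@root_A_basis R n)).
have [h' Hh'] := basis_extension (fun j => root_A R (invF tau_inj j)) (basis_free a_basis).
have hK u : h' (h u) = u.
  have sub : (<<codom (@root_A R n)>> <= lker (h' \o h - \1)%VF)%VS.
    apply/span_subvP => _ /codomP[i ->].
    by rewrite memv_ker add_lfunE opp_lfunE comp_lfunE id_lfunE Hh /= Hh' invF_f subrr.
  rewrite (span_basis (@root_A_basis R n)) in sub.
  have := subvP sub u (memvf _).
  by rewrite memv_ker add_lfunE opp_lfunE comp_lfunE id_lfunE subr_eq0 => /eqP.
have h_bij : bijective h.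
  apply: lfun_injective_bijective => [|u hu]; last by rewrite -[u]hK hu linear0.
  rewrite [X in (_ <= X)%N]dimvf /dim /= dim_sum_zero.
  by rewrite (size_basis (X := in_tuple (codom a))) // size_codom card_ord.
have vE d : diag d -> h (santos_vector q (@snake n) (@root_A R n) d) = santos_vector q t a (act r d).
  move=> dd; rewrite !santos_vectorE //; last 2 first.
  - exact: diag_act.
  - by move=> i; rewrite (snakeE n_ge1); exact: snake_chord_diag.
  case: pickP => [i /eqP ei|no].
    rewrite linearN /= Hh /=; case: pickP => [j /eqP|/(_ (tau i))].
      by rewrite -ei (snakeE n_ge1) -Htau => /(seed_inj T0_tri) ->.
    by rewrite Htau -(snakeE n_ge1) ei eqxx.
  case: pickP => [j /eqP|_].
    rewrite -[j](f_invF tau_inj) Htau => /r_inj e.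
    have := no (invF tau_inj j); rewrite (snakeE n_ge1) e ?eqxx //.
    exact: snake_chord_diag.
  rewrite linear_sum /= [RHS](reindex tau) /=; last by exists (invF tau_inj) => i _; rewrite ?invF_f ?f_invF.
  by apply: eq_big => [i|i _]; [rewrite Htau crd_act // (snakeE n_ge1)|rewrite Hh].
exists h => //.
have cE (T D : {set chord n}) : ctri T -> D \subset T ->
    h @` conic_hull (mem D) (santos_vector q (@snake n) (@root_A R n)) =
    conic_hull (mem (act r @: D)%SET) (santos_vector q t a).
  move=> tT DT; have dD d : d \in D -> diag d by move=> dD; apply: tT.2.1; exact: (fintype.subsetP DT _ dD).
  by apply: conic_hull_map => [d e /dD dd /dD de|d /dD]; [exact: r_inj|exact: vE].
apply/seteqP; split=> [_ [T [D [/(triangulationE q_convex q_cyclic) tT DT ->]]]|].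
  exists (conic_hull (mem [set d : chord n | diag d && (act r d \in D)]%SET) (santos_vector q (@snake n) (@root_A R n))).
    exists [set d : chord n | diag d && (act r d \in T)]%SET, [set d : chord n | diag d && (act r d \in D)]%SET; split=> //.
      exact/triangulationE/ctri_preimage.
    by apply/fintype.subsetP => d; rewrite !inE => /andP[-> /(fintype.subsetP DT)].
  rewrite (cE _ _ (ctri_preimage tT)); last first.
    by apply/fintype.subsetP => d; rewrite !inE => /andP[-> /(fintype.subsetP DT)].
  suff -> : (act r @: [set d : chord n | diag d && (act r d \in D)])%SET = D by [].
  apply/finset.setP => e; apply/imsetP/idP => [[d] |eD].
    by rewrite inE => /andP[_ ?] ->.
  have [d dd ed] := act_surj r_dih (tT.2.1 _ (fintype.subsetP DT _ eD)).
  by exists d => //; rewrite inE dd ed.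
move=> _ [_ [T [D [/(triangulationE q_convex q_cyclic) tT DT ->]]] <-].
rewrite (cE T) //; exists (act r @: T)%SET, (act r @: D)%SET; split=> //.
  exact/triangulationE/ctri_act.
exact: imsetS.
Qed.

End Relabelling.

Lemma image_image (A B C : Type) (f : A -> B) (g : B -> C) (h : A -> C) (X : set A) :
  (forall x, g (f x) = h x) -> g @` (f @` X) = h @` X.
Proof.
move=> H; apply/seteqP; split=> [_ [_ [x Xx <-] <-]|_ [x Xx <-]]; first by exists x.
by exists (f x) => //; exists x.
Qed.

Lemma lfun_comp_bijective (K : fieldType) (U V W : vectType K) (g : 'Hom(V, W)) (f : 'Hom(U, V)) :
  bijective g -> bijective f -> bijective (g \o f)%VF.
Proof.
move=> bg bf; have [h h1 h2] := bij_comp bg bf.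
by exists h => x; rewrite ?comp_lfunE; [exact: h1|exact: h2].
Qed.

(** * Composing and inverting normal isomorphisms *)

Section NormalIsomorphism.
Variables (R : realType).

Lemma linearly_isomorphic_trans (U V W : vectType R) (F : set (set U)) (G : set (set V)) (H : set (set W)) :
  linearly_isomorphic F G -> linearly_isomorphic G H -> linearly_isomorphic F H.
Proof.
move=> [f [bf Hf]] [g [bg Hg]]; exists (g \o f)%VF; split; first exact: lfun_comp_bijective.
by move=> C /Hf/Hg; rewrite (@image_image _ _ _ f g (g \o f)%VF) // => x; rewrite comp_lfunE.
Qed.

Lemma linearly_isomorphic_inv (U V : vectType R) (F : set (set U)) (G : set (set V)) (f : 'Hom(U, V)) :
  bijective f -> (forall C', G C' -> exists2 C, F C & C' = f @` C) -> linearly_isomorphic G F.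
Proof.
move=> bf H; have [g [gK fK]] := lfun_bijectiveV bf; exists g; split; first by exists f.
move=> _ /H [C FC ->]; rewrite (@image_image _ _ _ f g id) //.
suff -> : id @` C = C by [].
by apply/seteqP; split=> [_ [x Cx <-]|x Cx] //; exists x.
Qed.

Lemma has_normal_fan_isomorphic (W V : vectType R) (Q : set W) (F : set (set V)) :
  has_normal_fan Q F -> linearly_isomorphic F (normal_fan Q) /\ linearly_isomorphic (normal_fan Q) F.
Proof.
move=> [f [bf eF]]; split.
  by exists f; split=> // C FC; rewrite eF; exists C.
by apply: (linearly_isomorphic_inv bf) => C'; rewrite eF => -[C FC <-]; exists C.
Qed.

Lemma normally_isomorphic_sym (W W' : vectType R) (P : set W) (Q : set W') :
  polytope P -> P !=set0 -> normally_isomorphic P Q -> normally_isomorphic Q P.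
Proof.
move=> polP P0 [g [bg Hg]]; apply: (linearly_isomorphic_inv bg).
exact: normal_fan_isomorphism_surj.
Qed.

(** The empty set counts as a polytope, with direction space 0; a positive dimension on the other
    side excludes it. *)
Lemma normally_isomorphic_neq0 (W W' : vectType R) (P : set W) (Q : set W') :
  normally_isomorphic P Q -> (0 < \dim {: conormal_space Q})%N -> P !=set0.
Proof.
move=> [g [bg _]]; rewrite (lfun_bijective_dim bg) => d0.
apply: contrapT => nP; move: d0.
have : (direction P <= 0)%VS by apply: direction_min => x y Px; case: nP; exists x.
by rewrite subv0 => /eqP P0; rewrite dim_Hom1 dimvf /dim /= P0 dimv0.
Qed.

End NormalIsomorphism.

Theorem theorem1p1 (R : realType) (n : nat) (n_ge1 : (1 <= n)%N)
    (p : (n.-1).-tuple bool -> 'I_n.+3 -> 'rV[R]_2)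
    (q : 'I_n.+3 -> 'rV[R]_2)
    (p_HL : forall s : (n.-1).-tuple bool, HL_polygon s (p s))
    (q_convex : convex_polygon q) (q_cyclic : cyclically_labelled q) :
  (exists (W : vectType R) (Q : set W), is_CFZ q Q) /\
  forall (W : vectType R) (P : set W), polytope P ->
    ((exists (s : (n.-1).-tuple bool) (T : {set 'I_n.+3 * 'I_n.+3}),
        triangulation q T /\
        normally_isomorphic P (Ass_I (p s)) /\
        exists (W' : vectType R) (Q : set W'),
          is_Ass_II q T Q /\ normally_isomorphic P Q)
     <->
     (exists (W' : vectType R) (Q : set W'),
        is_CFZ q Q /\ normally_isomorphic P Q)).
Proof.
split; first exact: CFZ_exists.
move=> W P polP; split=> [[s [T [triT [isoA [W' [Q [[polQ [V [a [t [ba eT nfQ]]]]] isoQ]]]]]]]|].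
  (* The Santos polytope [Q] itself is shown to have the snake fan. The seed fan reaches the normal
     fan of [Ass_I (p s)] through [Q] and [P], which requires inverting the isomorphism from [P] to
     [Q]. *)
  exists W', Q; split=> //; split=> //.
  have tT : ctri [set t i | i : 'I_n]%SET by rewrite -eT; exact/(triangulationE q_convex q_cyclic).
  have P0 : P !=set0.
    apply: (normally_isomorphic_neq0 isoQ); have [f [bf _]] := nfQ.
    by rewrite (lfun_bijective_dim bf) (size_basis (X := in_tuple (codom a))) // size_codom card_ord.
  have [phi [bphi Hphi]] := linearly_isomorphic_trans (linearly_isomorphic_trans
    (has_normal_fan_isomorphic nfQ).1 (normally_isomorphic_sym polP P0 isoQ)) isoA.
  have [r dr Hr] : exists2 r, dihedral n.+3 r &
      forall k, (k < n)%N -> act r (snake_chord n k) \in [set t i | i : 'I_n]%SET.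
    apply: (seed_is_snake n_ge1 (p_HL s) ba tT (w := santos_vector q t a) _ _ bphi).
    - exact: santos_vector_seed.
    - exact: santos_vector_cross.
    move=> T' D tT' DT'; apply: Hphi; exists T', D; split=> //; exact/triangulationE.
  have [h bh eh] := relabelled_fan n_ge1 q_convex q_cyclic ba tT dr Hr.
  have [f [bf ef]] := nfQ; exists (f \o h)%VF; split; first exact: lfun_comp_bijective.
  rewrite ef eh; apply: image_image => C; apply: image_image => x; by rewrite comp_lfunE.
move=> [W' [Q [[polQ nfQ] isoQ]]].
(* The alternating signs and the snake itself are common to both families. *)
exists (alt_signs n), [set snake_chord n i | i : 'I_n]%SET; split; [|split].
- exact/triangulationE/ctri_snake_set.
- apply: linearly_isomorphic_trans isoQ _.
  apply: linearly_isomorphic_trans (has_normal_fan_isomorphic nfQ).2 _.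
  apply: (has_normal_fan_isomorphic _).1.
  exact: (alternating_Ass_I_fan n_ge1 q_convex q_cyclic (@root_A_basis R n) (p_HL _)).
exists W', Q; split=> //; split=> //.
exists (subvs_of (sum_zero R n)), (@root_A R n), (@snake n); split=> //.
- exact: root_A_basis.
- by apply: eq_imset => i; rewrite snakeE.
Qed.
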